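(* Let $T>0$, let $d,e\ge 1$ be integers, let $1\le q<2$ and $q-1<\gamma\le 1$. Let $F:\mathbb{R}^e\to\mathcal{K}(\mathbb{R}^{e\times d})$ be $\gamma$-Hölder, and set $\Omega=\mathbb{R}^e\times\mathcal{V}^q([0,T]\to\mathbb{R}^d)$. Then for every $\omega=(\xi,x)\in\Omega$ there exists a global solution $z(\omega)\in\mathcal{V}^q([0,T]\to\mathbb{R}^e)$ to the Young differential inclusion $\mathrm{d}z_t\in F(z_t)\,\mathrm{d}x_t$ started at $\xi$, with velocity $v(\omega)\in\mathbf{V}^{q/\gamma+}([0,T]\to\mathbb{R}^{e\times d})$. Moreover, these can be chosen in such a way that the maps $\omega\mapsto z(\omega)$ and $\omega\mapsto v(\omega)$ are measurable from $\Omega$ to their target path spaces.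
   Context: $\mathbb{R}^{e\times d}$ is the space of real $e\times d$ matrices. For a topological space $Y$, $\mathcal{K}(Y)$ is the set of nonempty compact subsets of $Y$; $\mathcal{K}(\mathbb{R}^{e\times d})$ carries the Hausdorff distance $h$. $F$ is $\gamma$-Hölder if $H_\gamma(F)=\sup_{a\ne b}h(F(a),F(b))/|a-b|^\gamma<\infty$. For a path $x:E\to X$ with $E\subseteq\mathbb{R}$, $X$ a normed space, and $F'\subseteq E$, $V_p(x,F')=\sup\big(\sum_{k=1}^n|x_{\sigma_k}-x_{\sigma_{k-1}}|^p\big)^{1/p}$, the supremum being over all finite sets $\sigma_0<\dots<\sigma_n$ in $F'$; $V_p(x)=V_p(x,E)$. $V^p(E\to X)$ is the set of paths with $V_p(x)<\infty$; $V^p_{\rm loc}$ the set of paths having finite $p$-variation on every compact subset of $E$; $\mathcal{V}^p$ (resp. $\mathcal{V}^p_{\rm loc}$) the subset of continuous paths of $V^p$ (resp. $V^p_{\rm loc}$); $\mathbf{V}^p$ the subset of càdlàg (right-continuous with left limits) paths of $V^p$; $\mathbf{V}^{r+}=\bigcap_{p>r}\mathbf{V}^p$. Young integral: if $x$ is continuous of finite $q$-variation and $v$ has finite $p$-variation with $1/p+1/q>1$ on $[0,t]$, $\int_0^t v_s\,\mathrm{d}x_s$ is the limit of $\sum_k v_{\sigma_{k-1}}(x_{\sigma_k}-x_{\sigma_{k-1}})$ over subdivisions $0=\sigma_0<\dots<\sigma_n=t$ as the mesh tends to $0$. Solution: for $\xi\in U$ ($U\subseteq\mathbb{R}^e$ open,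 here $U=\mathbb{R}^e$) and $x\in\mathcal{V}^q([0,T]\to\mathbb{R}^d)$, a solution started from $\xi$ on $I=[0,T_*]$, $T_*\le T$, to $\mathrm{d}z_t\in F(z_t)\,\mathrm{d}x_t$ is a path $z\in\mathcal{V}^q_{\rm loc}(I\to U)$ such that there is $v\in V^p_{\rm loc}(I\to\mathbb{R}^{e\times d})$, for some $p\ge1$ with $1/p+1/q>1$, satisfying for all $t\in I$: $z_t=\xi+\int_0^t v_s\,\mathrm{d}x_s$ and $v_t\in F(z_t)$. One then says $z$ is a solution with velocity $v$. A global solution is a solution defined on all of $[0,T]$. Measurability: subsets of $\mathbb{R}^k$ carry the Borel $\sigma$-algebra; every path space (a subset of $(\mathbb{R}^k)^{[0,T]}$) carries the cylindrical $\sigma$-algebra, i.e. the smallest one making all evaluations $x\mapsto x_t$, $t\in[0,T]$, measurable; $\Omega$ carries the product $\sigma$-algebra. *)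

(* Defs.v *)
From HB Require Import structures.
From mathcomp Require Import all_boot all_order all_algebra.
From mathcomp Require Import all_classical all_reals all_analysis.

Set Implicit Arguments.
Unset Strict Implicit.
Unset Printing Implicit Defensive.
Import Order.TTheory GRing.Theory Num.Theory.
Import numFieldNormedType.Exports.

Local Open Scope classical_set_scope.
Local Open Scope ring_scope.

(* Real e x d matrices are 'M[R]_(e, d) and R^k is
   'cV[R]_k, with the library norm (the maximum of the absolute values of the
   entries).  All norms being equivalent in finite dimension, the notions below
   (finite p-variation, Hoelder continuity, Young integral) do not depend on
   that choice. *)

Section set_valued_maps.
Context {R : realType}.

Definition nonempty_compacts (Y : topologicalType) : set (set Y) :=
  [set A | A !=set0 /\ compact A].

Definition hausdorff_dist (Y : pseudoMetricType R) (A B : set Y) : \bar R :=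
  maxe (ereal_sup [set edist_inf B a | a in A])
       (ereal_sup [set edist_inf A b | b in B]).

(* The constant H_gamma(F). *)
Definition holder_const (X Y : normedModType R) (gamma : R) (F : X -> set Y) :
    \bar R :=
  ereal_sup [set y | exists a b, a != b /\
    y = (hausdorff_dist (F a) (F b) * ((`|a - b| `^ gamma)^-1)%:E)%E].

Definition holder (X Y : normedModType R) (gamma : R) (F : X -> set Y) : Prop :=
  (holder_const gamma F < +oo)%E.

End set_valued_maps.

(* A path defined on E is a function on the subtype associated with E, which
   carries the topology induced by that of R. *)
Section paths.
Context {R : realType} {E : set R} {X : normedModType R}.
Implicit Types (p r : R) (x : E -> X) (A : set E).

(* Only the values s 0, ..., s n matter. *)
Definition increasing_upto n (s : nat -> E) : Prop :=
  forall k, (k < n)%N -> set_val (s k) < set_val (s k.+1).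

Definition pvariation p x A : \bar R :=
  ereal_sup [set y | exists n (s : nat -> E),
    [/\ forall k, (k <= n)%N -> A (s k),
        increasing_upto n s &
        y = ((\sum_(k < n) `|x (s k.+1) - x (s k)| `^ p) `^ p^-1)%:E]].

Definition finite_pvar p : set (E -> X) :=
  [set x | (pvariation p x setT < +oo)%E].

Definition finite_pvar_loc p : set (E -> X) :=
  [set x | forall A, compact A -> (pvariation p x A < +oo)%E].

Definition continuous_pvar p : set (E -> X) :=
  finite_pvar p `&` [set x | continuous x].

Definition continuous_pvar_loc p : set (E -> X) :=
  finite_pvar_loc p `&` [set x | continuous x].

(* At a point t which is not a limit from the left, the filter in the second
   clause is improper, and the clause holds trivially. *)
Definition cadlag x : Prop :=
  (forall t : E,
     x s @[s --> within [set s : E | set_val t <= set_val s] (nbhs t)] --> x t)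
  /\ (forall t : E, exists l : X,
     x s @[s --> within [set s : E | set_val s < set_val t] (nbhs t)] --> l).

Definition cadlag_pvar p : set (E -> X) := finite_pvar p `&` [set x | cadlag x].

Definition cadlag_pvar_plus r : set (E -> X) :=
  [set x | forall p, r < p -> cadlag_pvar p x].

Lemma finite_pvar_cst p : finite_pvar p (cst 0).
Proof.
apply: (@le_lt_trans _ _ (1 : R)%:E); last exact: ltry.
apply: ge_ereal_sup => _ [n [s [_ _ ->]]]; rewrite lee_fin.
have [->|p0] := eqVneq p 0; first by rewrite invr0 powRr0.
rewrite big1 => [|k _]; last by rewrite subrr normr0 powR0.
by rewrite powR0 ?ler01// invr_neq0.
Qed.

Lemma continuous_pvar_cst p : continuous_pvar p (cst 0).
Proof. by split; [exact: finite_pvar_cst|exact: cst_continuous]. Qed.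

Lemma cadlag_pvar_plus_cst r : cadlag_pvar_plus r (cst 0).
Proof.
move=> p _; split; first exact: finite_pvar_cst.
by split=> t; [exact: cvg_cst|exists 0; exact: cvg_cst].
Qed.

End paths.
Arguments finite_pvar {R} E X p.
Arguments finite_pvar_loc {R} E X p.
Arguments continuous_pvar {R} E X p.
Arguments continuous_pvar_loc {R} E X p.
Arguments cadlag_pvar {R} E X p.
Arguments cadlag_pvar_plus {R} E X r.

Section measurable_spaces.
Context {R : realType}.

Definition borel (X : ptopologicalType) : Type := X.

HB.instance Definition _ (X : ptopologicalType) :=
  Measurable.copy (borel X) (g_sigma_algebraType (@open X)).

(* Here W is a type of paths and path w is the underlying path of w.  These are
   the sets [set w | B (path w t)] with B Borel, which generate the cylindrical
   sigma-algebra on W. *)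
Definition cylinders (E : set R) (X : normedModType R) (W : Type)
    (path : W -> (E -> X)) : set (set W) :=
  \bigcup_(t in [set: E])
    preimage_set_system setT (fun w => path w t : borel X) measurable.

(* The library requires measurable types to be pointed, here by the zero path. *)
Definition continuous_path_space (E : set R) (X : normedModType R) (q : R) :
  Type := continuous_pvar E X q.

HB.instance Definition _ (E : set R) (X : normedModType R) (q : R) :=
  Choice.copy (continuous_path_space E X q) (set_type (continuous_pvar E X q)).
HB.instance Definition _ (E : set R) (X : normedModType R) (q : R) :=
  isPointed.Build (continuous_path_space E X q)
    (SigSub (mem_set (@continuous_pvar_cst R E X q))).
HB.instance Definition _ (E : set R) (X : normedModType R) (q : R) :=
  Measurable.copy (continuous_path_space E X q)
    (g_sigma_algebraType
       (cylinders (fun w : continuous_path_space E X q => set_val w))).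

Definition cadlag_path_space (E : set R) (X : normedModType R) (r : R) :
  Type := cadlag_pvar_plus E X r.

HB.instance Definition _ (E : set R) (X : normedModType R) (r : R) :=
  Choice.copy (cadlag_path_space E X r) (set_type (cadlag_pvar_plus E X r)).
HB.instance Definition _ (E : set R) (X : normedModType R) (r : R) :=
  isPointed.Build (cadlag_path_space E X r)
    (SigSub (mem_set (@cadlag_pvar_plus_cst R E X r))).
HB.instance Definition _ (E : set R) (X : normedModType R) (r : R) :=
  Measurable.copy (cadlag_path_space E X r)
    (g_sigma_algebraType
       (cylinders (fun w : cadlag_path_space E X r => set_val w))).

End measurable_spaces.

Section young_inclusion.
Context {R : realType} {T : R} {d e : nat}.
Local Notation I := `[0, T]%classic.

Definition is_young_integral (v : I -> 'M[R]_(e, d)) (x : I -> 'cV[R]_d)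
    (t : I) (J : 'cV[R]_e) : Prop :=
  forall eps : R, 0 < eps -> exists2 delta : R, 0 < delta &
    forall n (s : nat -> I), increasing_upto n s ->
      set_val (s 0%N) = 0 -> s n = t ->
      (forall k, (k < n)%N -> set_val (s k.+1) - set_val (s k) < delta) ->
      `|\sum_(k < n) v (s k) *m (x (s k.+1) - x (s k)) - J| < eps.

(* z is a solution on the whole of [0, T], started from xi, with velocity v, to
   dz_t \in F(z_t) dx_t, where x is continuous with finite q-variation. *)
Definition global_solution (q : R) (F : 'cV[R]_e -> set 'M[R]_(e, d))
    (xi : 'cV[R]_e) (x : I -> 'cV[R]_d) (z : I -> 'cV[R]_e)
    (v : I -> 'M[R]_(e, d)) : Prop :=
  [/\ continuous_pvar_loc I 'cV[R]_e q z,
      exists p : R, [/\ 1 <= p, 1 < p^-1 + q^-1 &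
                        finite_pvar_loc I 'M[R]_(e, d) p v] &
      forall t : I,
        (exists2 J, is_young_integral v x t J & z t = xi + J) /\ F (z t) (v t)].

End young_inclusion.

(* Main.v *)
Require Import Defs.
From mathcomp Require Import all_boot all_order all_algebra.
From mathcomp Require Import all_classical all_reals all_analysis.
From mathcomp Require Import measurable_realfun.
From mathcomp Require Import ring lra zify.
Set Implicit Arguments.
Unset Strict Implicit.
Unset Printing Implicit Defensive.
Import Order.TTheory GRing.Theory Num.Theory.
Import numFieldNormedType.Exports.
Local Open Scope classical_set_scope.
Local Open Scope ring_scope.

(** The solution is a limit of Euler schemes whose velocities are chosen along a
binary tree of times, so that one scheme provides at once the selection of bounded
variation and the integral.

Time is first changed. For a continuous path [x] of finite q-variation, the sum of
[t] and of the q-th power of the q-variation of [x] on [0, t] is continuous and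
strictly increasing ([cumulated_continuous]). In the resulting clock, normalized to
take its values in [0, 1), the driver [y] is Hoelder continuous of exponent 1/q
([clock_driver_bound]): with [a = 2^(-1/q)], it moves by at most [M a^m] over dyadic
intervals of level [m].

In this clock, the scheme of level [n] advances by [z' = z + v (y' - y)] on the
grid of step [2^-n], and the velocity at the grid point [k] is a point of [F z_k]
nearest to the velocity at the parent of [k], obtained by clearing the lowest binary
digit of [k]. The midpoint of a dyadic interval thus has the left end of that
interval as its parent. Hence, with [b = a^gamma], the velocity oscillates by
[O(b^m)] on an interval of level [m], and splitting such an interval at its midpoint
changes the left-point value of the integral by [O((a b)^m)]. As [q < 1 + gamma]
means [2 a b < 1], these errors, two times more numerous at each level, sum up
([block_estimate]). The constants are affine in the size of the velocity, so that on
blocks of a fixed level, small enough, the velocity at most doubles up to a constant.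
There are finitely many such blocks, whence bounds that do not depend on [n]
([euler_uniform_estimate]).

The values at dyadic times being bounded, they have cluster points as [n] tends to
infinity, and the uniform estimates pass to the limit and to all times
([limit_dyadic_values], [dyadic_limit_solution]). The oscillation estimate makes the
velocity right-continuous with left limits; it also gives it finite p-variation as
soon as [2 b^p < 1], that is [p > q / gamma], because at most [2^m] consecutive pairs
of a partition are separated at level [m + 1] exactly ([velocity_variation]). The
same count, with one factor [a^m] weakened to an interpolation with the mesh, shows
that the errors of the Young sums vanish ([defect_control]).

Every step can be performed measurably: the cumulated variation is a supremum over
countably many dyadic partitions, a nearest point of a compact set and a cluster point
of a bounded sequence of vectors can be selected measurably
([measurable_nearest_point], [measurable_cluster]), and composing with the clock is
evaluating a measurable process at a measurable time. *)

(** * Entrywise measurability *)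

Section matrix_norm.
Context {R : realType}.

Lemma mx_entry_le m n (A : 'M[R]_(m, n)) i j : `|A i j| <= `|A|.
Proof.
rewrite /Num.norm/= mx_normrE.
exact: (le_bigmax_cond _ (fun ij : 'I_m * 'I_n => `|A ij.1 ij.2|) (j := (i, j))).
Qed.

Lemma mx_norm_lt m n (A : 'M[R]_(m, n)) (e : R) : 0 < e ->
  (forall i j, `|A i j| < e) -> `|A| < e.
Proof.
by move=> e0 Ae; rewrite /Num.norm/= mx_normrE; apply: bigmax_lt => // -[i j].
Qed.

Lemma mx_norm_le m n (A : 'M[R]_(m, n)) (e : R) : 0 <= e ->
  (forall i j, `|A i j| <= e) -> `|A| <= e.
Proof.
by move=> e0 Ae; rewrite /Num.norm/= mx_normrE; apply: bigmax_le => // -[i j].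
Qed.

Lemma mx_norm_mul m n p (A : 'M[R]_(m, n)) (B : 'M[R]_(n, p)) :
  `|A *m B| <= n%:R * `|A| * `|B|.
Proof.
apply: mx_norm_le => [|i j]; first by rewrite !mulr_ge0.
rewrite mxE (le_trans (ler_norm_sum _ _ _))//.
rewrite (le_trans (ler_sum _ (G := fun=> `|A| * `|B|) _))//; last first.
  by rewrite sumr_const card_ord -[leLHS]mulr_natl mulrA.
by move=> k _; rewrite normrM ler_pM// mx_entry_le.
Qed.

Lemma cvg_mx_entries m n (u : nat -> 'M[R]_(m, n)) (l : 'M[R]_(m, n)) :
  (forall i j, u k i j @[k --> \oo] --> l i j) -> u k @[k --> \oo] --> l.
Proof.
move=> ul; apply/cvgrPdist_lt => e e0.
have : \forall k \near \oo, forall ij : 'I_m * 'I_n,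
    `|l ij.1 ij.2 - u k ij.1 ij.2| < e.
  by apply: filter_forall => -[i j] /=; move/cvgrPdist_lt: (ul i j); exact.
apply: filterS => k uk; apply: mx_norm_lt => // i j.
by rewrite !mxE; exact: (uk (i, j)).
Qed.

Lemma cvg_entry m n (u : nat -> 'M[R]_(m, n)) (l : 'M[R]_(m, n)) i j :
  u k @[k --> \oo] --> l -> u k i j @[k --> \oo] --> l i j.
Proof.
move=> ul.
by apply: (cvg_comp u (fun M : 'M[R]_(m, n) => M i j) ul); exact: coord_continuous.
Qed.

Lemma exists_invn_lt (e : R) : 0 < e -> exists k, k.+1%:R^-1 < e.
Proof.
move=> e0; have [k _ /(_ k (leqnn _)) kP] := near_infty_natSinv_lt (PosNum e0).
by exists k.
Qed.

Lemma mx_rat_dense m n (M : 'M[R]_(m, n)) (e : R) : 0 < e ->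
  exists r : 'M[rat]_(m, n), `|M - map_mx ratr r| < e.
Proof.
move=> e0.
have rP i j : exists r : rat, `|M i j - ratr r| < e.
  have [|r] := @rat_in_itvoo R (M i j - e) (M i j + e); first by lra.
  by rewrite in_itv/= => /andP[r1 r2]; exists r; rewrite ltr_norml; lra.
exists (\matrix_(i, j) projT1 (cid (rP i j))).
by apply: mx_norm_lt => // i j; rewrite !mxE; case: cid.
Qed.

Lemma mx_ballE m n (x y : 'M[R]_(m, n)) (e : R) : ball x e y = (`|x - y| < e) :> Prop.
Proof. by rewrite -ball_normE. Qed.

Lemma open_countable_balls m n (U : set 'M[R]_(m, n)) : open U ->
  U = \bigcup_(rk in [set rk : 'M[rat]_(m, n) * nat |
        ball (map_mx ratr rk.1 : 'M[R]_(m, n)) rk.2.+1%:R^-1 `<=` U])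
      ball (map_mx ratr rk.1 : 'M[R]_(m, n)) rk.2.+1%:R^-1.
Proof.
move=> oU; apply/seteqP; split=> [M UM|M [rk /= sub]]; last exact: sub.
have [e /= e0 eU] : nbhs_ball M U by rewrite nbhs_ballE; exact: open_nbhs_nbhs.
have [k ke] := exists_invn_lt (divr_gt0 e0 (ltr0n R 2)).
have k0 : 0 < k.+1%:R^-1 :> R by rewrite invr_gt0.
have [r rM] := mx_rat_dense M k0.
have Br : ball (map_mx ratr r : 'M[R]_(m, n)) k.+1%:R^-1 M.
  by rewrite mx_ballE distrC.
exists (r, k) => //= N; rewrite mx_ballE => rN; apply: eU; rewrite mx_ballE.
rewrite (le_lt_trans (ler_distD (map_mx ratr r) _ _))// (lt_trans (ltrD rM rN))//=.
by rewrite [e]splitr ltrD.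
Qed.

End matrix_norm.

Section entrywise_measurability.
Context {R : realType} {d : measure_display} {Om : measurableType d}.

(** Equivalent to Borel measurability ([measurable_entries_borel]), and better suited
to matrix operations and pointwise limits. *)
Definition measurable_entries m n (f : Om -> 'M[R]_(m, n)) : Prop :=
  forall i j, measurable_fun setT (fun w => f w i j).

Lemma measurable_entries_norm m n (f : Om -> 'M[R]_(m, n)) :
  measurable_entries f -> measurable_fun setT (fun w => `|f w|).
Proof.
move=> mf; rewrite (_ : (fun w => _) = (fun w =>
  \big[Num.max/0]_(ij : 'I_m * 'I_n) `|f w ij.1 ij.2|)); last first.
  by apply/funext => w; rewrite /Num.norm/= mx_normrE.
elim: (index_enum _) => [|ij s IH].
  by under eq_fun do rewrite big_nil; exact: measurable_cst.
under eq_fun do rewrite big_cons.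
by apply: measurable_maxr => //; apply: measurableT_comp => //; exact: mf.
Qed.

Lemma measurable_entriesB m n (f g : Om -> 'M[R]_(m, n)) :
  measurable_entries f -> measurable_entries g ->
  measurable_entries (fun w => f w - g w).
Proof.
move=> mf mg i j; under eq_fun do rewrite !mxE.
exact: measurable_funB.
Qed.

Lemma measurable_entriesD m n (f g : Om -> 'M[R]_(m, n)) :
  measurable_entries f -> measurable_entries g ->
  measurable_entries (fun w => f w + g w).
Proof.
move=> mf mg i j; under eq_fun do rewrite !mxE.
exact: measurable_funD.
Qed.

Lemma measurable_entriesM m n p (f : Om -> 'M[R]_(m, n)) (g : Om -> 'M[R]_(n, p)) :
  measurable_entries f -> measurable_entries g ->
  measurable_entries (fun w => f w *m g w).
Proof.
move=> mf mg i j; under eq_fun do rewrite !mxE.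
by apply: measurable_sum => k; exact: measurable_funM.
Qed.

Lemma measurable_entries_cst m n (A : 'M[R]_(m, n)) :
  measurable_entries (fun=> A).
Proof. by move=> i j; exact: measurable_cst. Qed.

Lemma measurable_entries_cvg m n (f_ : nat -> Om -> 'M[R]_(m, n)) f :
  (forall k, measurable_entries (f_ k)) ->
  (forall w, f_ k w @[k --> \oo] --> f w) -> measurable_entries f.
Proof.
move=> mf fP i j.
apply: (measurable_fun_cvg (h := fun k w => f_ k w i j)) => [k|w _]; first exact: mf.
exact: cvg_entry.
Qed.

Lemma measurable_entries_open m n (f : Om -> 'M[R]_(m, n)) U :
  measurable_entries f -> open U -> measurable (f @^-1` U).
Proof.
move=> mf oU; rewrite (open_countable_balls oU) preimage_bigcup.
rewrite bigcup_mkcond; apply: countable_bigcupT_measurable => // rk.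
case: ifP => // _.
rewrite (_ : _ @^-1` _ = [set w | `|map_mx ratr rk.1 - f w| < rk.2.+1%:R^-1]);
  last by apply/funext => w; rewrite /preimage /= mx_ballE.
rewrite -[X in measurable X]setTI.
apply: (measurable_fun_ltr (g := cst _) _ _ measurableT _ (Y := [set true])) => //.
apply: measurable_entries_norm; exact: measurable_entriesB.
Qed.

Lemma measurable_entries_borel m n (f : Om -> 'M[R]_(m, n)) :
  measurable_entries f <->
  measurable_fun setT (f : Om -> borel 'M[R]_(m, n)).
Proof.
split=> [mf|mf i j].
  apply: (@measurability _ _ _ (borel 'M[R]_(m, n)) setT f (@open 'M[R]_(m, n))).
    by [].
  by move=> _ [U oU <-]; rewrite setTI; exact: measurable_entries_open.
apply: (measurableT_comp (f := fun M : borel 'M[R]_(m, n) => M i j)) => //.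
apply: (measurability _ (RGenOpens.measurableE R)) => _ [_ [a [b ->] <-]].
rewrite setTI; apply: sub_sigma_algebra.
apply: (@open_comp _ _ (fun M : 'M[R]_(m, n) => M i j)); last exact: interval_open.
by move=> M _; exact: coord_continuous.
Qed.

Lemma measurable_entries_continuous m n (g : 'M[R]_(m, n) -> R) f :
  continuous g -> measurable_entries f -> measurable_fun setT (g \o f).
Proof.
move=> cg mf.
apply: (measurability _ (RGenOpens.measurableE R)) => _ [_ [a [b ->] <-]].
rewrite setTI comp_preimage; apply: measurable_entries_open => //.
by apply: open_comp => //; exact: interval_open.
Qed.

(** A measurable family of measurable maps may be evaluated at a measurable
index, provided the index takes countably many values. *)
Lemma measurable_countable_index (I : countType) d' (T : measurableType d')
    (K : Om -> I) (f : I -> Om -> T) :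
  (forall k, measurable [set w | K w = k]) ->
  (forall k, measurable_fun setT (f k)) ->
  measurable_fun setT (fun w => f (K w) w).
Proof.
move=> mK mf _ Y mY; rewrite setTI.
rewrite (_ : _ @^-1` Y = \bigcup_k ([set w | K w = k] `&` f k @^-1` Y)).
  apply: countable_bigcupT_measurable => // k; apply: measurableI => //.
  by rewrite -[X in measurable X]setTI; exact: mf.
by apply/seteqP; split=> [w Yw|w [k _ [/= -> //]]]; exists (K w).
Qed.

End entrywise_measurability.

(** * Measurable cluster points *)

Section measurable_cluster_point.
Context {R : realType} {d : measure_display} {Om : measurableType d}.
Implicit Types (D : nat -> nat -> set Om) (g : nat -> Om -> R) (u : nat -> nat -> Om -> R).

(** Its supremum is the upper limit of [g n w] along the [n] at which [D m n] holds,
[m] tending to infinity with [n]. *)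
Definition frequent_below D g (w : Om) : set R :=
  [set r | forall m N, exists2 n, (N <= n)%N & D m n w /\ r < g n w].

(** [nearby u j m n w] means that the first [j] coordinates of [u n] are closer than
[1 / (m + 1)] to those of the cluster point; the next coordinate of the latter is
then an upper limit along these [n]. *)
Fixpoint nearby u j : nat -> nat -> set Om :=
  if j is j'.+1 then fun m n => nearby u j' m n `&` [set w |
    `|u n j' w - sup (frequent_below (nearby u j') (u ^~ j') w)| < m.+1%:R^-1]
  else fun _ _ => setT.

Definition cluster_point u j w : R :=
  sup (frequent_below (nearby u j) (u ^~ j) w).

Section frequent_sup.
Variables (D : nat -> nat -> set Om) (g : nat -> Om -> R).
Hypothesis mD : forall m n, measurable (D m n).
Hypothesis mg : forall n, measurable_fun setT (g n).
Hypothesis Dm : forall m m' n w, (m <= m')%N -> D m' n w -> D m n w.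
Hypothesis D_frequent : forall w m N, exists2 n, (N <= n)%N & D m n w.
Hypothesis g_bounded : forall w, exists B N, forall n, (N <= n)%N -> `|g n w| <= B.
Local Notation S := (frequent_below D g).

Lemma frequent_below_has_sup w : has_sup (S w).
Proof.
have [B [N0 gB]] := g_bounded w; split.
  exists (- B - 1) => m N; have [n] := D_frequent w m (maxn N N0).
  rewrite geq_max => /andP[Nn N0n] Dn; exists n => //; split => //.
  by have := gB _ N0n; rewrite ler_norml; lra.
exists B => r Sr; have [n N0n [_ rg]] := Sr 0%N N0.
by have := gB _ N0n; rewrite ler_norml; lra.
Qed.

Lemma frequent_belowW w (r r' : R) : r' <= r -> S w r -> S w r'.
Proof.
move=> r'r Sr m N; have [n Nn [Dn rg]] := Sr m N.
by exists n => //; split => //; exact: le_lt_trans rg.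
Qed.

Lemma frequent_sup_near w m N (e : R) : 0 < e ->
  exists2 n, (N <= n)%N & D m n w /\ `|g n w - sup (S w)| < e.
Proof.
move=> e0; have hS := frequent_below_has_sup w.
have [r Sr rS] := sup_adherent e0 hS.
have /existsNP[m0 /existsNP[N0 none]] : ~ S w (sup (S w) + e / 2).
  by move=> /(ub_le_sup hS.2); lra.
have [n] := Sr (maxn m m0) (maxn N N0).
rewrite geq_max => /andP[Nn N0n] [Dn rg].
exists n => //; split; first by apply: Dm Dn; rewrite leq_maxl.
have gle : g n w <= sup (S w) + e / 2.
  rewrite leNgt; apply/negP => lt; apply: none; exists n => //; split => //.
  by apply: Dm Dn; rewrite leq_maxr.
by rewrite ltr_norml; lra.
Qed.

Lemma measurable_frequent_below (r : R) : measurable [set w | S w r].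
Proof.
rewrite (_ : mkset _ = \bigcap_m \bigcap_N \bigcup_(n in [set n | (N <= n)%N])
    (D m n `&` [set w | r < g n w])); last first.
  apply/seteqP; split=> [w Sw m _ N _|w Sw m N].
    by have [n Nn [Dn rg]] := Sw m N; exists n.
  by have [n /= Nn [Dn rg]] := Sw m I N I; exists n.
apply: bigcapT_measurable => m; apply: bigcapT_measurable => N.
apply: bigcup_measurable => n _; apply: measurableI => //.
rewrite -[X in measurable X]setTI.
exact: (measurable_fun_ltr (measurable_cst _) (mg n) measurableT (Y := [set true])).
Qed.

Lemma measurable_frequent_sup : measurable_fun setT (fun w => sup (S w)).
Proof.
apply: (measurability _ (RGenOInfty.measurableE R)) => _ [_ [a ->] <-].
rewrite setTI (_ : _ @^-1` _ =
    \bigcup_(q in [set q : rat | a < ratr q]) [set w | S w (ratr q)]).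
  rewrite bigcup_mkcond; apply: bigcupT_measurable_rat => q; case: ifP => // _.
  exact: measurable_frequent_below.
apply/seteqP; split=> [w|w [q /= aq Sq]]; rewrite /preimage /= in_itv/= andbT.
  move=> aS; have e0 : 0 < sup (S w) - a by rewrite subr_gt0.
  have [r Sr rS] := sup_adherent e0 (frequent_below_has_sup w).
  have [|q] := @rat_in_itvoo R a r; first by lra.
  rewrite in_itv/= => /andP[aq qr]; exists q => //=.
  exact: frequent_belowW (ltW qr) Sr.
by rewrite (lt_le_trans aq)//; apply: ub_le_sup Sq; case: (frequent_below_has_sup w).
Qed.

End frequent_sup.

Lemma nearby_le u j m m' n w : (m <= m')%N -> nearby u j m' n w -> nearby u j m n w.
Proof.
elim: j => //= j IH mm' [Dn lt]; split; first exact: IH.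
by apply: lt_le_trans lt _; rewrite lef_pV2 ?posrE ?ltr0n ?ler_nat.
Qed.

Lemma nearby_dist u j k m n w : (j < k)%N -> nearby u k m n w ->
  `|u n j w - cluster_point u j w| < m.+1%:R^-1.
Proof.
elim: k => // k IH; rewrite ltnS leq_eqVlt => /orP[/eqP -> [] //|jk [Dn _]].
exact: IH.
Qed.

(** Bolzano-Weierstrass with measurable limit: the cluster point is built one
coordinate at a time, the j-th one being the upper limit of [u n j] along those
n for which the previous coordinates are already close to their limit. *)
Lemma measurable_cluster u :
  (forall n j, measurable_fun setT (u n j)) ->
  (forall w j, exists B N, forall n, (N <= n)%N -> `|u n j w| <= B) ->
  exists2 c : nat -> Om -> R, (forall j, measurable_fun setT (c j)) &
    forall w, exists2 phi : nat -> nat, (forall k, (k <= phi k)%N) &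
      forall j, u (phi k) j w @[k --> \oo] --> c j w.
Proof.
move=> mu bu; pose P j := (forall m n, measurable (nearby u j m n)) /\
  (forall w m N, exists2 n, (N <= n)%N & nearby u j m n w).
have near_le j m m' n w := @nearby_le u j m m' n w.
have mc j : P j -> measurable_fun setT (cluster_point u j).
  by case=> mD fD; apply: measurable_frequent_sup => // w; exact: bu.
have PP j : P j.
  elim: j => [|j /[dup] Pj [mD fD]]; first by split=> [m n|w m N]; [exact: measurableT|exists N].
  split=> [m n|w m N].
    apply: measurableI => //; rewrite -[X in measurable X]setTI.
    apply: (measurable_fun_ltr _ (measurable_cst _) measurableT (Y := [set true])) => //.
    apply: measurableT_comp => //; apply: measurable_funB => //; exact: mc.
  have m0 : 0 < m.+1%:R^-1 :> R by rewrite invr_gt0.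
  have [n Nn [Dn lt]] := frequent_sup_near (near_le j) fD (bu ^~ j) w m N m0.
  by exists n.
exists (cluster_point u) => [j|w]; first exact: mc.
have /choice[phi phiP] k : exists n, (k <= n)%N /\ nearby u k k n w.
  by have [n kn Dn] := (PP k).2 w k k; exists n.
exists phi => [k|j]; first by case: (phiP k).
apply/cvgrPdist_lt => e e0; have [k0 k0e] := exists_invn_lt e0.
exists (maxn j.+1 k0) => // k /=; rewrite geq_max => /andP[jk k0k].
rewrite distrC (lt_le_trans (nearby_dist jk (phiP k).2))// (le_trans _ (ltW k0e))//.
by rewrite lef_pV2 ?posrE ?ltr0n ?ler_nat.
Qed.

End measurable_cluster_point.

Section cluster_of_matrices.
Context {R : realType} {d : measure_display} {Om : measurableType d}.

Lemma measurable_cluster_mx (I : countType) m n (u : nat -> I -> Om -> 'M[R]_(m, n)) :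
  (forall k i, measurable_entries (u k i)) ->
  (forall w i, exists B N, forall k, (N <= k)%N -> `|u k i w| <= B) ->
  exists2 c : I -> Om -> 'M[R]_(m, n), (forall i, measurable_entries (c i)) &
    forall w, exists2 phi : nat -> nat, (forall k, (k <= phi k)%N) &
      forall i, u (phi k) i w @[k --> \oo] --> c i w.
Proof.
move=> mu bu; pose J : countType := (I * ('I_m * 'I_n))%type.
pose v k (j : nat) w : R := if (unpickle j : option J) is Some (i, (a, b)) then u k i w a b else 0.
have [k j|w j|c mc cP] := @measurable_cluster R _ Om v.
- rewrite /v; case: unpickle => [[i [a b]]|]; [exact: mu|exact: measurable_cst].
- rewrite /v; case: unpickle => [[i [a b]]|].
    have [B [N uB]] := bu w i; exists B, N => k Nk.
    exact: le_trans (mx_entry_le _ _ _) (uB k Nk).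
  by exists 0, 0%N => k _; rewrite normr0.
pose e i a b := pickle ((i, (a, b)) : J).
exists (fun i w => \matrix_(a, b) c (e i a b) w) => [i a b|w].
  by under eq_fun do rewrite mxE; exact: mc.
have [phi kphi phiP] := cP w; exists phi => // i.
apply: cvg_mx_entries => a b; rewrite mxE.
by have := phiP (e i a b); rewrite /v /e pickleK.
Qed.

(** Among countably many measurable candidates the first admissible one is a
measurable choice. *)
Lemma measurable_first_index (C : nat -> set Om) :
  (forall k, measurable (C k)) -> (forall w, exists k, C k w) ->
  exists2 K : Om -> nat, (forall k, measurable [set w | K w = k]) &
    forall w, C (K w) w.
Proof.
move=> mC /choice[K0 K0P].
have exC w : exists k, `[< C k w >] by exists (K0 w); exact/asboolP.
exists (fun w => ex_minn (exC w)) => [k|w]; last by case: ex_minnP => k /asboolP.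
rewrite (_ : mkset _ = C k `&` \bigcap_(i in [set i | (i < k)%N]) ~` C i).
  apply: measurableI => //; rewrite bigcap_mkcond; apply: bigcapT_measurable => i.
  by case: ifP => // _; exact: measurableC.
apply/seteqP; split=> [w /= <-|w [/= Ck less]].
  case: ex_minnP => k0 /asboolP Ck0 min; split => // i /= ik0 Ci.
  by have := min i; rewrite leqNgt ik0 => /(_ (asboolT Ci)).
case: ex_minnP => k0 /asboolP Ck0 min; apply/eqP; rewrite eqn_leq.
rewrite min/=; last exact/asboolP.
by rewrite leqNgt; apply/negP => /less; exact.
Qed.

End cluster_of_matrices.

(** * Measurable nearest points of a Hoelder set-valued map *)

Section distance_to_a_set.
Context {R : realType} {X : normedModType R}.
Implicit Types (A : set X) (x y : X).

Definition distance A x : R := inf [set `|x - u| | u in A].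

Lemma distance_le A x u : A u -> distance A x <= `|x - u|.
Proof. by move=> Au; apply: ge_inf; [exists 0 => _ [v _ <-]|exists u]. Qed.

Lemma distance_adherent A x (e : R) : A !=set0 -> 0 < e ->
  exists2 u, A u & `|x - u| < distance A x + e.
Proof.
move=> [u0 Au0] e0.
have [|_ [u Au <-] lt] := @inf_adherent R [set `|x - u| | u in A] e e0; last by exists u.
by split; [exists `|x - u0|, u0|exists 0 => _ [v _ <-]].
Qed.

Lemma distance_ler A x y : A !=set0 -> distance A x <= `|x - y| + distance A y.
Proof.
move=> A0; apply/ler_addgt0Pr => e e0.
have [u Au lt] := distance_adherent y A0 e0.
rewrite (le_trans (distance_le _ Au))// (le_trans (ler_distD y _ _))//.
by rewrite -addrA lerD2l ltW.
Qed.

Lemma distance_closed A x : closed A -> A !=set0 -> distance A x <= 0 -> A x.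
Proof.
move=> cA A0 d0; apply: cA => U /nbhs_ballP[e /= e0 eU].
have [u Au lt] := distance_adherent x A0 e0; exists u; split => //.
by apply: eU; rewrite -ball_normE /=; apply: lt_le_trans lt _; lra.
Qed.

End distance_to_a_set.

Section hoelder_set_valued.
Context {R : realType} {X Y : normedModType R}.
Variables (gamma : R) (F : X -> set Y).

(** Hoelder continuity for the Hausdorff distance, in the form in which it is
used: a value at [a] can be followed to [b] at the cost of [H |a - b|^gamma]. *)
Definition hoelder_bound (H : R) : Prop :=
  forall a b w, F a w -> distance (F b) w <= H * `|a - b| `^ gamma.

Lemma holder_hoelder_bound : (forall a, F a !=set0) -> holder gamma F ->
  exists2 H : R, 0 <= H & hoelder_bound H.
Proof.
move=> F0 hF; have [K KP] : exists K : R, (holder_const gamma F <= K%:E)%E.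
  move: hF; rewrite /holder; case: holder_const => [r|//|] _; first by exists r.
  by exists 0; rewrite leNye.
exists `|K| => // a b w Faw; have cmp r : (edist_inf (F b) w <= r%:E)%E -> distance (F b) w <= r.
  move=> wr; apply/ler_addgt0Pr => e e0.
  have : (edist_inf (F b) w < (r + e)%:E)%E.
    by rewrite (le_lt_trans wr)// lte_fin ltrDl.
  move=> /ereal_inf_lt[_ [u Fu <-]] /edist_lt_ball/=; rewrite -ball_normE/= => wu.
  exact: le_trans (distance_le _ Fu) (ltW wu).
have [<-|ab] := eqVneq a b.
  rewrite (le_trans (distance_le _ Faw))// subrr normr0.
  by rewrite mulr_ge0 ?powR_ge0.
have ab0 : 0 < `|a - b| `^ gamma by rewrite powR_gt0// normr_gt0 subr_eq0.
apply: cmp; have : (hausdorff_dist (F a) (F b) <= (`|K| * `|a - b| `^ gamma)%:E)%E.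
  rewrite EFinM -lee_pdivrMr// .
  rewrite (@le_trans _ _ K%:E)//; last by rewrite lee_fin ler_norm.
  by apply: le_trans KP; apply: ereal_sup_ubound; exists a, b.
by apply: le_trans; rewrite /hausdorff_dist le_max; apply/orP; left;
  apply: ereal_sup_ubound; exists w.
Qed.

End hoelder_set_valued.

Section hoelder_values.
Context {R : realType} {X Y : normedModType R}.
Variables (gamma H : R) (F : X -> set Y).
Hypothesis gamma0 : 0 < gamma.
Hypothesis H0 : 0 <= H.
Hypothesis F0 : forall a, F a !=set0.
Hypothesis cF : forall a, closed (F a).
Hypothesis FH : hoelder_bound gamma F H.

Lemma powR_small (e : R) : 0 < e -> exists2 dl, 0 < dl &
  forall x, 0 <= x -> x < dl -> x `^ gamma < e.
Proof.
move=> e0; exists (e `^ gamma^-1); first by rewrite powR_gt0.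
move=> x x0 xe; have -> : e = (e `^ gamma^-1) `^ gamma.
  by rewrite -powRrM mulVf ?gt_eqF// powRr1// ltW.
by rewrite gt0_ltr_powR// nnegrE ?powR_ge0.
Qed.

Lemma distance_hoelder a b x :
  distance (F b) x <= distance (F a) x + H * `|a - b| `^ gamma.
Proof.
apply/ler_addgt0Pr => e e0; have [u Fu lt] := distance_adherent x (F0 a) e0.
rewrite (le_trans (distance_ler x u (F0 b)))//.
by have := FH b Fu; lra.
Qed.

Lemma distance_value_continuous x : continuous (fun a => distance (F a) x).
Proof.
move=> a; apply/cvgrPdist_lt => e e0.
have e1 : 0 < e / (H + 1) by rewrite divr_gt0// ltr_wpDl.
have [dl dl0 dlP] := powR_small e1.
near=> b; have ab : `|a - b| < dl.
  by near: b; apply/nbhs_ballP; exists dl => //= y; rewrite -ball_normE.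
have ab0 := powR_ge0 (`|a - b|) gamma.
have : H * `|a - b| `^ gamma < e.
  have := dlP _ (normr_ge0 _) ab; rewrite ltr_pdivlMr ?ltr_wpDl//.
  by apply: le_lt_trans; rewrite mulrC ler_wpM2l// lerDl.
have := distance_hoelder a b x; have := distance_hoelder b a x.
by rewrite (distrC b a) ltr_norml; lra.
Unshelve. all: by end_near. Qed.

Lemma hoelder_closed_graph (a_ : nat -> X) (w_ : nat -> Y) a w :
  (\forall k \near \oo, F (a_ k) (w_ k)) ->
  a_ k @[k --> \oo] --> a -> w_ k @[k --> \oo] --> w -> F a w.
Proof.
move=> Fk ca cw; apply: distance_closed => //; apply/ler_addgt0Pr => e e0; rewrite add0r.
have e1 : 0 < e / 2 / (H + 1) by rewrite !divr_gt0// ltr_wpDl.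
have [dl dl0 dlP] := powR_small e1.
near \oo => k.
have ka : `|a_ k - a| < dl by rewrite distrC; near: k; exact: cvgr_dist_lt ca _ dl0.
have kw : `|w - w_ k| < e / 2 by near: k; apply: cvgr_dist_lt cw _ _; lra.
have Fak : F (a_ k) (w_ k) by near: k.
have : H * `|a_ k - a| `^ gamma <= e / 2.
  have := dlP _ (normr_ge0 _) ka; rewrite ltr_pdivlMr ?ltr_wpDl// => /ltW.
  by apply: le_trans; rewrite mulrC ler_wpM2l ?powR_ge0// lerDl.
by have := FH a Fak; have := distance_ler w (w_ k) (F0 a); lra.
Unshelve. all: by end_near. Qed.

End hoelder_values.

Section nearest_point_selection.
Context {R : realType} {m n p r : nat}.
Variables (gamma H : R) (F : 'M[R]_(m, n) -> set 'M[R]_(p, r)).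
Hypothesis gamma0 : 0 < gamma.
Hypothesis H0 : 0 <= H.
Hypothesis F0 : forall a, F a !=set0.
Hypothesis cF : forall a, closed (F a).
Hypothesis FH : hoelder_bound gamma F H.

Lemma distance_lt_rat (A : set 'M[R]_(p, r)) x s : A !=set0 ->
  distance A x < s <->
  exists q : 'M[rat]_(p, r), `|x - map_mx ratr q| + distance A (map_mx ratr q) < s.
Proof.
move=> A0; split=> [lt|[q]]; last exact/le_lt_trans/distance_ler.
have e0 : 0 < (s - distance A x) / 2 by lra.
have [q qx] := mx_rat_dense x e0; exists q.
by have := distance_ler (map_mx ratr q) x A0; rewrite distrC; lra.
Qed.

(** The infimum that defines the distance may be taken over rational matrices [q],
once [`|w - q|] is added to the distance of [q] ([distance_lt_rat]); for fixed [q] the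
distance to [F a] is continuous in [a]. *)
Lemma measurable_distance_value d (Om : measurableType d) a w :
  measurable_entries (a : Om -> _) -> measurable_entries (w : Om -> _) ->
  measurable_fun setT (fun t => distance (F (a t)) (w t)).
Proof.
move=> ma mw; apply: (measurability _ (RGenInftyO.measurableE R)) => _ [_ [s ->] <-].
rewrite setTI (_ : _ @^-1` _ = \bigcup_q [set t |
    `|w t - map_mx ratr q| + distance (F (a t)) (map_mx ratr q) < s]).
  apply: countable_bigcupT_measurable => // q; rewrite -[X in measurable X]setTI.
  apply: (measurable_fun_ltr _ (measurable_cst s) measurableT (Y := [set true])) => //.
  apply: measurable_funD.
    by apply/measurable_entries_norm/measurable_entriesB => //; exact: measurable_entries_cst.
  apply: (measurable_entries_continuous (g := fun a => distance (F a) _)) => //.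
  exact: (distance_value_continuous gamma0 H0).
apply/seteqP; split=> t; rewrite /preimage/= in_itv/=.
  by move/(distance_lt_rat _ _ (F0 _)) => [q]; exists q.
by move=> [q _ /= lt]; apply/(distance_lt_rat _ _ (F0 _)); exists q.
Qed.

(** Near-minimal rational matrices are chosen measurably; any of their cluster
points lies in the closed set and minimizes the distance. *)
Lemma measurable_nearest_point d (Om : measurableType d) a w :
  measurable_entries (a : Om -> _) -> measurable_entries (w : Om -> _) ->
  exists2 c : Om -> 'M[R]_(p, r), measurable_entries c &
    forall t, F (a t) (c t) /\ `|c t - w t| <= distance (F (a t)) (w t).
Proof.
move=> ma mw; pose D t := distance (F (a t)) (w t).
pose Q (i : nat) : 'M[R]_(p, r) := map_mx ratr (odflt 0 (unpickle i : option 'M[rat]_(p, r))).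
pose C k i := [set t | distance (F (a t)) (Q i) < k.+1%:R^-1] `&`
  [set t | `|w t - Q i| < D t + k.+1%:R^-1].
have mlt (f g : Om -> R) : measurable_fun setT f -> measurable_fun setT g ->
    measurable [set t | f t < g t].
  move=> mf mg; rewrite -[X in measurable X]setTI.
  exact: (measurable_fun_ltr mf mg measurableT (Y := [set true])).
have mC k i : measurable (C k i).
  apply: measurableI; apply: mlt => //.
  - by apply: measurable_distance_value => //; exact: measurable_entries_cst.
  - by apply/measurable_entries_norm/measurable_entriesB => //; exact: measurable_entries_cst.
  - by apply: measurable_funD => //; exact: measurable_distance_value.
have exC k t : exists i, C k i t.
  have e0 : 0 < k.+1%:R^-1 / 2 :> R by rewrite divr_gt0.
  have [u Fu uw] := distance_adherent (w t) (F0 (a t)) e0.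
  have [q qu] := mx_rat_dense u e0; exists (pickle q); rewrite /C /Q pickleK/=.
  have k2 : k.+1%:R^-1 / 2 < k.+1%:R^-1 :> R by rewrite [ltRHS]splitr ltrDl.
  split=> /=.
    by rewrite (le_lt_trans (distance_le _ Fu))// distrC (lt_trans qu).
  rewrite (le_lt_trans (ler_distD u _ _))// [k.+1%:R^-1]splitr addrA ltrD//.
pose g k := projT1 (cid2 (measurable_first_index (mC k) (exC k))).
have mg k i : measurable [set t | g k t = i] by rewrite /g; case: cid2.
have gC k t : C k (g k t) t by rewrite /g; case: cid2.
have [||c mc cP] := @measurable_cluster_mx R _ Om unit _ _ (fun k _ t => Q (g k t)).
- move=> k _ i j; apply: (measurable_countable_index (mg k)
    (f := fun q _ => Q q i j)) => q; exact: measurable_cst.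
- move=> t _; exists (`|w t| + (D t + 1)), 0%N => k _.
  have [_ /ltW le] := gC k t.
  rewrite -[Q _](subrK (w t)) addrC (le_trans (ler_normD _ _))// lerD2l distrC.
  rewrite (le_trans le)// lerD2l invf_le1// ler1n//.
exists (c tt) => // t; have [phi kphi /(_ tt) phiP] := cP t.
have small (e : R) : 0 < e -> exists k, (phi k).+1%:R^-1 < e /\ `|c tt t - Q (g (phi k) t)| < e.
  move=> e0; have [k0 k0e] := exists_invn_lt e0.
  near \oo => k; exists k; split; last by near: k; exact: cvgr_dist_lt phiP _ e0.
  apply: le_lt_trans k0e; rewrite lef_pV2 ?posrE ?ltr0n// ler_nat ltnS.
  by apply: leq_trans (kphi k); near: k; exists k0.
split.
  apply: distance_closed => //; apply/ler_addgt0Pr => e e0; rewrite add0r.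
  have e2 : 0 < e / 2 by lra.
  have [k [k1 k2]] := small _ e2; have [/= /ltW Fk _] := gC (phi k) t.
  rewrite (le_trans (distance_ler _ (Q (g (phi k) t)) (F0 _)))//.
  by rewrite [leRHS]splitr lerD ?ltW// (le_lt_trans Fk).
apply/ler_addgt0Pr => e e0; have e2 : 0 < e / 2 by lra.
have [k [k1 k2]] := small _ e2; have [_ /= lt] := gC (phi k) t.
rewrite (le_trans (ler_distD (Q (g (phi k) t)) _ _))//.
by rewrite [e]splitr addrC addrA lerD// ?ltW// distrC (lt_le_trans lt)// lerD2l ltW.
Unshelve. all: by end_near. Qed.

(** Applied to the two projections of the product space, the previous lemma yields a
single Borel selector, which can be composed with any measurable data. *)
Lemma nearest_point_selector :
  exists pi : 'M[R]_(m, n) -> 'M[R]_(p, r) -> 'M[R]_(p, r),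
    (forall a w, F a (pi a w) /\ `|pi a w - w| <= distance (F a) w) /\
    forall d (Om : measurableType d) a w,
      measurable_entries (a : Om -> _) -> measurable_entries (w : Om -> _) ->
      measurable_entries (fun t => pi (a t) (w t)).
Proof.
pose Om := (borel 'M[R]_(m, n) * borel 'M[R]_(p, r))%type.
have m1 : measurable_entries (fst : Om -> 'M[R]_(m, n)).
  by apply/measurable_entries_borel; exact: measurable_fst.
have m2 : measurable_entries (snd : Om -> 'M[R]_(p, r)).
  by apply/measurable_entries_borel; exact: measurable_snd.
have [c mc cP] := measurable_nearest_point m1 m2.
exists (fun a w => c (a, w)); split=> [a w|d Om' a w ma mw i j]; first exact: (cP (a, w)).
apply: (measurableT_comp (mc i j)).
by apply: measurable_fun_pair; exact/measurable_entries_borel.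
Qed.

End nearest_point_selection.

(** * Dyadic floors and powers *)

Section dyadic_floor.
Context {R : realType}.

Definition dyadic_floor (k : nat) (u : R) : nat := Num.truncn (2 ^+ k * u).
Definition dyadic (k i : nat) : R := i%:R / 2 ^+ k.

Lemma dyadic_floor_itv k (u : R) : 0 <= u ->
  dyadic k (dyadic_floor k u) <= u < dyadic k (dyadic_floor k u).+1.
Proof.
move=> u0; have k0 : (0 : R) < 2 ^+ k by rewrite exprn_gt0.
have := truncn_itv (mulr_ge0 (ltW k0) u0).
by rewrite /dyadic /dyadic_floor ler_pdivrMr// ltr_pdivlMr// mulrC.
Qed.

Lemma le_dyadic k i j : (i <= j)%N -> dyadic k i <= dyadic k j.
Proof. by move=> ij; rewrite /dyadic ler_wpM2r// ?ler_nat// invr_ge0 exprn_ge0. Qed.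

Lemma dyadic_ge0 k i : 0 <= dyadic k i.
Proof. by rewrite /dyadic divr_ge0// exprn_ge0. Qed.

Lemma dyadicS k i : dyadic k i.+1 = dyadic k i + 2 ^- k.
Proof. by rewrite /dyadic -natr1 mulrDl mul1r. Qed.

Lemma dyadic_floor_near k (u : R) : 0 <= u ->
  u - 2 ^- k < dyadic k (dyadic_floor k u) <= u.
Proof.
move=> u0; have /andP[le] := dyadic_floor_itv k u0.
by rewrite dyadicS le andbT ltrBlDr.
Qed.

Lemma cvg_dyadic_floor (u : R) : 0 <= u ->
  dyadic k (dyadic_floor k u) @[k --> \oo] --> u.
Proof.
move=> u0; apply/cvgrPdist_lt => e e0.
near=> k; have /andP[l1 l2] := dyadic_floor_near k u0.
rewrite ger0_norm ?subr_ge0// ltrBlDl -ltrBlDr (lt_trans _ l1)// ltrD2l ltrN2.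
near: k; have := near_infty_natSinv_expn_lt (PosNum e0).
by apply: filterS => k; rewrite mul1r.
Unshelve. all: by end_near. Qed.

End dyadic_floor.

Section power_continuity.
Context {R : realType}.

Lemma cvg_powR (q : R) (v : nat -> R) l : 0 < q -> (forall k, 0 <= v k) ->
  v k @[k --> \oo] --> l -> v k `^ q @[k --> \oo] --> l `^ q.
Proof.
move=> q0 v0 vl; have l0 : 0 <= l.
  by rewrite -(cvg_lim _ vl)//; apply: limr_ge; [exact: cvgP vl|exact: nearW].
have [lz|lnz] := eqVneq l 0.
  rewrite lz powR0 ?gt_eqF//; apply/cvgrPdist_lt => e e0.
  have [dl dl0 dlP] := powR_small q0 e0.
  have vs : \forall k \near \oo, `|0 - v k| < dl.
    by apply: cvgr_dist_lt => //; rewrite -lz.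
  apply: filterS vs => k; rewrite !sub0r !normrN ger0_norm// => vk.
  by rewrite ger0_norm ?powR_ge0// dlP.
have lp : 0 < l by rewrite lt_neqAle eq_sym lnz.
apply: (cvg_comp v (fun z : R => z `^ q) vl).
have /derivable1_diffP/differentiable_continuous : derivable (fun z : R => z `^ q) l 1.
  by apply: derivable_powR; rewrite in_itv/= lp.
exact.
Qed.

(** A substitute for the modulus of continuity of the power: the factor of [r `^ q]
can be made as close to one as needed. One of [dl <= la * r] and
[r <= la^-1 * dl] holds. *)
Lemma powRD_split (q r dl la : R) : 0 <= q -> 0 <= r -> 0 <= dl -> 0 < la ->
  (r + dl) `^ q <= (1 + la) `^ q * r `^ q + (1 + la^-1) `^ q * dl `^ q.
Proof.
move=> q0 r0 dl0 la0; have la1 : 0 <= la^-1 by rewrite invr_ge0 ltW.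
have [le|lt] := leP dl (la * r).
  rewrite (@le_trans _ _ (((1 + la) * r) `^ q))//.
    by apply: ge0_ler_powR => //; rewrite ?nnegrE; nra.
  by rewrite powRM// ?lerDl ?mulr_ge0 ?powR_ge0//; lra.
rewrite (@le_trans _ _ (((1 + la^-1) * dl) `^ q))//.
  apply: ge0_ler_powR => //; rewrite ?nnegrE; [lra|by apply: mulr_ge0; lra|].
  by rewrite mulrDl mul1r addrC lerD2l mulrC ler_pdivlMr// mulrC ltW.
by rewrite powRM// ?lerDr ?mulr_ge0 ?powR_ge0//; lra.
Qed.

End power_continuity.

(** * The clock of a path of finite variation *)

Section clock.
Context {R : realType} {X : normedModType R}.
Implicit Types (x : R -> X) (q : R) (l : seq R).

(** The points of the partition are [a] followed by those of the list. *)
Fixpoint power_sum q x (a : R) l : R :=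
  if l is b :: l' then `|x b - x a| `^ q + power_sum q x b l' else 0.

Lemma power_sum_ge0 q x a l : 0 <= power_sum q x a l.
Proof. by elim: l a => //= b l IH a; rewrite addr_ge0 ?powR_ge0. Qed.

Lemma power_sum_cat q x a l1 l2 :
  power_sum q x a (l1 ++ l2) = power_sum q x a l1 + power_sum q x (last a l1) l2.
Proof. by elim: l1 a => /= [|b l1 IH] a; rewrite ?add0r// IH addrA. Qed.

Lemma cvg_power_sum q x (phi : nat -> R -> R) a l : 0 < q -> continuous x ->
  (forall s, s \in a :: l -> phi k s @[k --> \oo] --> s) ->
  power_sum q x (phi k a) (map (phi k) l) @[k --> \oo] --> power_sum q x a l.
Proof.
move=> q0 cx; elim: l a => /= [|b l IH] a phiP; first exact: cvg_cst.
have xphi s : s \in [:: a, b & l] -> x (phi k s) @[k --> \oo] --> x s.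
  by move=> /phiP ps; apply: continuous_cvg => //; exact: cx.
apply: cvgD; last by apply: IH => s sl; apply: phiP; rewrite inE sl orbT.
apply: cvg_powR => //; apply: cvg_norm.
by apply: cvgB; apply: xphi; rewrite !inE eqxx ?orbT.
Qed.

Definition power_sums q x (t : R) : set R :=
  [set s | exists2 l, path <=%R 0 l /\ last 0 l <= t & s = power_sum q x 0 l].

(** The q-th power of the q-variation of [x] on [0, t]. *)
Definition cumulated q x (t : R) : R := sup (power_sums q x t).

Lemma path_le_last (a : R) l : path <=%R a l -> a <= last a l.
Proof. by elim: l a => //= b l IH a /andP[ab /IH]; exact: le_trans. Qed.

Section bounded.
Variables (q : R) (x : R -> X) (C : R).
Hypothesis q12 : 1 <= q < 2.
Hypothesis cx : continuous x.
Hypothesis xC : forall l, path <=%R 0 l -> power_sum q x 0 l <= C.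
Local Notation W := (cumulated q x).

Let q0 : 0 < q. Proof. by case/andP: q12 => + _; apply: lt_le_trans. Qed.

Lemma power_sums_has_sup t : 0 <= t -> has_sup (power_sums q x t).
Proof.
move=> t0; split; first by exists 0, [::].
by exists C => _ [l [pl _] ->]; exact: xC.
Qed.

Lemma le_cumulated l t : path <=%R 0 l -> last 0 l <= t ->
  power_sum q x 0 l <= W t.
Proof.
move=> pl lt; apply: ub_le_sup; last by exists l.
by exists C => _ [l' [pl' _] ->]; exact: xC.
Qed.

Lemma cumulated_ge0 t : 0 <= W t.
Proof.
have [t0|t0] := leP 0 t; first exact: (@le_cumulated [::]).
rewrite /cumulated (_ : power_sums _ _ _ = set0) ?sup0//.
rewrite -subset0 => _ [l [/path_le_last pl lt] _] /=.
by move: (le_lt_trans (le_trans pl lt) t0); rewrite ltxx.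
Qed.

Lemma cumulated_adherent t (e : R) : 0 <= t -> 0 < e ->
  exists l, [/\ path <=%R 0 l, last 0 l <= t & W t - e < power_sum q x 0 l].
Proof.
move=> t0 e0; have [_ [l [pl lt] -> le]] := sup_adherent e0 (power_sums_has_sup t0).
by exists l.
Qed.

Lemma cumulated_append s t l : 0 <= s -> path <=%R s l -> last s l <= t ->
  W s + power_sum q x s l <= W t.
Proof.
move=> s0 pl lt; apply/ler_addgt0Pr => e e0.
have [l0 [pl0 l0s le]] := cumulated_adherent s0 e0.
have : power_sum q x 0 (l0 ++ s :: l) <= W t.
  apply: le_cumulated; first by rewrite cat_path pl0 /= l0s pl.
  by rewrite last_cat.
rewrite power_sum_cat /=.
by have := powR_ge0 (`|x s - x (last 0 l0)|) q; lra.
Qed.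

Lemma cumulated_increment s t : 0 <= s -> s <= t ->
  `|x t - x s| `^ q <= W t - W s.
Proof.
move=> s0 st; have := @cumulated_append s t [:: t] s0.
by rewrite /= st addr0 => /(_ erefl (lexx _)); lra.
Qed.

Lemma cumulated_le0 t : t <= 0 -> W t = 0.
Proof.
move=> t0; apply/eqP; rewrite eq_le cumulated_ge0 andbT.
have [lt|] := ltP t 0.
  rewrite /cumulated (_ : power_sums _ _ _ = set0) ?sup0//.
  rewrite -subset0 => _ [l [/path_le_last pl lt'] _] /=.
  by move: (le_lt_trans (le_trans pl lt') lt); rewrite ltxx.
move=> t0'; have {t0 t0'} -> : t = 0 by apply/eqP; rewrite eq_le t0.
apply: ge_sup; first by exists 0, [::].
move=> _ [l [pl l0] ->].
suff : forall a, a = 0 -> path <=%R a l -> last a l <= 0 -> power_sum q x a l = 0.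
  by move=> /(_ _ erefl pl l0) ->.
elim: {pl l0} l => //= b l IH a -> /andP[b0 pl] l0.
have {}b0 : b = 0 by apply/eqP; rewrite eq_le b0 (le_trans (path_le_last pl)).
by rewrite (IH b)// b0 subrr normr0 powR0 ?addr0// gt_eqF.
Qed.

Lemma le_cumulated_homo s t : s <= t -> W s <= W t.
Proof.
move=> st; have [s0|s0] := leP 0 s.
  by have := powR_ge0 (`|x t - x s|) q; have := cumulated_increment s0 st; lra.
by rewrite cumulated_le0 ?(ltW s0)// cumulated_ge0.
Qed.

(** A nearly optimal partition of [0, t], contracted towards 0 by a factor close to
one, lies before [t] and its sum hardly changes, by continuity of [x]. *)
Lemma cumulated_left t (e : R) : 0 < t -> 0 < e -> exists2 s, s < t & W t - e < W s.
Proof.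
move=> t0 e0; have [l [pl lt le]] := cumulated_adherent (ltW t0) e0.
pose rho (k : nat) : R := 1 - k.+1%:R^-1.
have rho0 k : 0 <= rho k by rewrite subr_ge0 invf_le1 ?ler1n.
have rhoP : rho k @[k --> \oo] --> (1 : R).
  by rewrite -[X in _ --> X]subr0; apply: cvgB; [exact: cvg_cst|exact: cvg_harmonic].
have := @cvg_power_sum q x (fun k s => rho k * s) 0 l q0 cx.
move=> /(_ _)/wrap[|cv].
  by move=> s _; rewrite -[X in _ --> X]mul1r; apply: cvgM; [exact: rhoP|exact: cvg_cst].
have near_lt := cvgr_gt _ cv _ le.
near \oo => k; exists (rho k * t).
  by rewrite -[ltRHS]mul1r ltr_pM2r// ltrBlDr ltrDl invr_gt0.
apply: (@lt_le_trans _ _ (power_sum q x (rho k * 0) [seq rho k * s | s <- l])).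
  by near: k; exact: (near_lt _).
rewrite mulr0; apply: le_cumulated.
  by rewrite -[X in path _ X]( mulr0 (rho k)) (homo_path (f := *%R (rho k)) (e := <=%R))// => a b; exact: ler_wpM2l.
by rewrite -[X in last X](mulr0 (rho k)) last_map ler_wpM2l.
Unshelve. all: by end_near. Qed.

(** If [W] jumped to the right of [t], a partition reaching past [t] and nearly
optimal for the right limit of [W] would have almost all its sum before [t]:
the part beyond the first point [b] after [t], and the increment of [x] from
[t] to [b], are bounded by [W s - W s'] for any [t < s' < b <= s], hence by the
oscillation of [W] on a right neighbourhood of [t]. *)
Lemma cumulated_right t (e : R) : 0 <= t -> 0 < e -> exists2 s, t < s & W s < W t + e.
Proof.
move=> t0 e0; apply: contrapT => no.
have jump s : t < s -> W t + e <= W s.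
  by move=> ts; rewrite leNgt; apply/negP => lt; apply: no; exists s.
pose Wp := inf [set W s | s in [set s | t < s]].
have infW : has_inf [set W s | s in [set s | t < s]].
  split; first by exists (W (t + 1)), (t + 1) => //=; lra.
  by exists (W t + e) => _ [s ts <-]; exact: jump.
have Wp_le s : t < s -> Wp <= W s by move=> ts; apply: ge_inf infW.2 _ _; exists s.
have Wp_jump : W t + e <= Wp.
  by apply: lb_le_inf; [exact: infW.1|move=> _ [s ts <-]; exact: jump].
have Wt0 := cumulated_ge0 t.
have split_bound (la ep : R) : 0 < la -> 0 < ep ->
    Wp <= (1 + la) `^ q * W t + (2 + (1 + la^-1) `^ q * 2 `^ q) * ep.
  move=> la0 ep0; have [_ [s ts <-] Ws] := inf_adherent ep0 infW.
  have s0 : 0 <= s by rewrite (le_trans t0)// ltW.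
  have [l [pl ls le]] := cumulated_adherent s0 ep0.
  have {}le : Wp - ep < power_sum q x 0 l by have := Wp_le s ts; lra.
  have la1 : 1 <= (1 + la) `^ q.
    by have := @ler_powR _ (1 + la) _ _ _ (ltW q0); rewrite powRr0; apply; lra.
  have K0 : 0 <= (1 + la^-1) `^ q * 2 `^ q by rewrite mulr_ge0 ?powR_ge0.
  have [lt|gt] := leP (last 0 l) t.
    have := le_cumulated pl lt.
    have := mulr_ge0 K0 (ltW ep0); have : 0 <= ((1 + la) `^ q - 1) * W t.
      by rewrite mulr_ge0// subr_ge0.
    by lra.
  have [l1 [b [l3 [El l1t tb]]]] : exists l1 b l3,
      [/\ l = l1 ++ b :: l3, last 0 l1 <= t & t < b].
    elim: l 0 t0 pl gt {ls le Ws} => /= [a ta _|b l IH a ta /andP[ab pl] gt].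
      by rewrite ltNge ta.
    have [bt|tb] := leP b t; last by exists [::], b, l.
    have [l1 [b' [l3 [-> h1 h2]]]] := IH b bt pl gt.
    by exists (b :: l1), b', l3.
  move: pl ls le; rewrite El cat_path last_cat power_sum_cat /=.
  move=> /and3P[pl1 l1b pl3] ls le.
  have before : power_sum q x 0 l1 + `|x t - x (last 0 l1)| `^ q <= W t.
    have := @le_cumulated (rcons l1 t) t.
    rewrite -cats1 cat_path pl1 /= l1t last_cat /= => /(_ erefl (lexx _)).
    by rewrite power_sum_cat /= addr0.
  have after s' : t < s' -> s' <= b ->
      `|x b - x s'| `^ q + power_sum q x b l3 < ep.
    move=> ts' s'b; have := @cumulated_append s' s (b :: l3).
    rewrite /= s'b pl3 (le_trans t0 (ltW ts')) => /(_ erefl erefl ls).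
    by have := Wp_le s' ts'; lra.
  pose dl := ep `^ q^-1.
  have dl0 : 0 < dl by rewrite powR_gt0.
  have dlq : dl `^ q = ep by rewrite -powRrM mulVf ?gt_eqF// powRr1// ltW.
  have [s' [ts' s'b xs']] : exists s', [/\ t < s', s' <= b & `|x t - x s'| < dl].
    have /cvgrPdist_lt/(_ dl dl0) : x s @[s --> t] --> x t by exact: cx.
    move=> /nbhs_ballP[r /= r0 rP]; pose s' := Num.min (t + r / 2) b.
    exists s'; split; first by rewrite lt_min tb andbT; lra.
      by rewrite ge_min lexx orbT.
    have : s' <= t + r / 2 by rewrite ge_min lexx.
    have : t < s' by rewrite lt_min tb andbT; lra.
    by move=> h1 h2; apply: rP; rewrite -ball_normE/= ltr_norml; lra.
  have aft := after s' ts' s'b.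
  have xb : `|x b - x s'| <= dl.
    rewrite leNgt; apply/negP => lt; have := power_sum_ge0 q x b l3.
    have := gt0_ltr_powR q0 _ _ lt; rewrite !nnegrE dlq => /(_ (ltW dl0) (normr_ge0 _)).
    by lra.
  have xba : `|x b - x (last 0 l1)| <= `|x t - x (last 0 l1)| + 2 * dl.
    have := ler_distD (x s') (x b) (x (last 0 l1)).
    have := ler_distD (x t) (x s') (x (last 0 l1)).
    by rewrite (distrC (x s') (x t)); lra.
  have : `|x b - x (last 0 l1)| `^ q <= (1 + la) `^ q * `|x t - x (last 0 l1)| `^ q
      + (1 + la^-1) `^ q * 2 `^ q * ep.
    have := powRD_split (ltW q0) (normr_ge0 (x t - x (last 0 l1)))
      (mulr_ge0 (ler0n R 2) (ltW dl0)) la0.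
    rewrite (powRM _ (ler0n R 2) (ltW dl0)) dlq mulrA; apply: le_trans.
    by apply: ge0_ler_powR; rewrite ?nnegrE ?addr_ge0 ?mulr_ge0// ltW.
  have := powR_ge0 (`|x b - x s'|) q; have := power_sum_ge0 q x 0 l1.
  have : 0 <= ((1 + la) `^ q - 1) * power_sum q x 0 l1.
    by rewrite mulr_ge0 ?power_sum_ge0// subr_ge0.
  have := ler_wpM2l (le_trans ler01 la1) before.
  by lra.
have W_bound (la : R) : 0 < la -> Wp <= (1 + la) `^ q * W t.
  move=> la0; set K := 2 + (1 + la^-1) `^ q * 2 `^ q.
  have K0 : 0 < K by rewrite ltr_wpDr// mulr_ge0 ?powR_ge0.
  apply/ler_addgt0Pr => ep ep0.
  have := split_bound la (ep / K) la0; rewrite divr_gt0// => /(_ erefl).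
  by rewrite -/K [K * _]mulrC divfK ?gt_eqF.
pose la := Num.min 1 (e / 2 / (3 * W t + 1)).
have d0 : 0 < e / 2 / (3 * W t + 1) by rewrite !divr_gt0//; lra.
have la0 : 0 < la by rewrite lt_min ltr01.
have la1 : la <= 1 by rewrite ge_min lexx.
have : la <= e / 2 / (3 * W t + 1) by rewrite ge_min lexx orbT.
rewrite ler_pdivlMr; last by lra.
have le2 : (1 + la) `^ q <= 1 + 3 * la.
  rewrite (@le_trans _ _ ((1 + la) `^ 2))//.
    by apply: ler_powR; [lra|case/andP: q12 => _ /ltW].
  by rewrite powR_mulrn; [rewrite expr2; nra|lra].
by have := W_bound la la0; nra.
Qed.

Lemma cumulated_continuous : continuous W.
Proof.
move=> t; apply/cvgrPdist_lt => e e0.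
have [s1 ts1 s1W] : exists2 s1, t < s1 & W s1 < W t + e.
  have [t0|t0] := leP 0 t; first exact: cumulated_right.
  by exists 0 => //; rewrite (cumulated_le0 (lexx 0)) (cumulated_le0 (ltW t0)) add0r.
have [s2 ts2 s2W] : exists2 s2, s2 < t & W t - e < W s2.
  have [t0|t0] := ltP 0 t; first exact: cumulated_left.
  by exists (t - 1); [lra|rewrite (cumulated_le0 t0) cumulated_le0; lra].
near=> s; have /andP[/ltW l1 /ltW l2] : s2 < s < s1.
  apply/andP; split; near: s; [exact: lt_nbhsr|exact: lt_nbhsl].
have := le_cumulated_homo l1; have := le_cumulated_homo l2.
by rewrite ltr_norml; lra.
Unshelve. all: by end_near. Qed.

End bounded.

End clock.

(** * The dyadic Euler scheme *)

Section binary_parent.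

(** Clears the lowest binary digit of [k], so that an odd multiple of [2 ^ j] is sent to
the left end of the dyadic interval of which it is the midpoint ([parent_odd]). *)
Definition parent (k : nat) : nat := k - 2 ^ logn 2 k.

Lemma parent_lt k : (0 < k)%N -> (parent k < k)%N.
Proof. by move=> k0; rewrite /parent ltn_subrL k0 expn_gt0. Qed.

Lemma parent_odd i j : parent (i.*2.+1 * 2 ^ j) = (i.*2 * 2 ^ j)%N.
Proof.
rewrite /parent lognM ?expn_gt0// pfactorK// logn_coprime ?add0n.
  by rewrite mulSn addnC addnK.
by rewrite coprime2n /= odd_double.
Qed.

End binary_parent.

Ltac nat_lia := match goal with R : realType |- _ => clear dependent R end; lia.

(** Splitting the interval at [c] changes the left-point error of an integral by the
product of the increments of the velocity before [c] and of the driver after [c]. *)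
Lemma left_point_split {R : realType} {m n p} (zs zc zt : 'M[R]_(m, p))
    (vs vc : 'M[R]_(m, n)) (ys yc yt : 'M[R]_(n, p)) :
  zt - zs - vs *m (yt - ys) = (zc - zs - vs *m (yc - ys)) +
    (zt - zc - vc *m (yt - yc)) + (vc - vs) *m (yt - yc).
Proof.
have zE (V : zmodType) (p1 p2 p3 : V) : p1 - p3 = (p1 - p2) + (p2 - p3) by rewrite subrKA.
rewrite mulmxBl (zE _ yt yc ys) mulmxDr (zE _ zt zc zs).
by apply/matrixP => i j; rewrite !mxE; ring.
Qed.

Section euler_estimate.
Context {R : realType} {d e : nat}.
Variables (gamma H M a : R).
Hypothesis gamma01 : 0 < gamma <= 1.
Hypothesis H0 : 0 <= H.
Hypothesis M0 : 0 <= M.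
Hypothesis a01 : 0 < a < 1.
Local Notation b := (a `^ gamma).
Hypothesis ab12 : 2 * (a * b) < 1.

(** The last field is the Hoelder continuity of the driver on the grid of step [2^-n]:
its increment over a dyadic block of [2 ^ j] steps, of level [n - j], is at most
[M a^(n - j)], up to the dimension which is included in [M]. *)
Record euler_scheme (n : nat) (y : nat -> 'cV[R]_d) (z : nat -> 'cV[R]_e)
    (v : nat -> 'M[R]_(e, d)) : Prop := EulerScheme {
  scheme_step : forall k, z k.+1 = z k + v k *m (y k.+1 - y k);
  scheme_parent : forall k, (0 < k)%N ->
    `|v k - v (parent k)| <= H * `|z k - z (parent k)| `^ gamma;
  scheme_driver : forall w j i s t, (j <= n)%N ->
    (i * 2 ^ j <= s)%N -> (s <= t)%N -> (t <= i.+1 * 2 ^ j)%N ->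
    `|(w : 'M[R]_(e, d)) *m (y t - y s)| <= `|w| * (M * a ^+ (n - j)) }.

Definition remainder (y : nat -> 'cV[R]_d) (z : nat -> 'cV[R]_e)
  (v : nat -> 'M[R]_(e, d)) (s t : nat) := z t - z s - v s *m (y t - y s).

Let a0 : 0 < a. Proof. by case/andP: a01. Qed.
Let b0 : 0 < b. Proof. by rewrite powR_gt0. Qed.
Let g0 : 0 < gamma. Proof. by case/andP: gamma01. Qed.
Let b1 : b < 1.
Proof. by have := @gt0_ltr_powR R gamma g0 a 1; rewrite powR1 !nnegrE ltW// => ->//; case/andP: a01. Qed.

Lemma powR_le1D (x : R) : 0 <= x -> x `^ gamma <= 1 + x.
Proof.
case/andP: gamma01 => _ g1 x0; have [x1|x1] := leP 1 x.
  by rewrite (le_trans (ler1_powR x1 g1))// lerDr.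
rewrite (@le_trans _ _ (1 `^ gamma))//; last by rewrite powR1 lerDl.
by apply: ge0_ler_powR; rewrite ?nnegrE ?(ltW g0) ?(ltW x1).
Qed.

Lemma powR_exprn k : (a ^+ k) `^ gamma = b ^+ k.
Proof.
have a0' := ltW a0; rewrite -(powR_mulrn k a0') -(powR_mulrn k (powR_ge0 a gamma)).
exact: powRAC.
Qed.

Section one_scheme.
Variables (n : nat) (y : nat -> 'cV[R]_d) (z : nat -> 'cV[R]_e) (v : nat -> 'M[R]_(e, d)).
Hypothesis Sc : euler_scheme n y z v.
Local Notation Rm := (remainder y z v).

Lemma remainder_split s c t :
  Rm s t = Rm s c + Rm c t + (v c - v s) *m (y t - y c).
Proof.
exact: left_point_split.
Qed.

(** Induction on the size of the block. The velocity at its midpoint [c] is nearest to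
the one at its left end [al], hence the jump from [al] to [c] is controlled by the
power gamma of [z c - z al], which the induction hypothesis bounds on the left half.
The remainder over the whole block is the sum of those of the two halves and of a term
[(v c - v s) (y t - y c)]. The two inequalities on [P] and [C] say that these
bounds reproduce themselves from one level to the next. *)
Lemma block_estimate (m0 : nat) (B P C : R) : (m0 <= n)%N -> 0 <= B -> 0 <= P -> 0 <= C ->
  P * b + H * b * (1 + B * M + C * b ^+ m0) <= P ->
  2 * C * (a * b) + P * M * a <= C ->
  forall j, (j <= n - m0)%N -> forall i,
  (forall s, (i * 2 ^ j <= s < i.+1 * 2 ^ j)%N -> `|v s| <= B) ->
  (forall s, (i * 2 ^ j <= s < i.+1 * 2 ^ j)%N ->
    `|v s - v (i * 2 ^ j)%N| <= P * b ^+ (n - j)) /\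
  (forall s t, (i * 2 ^ j <= s)%N -> (s <= t)%N -> (t <= i.+1 * 2 ^ j)%N ->
    (s < i.+1 * 2 ^ j)%N -> `|Rm s t| <= C * (a * b) ^+ (n - j)).
Proof.
move=> m0n B0 P0 C0 K1 K2; elim=> [|j IH] jn i vB.
  have ab0 k : 0 <= (a * b) ^+ k by rewrite exprn_ge0// mulr_ge0 ?ltW.
  have bk0 k : 0 <= b ^+ k by rewrite exprn_ge0// ltW.
  rewrite expn0 !muln1 subn0; split=> [s|s t].
    rewrite ltnS -eqn_leq => /eqP <-; rewrite subrr normr0.
    by rewrite mulr_ge0.
  move=> is_ st ti; rewrite ltnS => si.
  have {is_ si} Es : s = i by apply/eqP; rewrite eqn_leq si.
  have [Et|Et] : t = i \/ t = i.+1 by nat_lia.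
    by rewrite /remainder Es Et !subrr mulmx0 subr0 normr0 mulr_ge0.
  rewrite /remainder Es Et (scheme_step Sc) [z i + _]addrC addrK subrr normr0.
  by rewrite mulr_ge0.
have jn' : (j <= n - m0)%N by nat_lia.
have jn1 : (j.+1 <= n)%N by nat_lia.
pose al := (i.*2 * 2 ^ j)%N; pose c := (i.*2.+1 * 2 ^ j)%N; pose be := (i.*2.+2 * 2 ^ j)%N.
have Eal : (i * 2 ^ j.+1 = al)%N by rewrite /al expnS; nat_lia.
have Ebe : (i.+1 * 2 ^ j.+1 = be)%N by rewrite /be expnS; nat_lia.
have alc : (al < c)%N by rewrite /al /c ltn_pmul2r ?expn_gt0.
have cbe : (c < be)%N by rewrite /be /c ltn_pmul2r ?expn_gt0.
rewrite Eal Ebe in vB *.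
have vBl s : (al <= s < c)%N -> `|v s| <= B by move=> sl; apply: vB; nat_lia.
have vBr s : (c <= s < be)%N -> `|v s| <= B by move=> sl; apply: vB; nat_lia.
have [IHvl IHRl] := IH jn' i.*2 vBl.
have [IHvr IHRr] := IH jn' i.*2.+1 vBr.
rewrite -/al -/c -/be in IHvl IHRl IHvr IHRr.
set k := (n - j.+1)%N; have Ek : (n - j)%N = k.+1 by rewrite /k; nat_lia.
rewrite Ek in IHvl IHRl IHvr IHRr.
have bk0 l : 0 <= b ^+ l by rewrite exprn_ge0// ltW.
have ak0 l : 0 <= a ^+ l by rewrite exprn_ge0// ltW.
have ab0 l : 0 <= (a * b) ^+ l by rewrite exprn_ge0// mulr_ge0// ltW.
have abl l : (a * b) ^+ l = a ^+ l * b ^+ l by rewrite exprMn.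
have bdec : b ^+ k.+1 <= b ^+ k by rewrite exprS ler_piMl ?bk0// ltW.
have abdec : (a * b) ^+ k.+1 <= (a * b) ^+ k.
  by rewrite exprS ler_piMl ?ab0//; move: ab12; lra.
have bm0 : b ^+ k.+1 <= b ^+ m0.
  by rewrite ler_wiXn2l// ?ltW//; rewrite /k; nat_lia.
have drv s t (w : 'M[R]_(e, d)) : (al <= s <= t)%N -> (t <= be)%N -> (t <= c)%N \/ (c <= s)%N ->
    `|w *m (y t - y s)| <= `|w| * (M * a ^+ k.+1).
  move=> /andP[als st] tbe tc; rewrite -Ek.
  case: tc => tc.
    by apply: (@scheme_driver _ _ _ _ Sc w j i.*2); rewrite -/al -/c //; nat_lia.
  by apply: (@scheme_driver _ _ _ _ Sc w j i.*2.+1); rewrite -/be -/c //; nat_lia.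
have par_c : parent c = al by exact: parent_odd.
have jump : `|v c - v al| <= H * b * (1 + B * M + C * b ^+ m0) * b ^+ k.
  have c0 : (0 < c)%N by nat_lia.
  have := scheme_parent Sc c0; rewrite par_c => /le_trans; apply.
  rewrite -mulrA -[leRHS]mulrA ler_wpM2l//.
  have zc : `|z c - z al| <= a ^+ k.+1 * (B * M + C * b ^+ m0).
    have -> : z c - z al = Rm al c + v al *m (y c - y al) by rewrite /remainder subrK.
    rewrite (le_trans (ler_normD _ _))//.
    have h1 : `|Rm al c| <= C * (a * b) ^+ k.+1 by apply: IHRl; nat_lia.
    have h2 : `|v al *m (y c - y al)| <= B * (M * a ^+ k.+1).
      have va : `|v al| <= B by apply: vB; nat_lia.
      apply: le_trans (drv _ _ _ _ _ _) _; try nat_lia.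
      by rewrite ler_wpM2r// mulr_ge0.
    have h3 : C * (a * b) ^+ k.+1 <= C * (a ^+ k.+1 * b ^+ m0).
      by rewrite abl ler_wpM2l// ler_wpM2l.
    by lra.
  have T0 : 0 <= B * M + C * b ^+ m0 by rewrite addr_ge0 ?mulr_ge0.
  rewrite (@le_trans _ _ ((a ^+ k.+1 * (B * M + C * b ^+ m0)) `^ gamma))//.
    by apply: ge0_ler_powR => //; rewrite ?nnegrE ?mulr_ge0// ltW.
  rewrite powRM// powR_exprn [leRHS]mulrCA -exprS mulrC ler_wpM2r//.
  by rewrite -addrA powR_le1D.
have osc1 : P * b ^+ k.+1 + `|v c - v al| <= P * b ^+ k.
  have := ler_wpM2r (bk0 k) K1; rewrite mulrDl exprS; lra.
have osc s : (al <= s < be)%N -> `|v s - v al| <= P * b ^+ k.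
  move=> /andP[als sbe]; have [sc|cs] := ltnP s c.
    rewrite (le_trans (IHvl s _)) ?als// ler_wpM2l//.
  rewrite (le_trans (ler_distD (v c) _ _))//.
  by have := IHvr s; rewrite cs sbe => /(_ erefl); lra.
split=> // s t als st tbe sbe.
have RC : C * (a * b) ^+ k.+1 <= C * (a * b) ^+ k by rewrite ler_wpM2l.
have [cs|sc] := leqP c s; first exact: le_trans (IHRr _ _ cs st tbe sbe) RC.
have [tc|ct] := leqP t c; first exact: le_trans (IHRl _ _ als st tc sc) RC.
rewrite (remainder_split s c t).
have h1 : `|Rm s c| <= C * (a * b) ^+ k.+1 by apply: IHRl => //; nat_lia.
have h2 : `|Rm c t| <= C * (a * b) ^+ k.+1 by apply: IHRr => //; nat_lia.
have h3 : `|(v c - v s) *m (y t - y c)| <= P * b ^+ k * (M * a ^+ k.+1).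
  apply: le_trans (drv _ _ _ _ _ _) _; try nat_lia.
  rewrite ler_wpM2r ?mulr_ge0// (le_trans (ler_distD (v al) _ _))//.
  rewrite [X in _ + X]distrC; have := IHvl s; rewrite als sc => /(_ erefl); lra.
rewrite (le_trans (ler_normD _ _))// (le_trans (lerD (ler_normD _ _) (lexx _)))//.
have := ler_wpM2r (ab0 k) K2.
have E3 : P * b ^+ k * (M * a ^+ k.+1) = P * M * a * (a * b) ^+ k.
  by rewrite abl exprS; ring.
move: h1 h2 h3; rewrite E3 exprS; lra.
Qed.

End one_scheme.

Let ab0 : 0 < a * b. Proof. by rewrite mulr_gt0. Qed.
Let la0 : 0 < 1 - 2 * (a * b). Proof. by rewrite subr_gt0. Qed.
Let ka0 : 0 < 1 - b. Proof. by rewrite subr_gt0. Qed.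

(** The constants of [block_estimate] when the velocities are bounded by [B]; they
are affine in [B], which is what makes solutions global. *)
Let c1 := M * a / (1 - 2 * (a * b)).
Let Pc (B : R) := 2 * H * b * (1 + B * M) / (1 - b).
Let Cc (B : R) := c1 * Pc B.

Let c10 : 0 <= c1. Proof. by rewrite divr_ge0 ?mulr_ge0// ltW. Qed.
Let Pc0 B : 0 <= B -> 0 <= Pc B.
Proof. by move=> B0; rewrite divr_ge0 ?(ltW ka0)// ?mulr_ge0 ?(ltW b0)// addr_ge0// mulr_ge0. Qed.
Let Cc0 B : 0 <= B -> 0 <= Cc B.
Proof. by move=> B0; rewrite mulr_ge0 ?Pc0. Qed.

Lemma exists_exprn_small (r K ep : R) : 0 < r < 1 -> 0 < ep -> exists m, K * r ^+ m <= ep.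
Proof.
move=> /andP[r0 r1] ep0; have K1 : 0 < `|K| + 1 by rewrite ltr_wpDl.
have : r ^+ k @[k --> \oo] --> (0 : R) by apply: cvg_expr; rewrite ger0_norm ?ltW.
move=> /cvgrPdist_lt/(_ (ep / (`|K| + 1))); rewrite divr_gt0// => /(_ erefl)[m _ mP].
exists m; have := mP m (leqnn m).
have rm0 : 0 <= r ^+ m by rewrite exprn_ge0// ltW.
rewrite sub0r normrN ger0_norm// ltr_pdivlMr// => h.
rewrite (le_trans _ (ltW h))// mulrC ler_wpM2l//.
by rewrite (le_trans (ler_norm _))// lerDl.
Qed.

(** Both conditions hold for large [m0], as [b < 1]; neither involves the velocities. *)
Lemma exists_start_level : exists m0,
  H * b * c1 * b ^+ m0 <= (1 - b) / 2 /\
  2 * H * b * (1 + M) / (1 - b) * b ^+ m0 <= 2^-1.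
Proof.
have b01 : 0 < b < 1 by rewrite b0 b1.
have [m1 h1] := @exists_exprn_small b (H * b * c1) ((1 - b) / 2) b01 (divr_gt0 ka0 (ltr0n R 2)).
have [|m2 h2] := @exists_exprn_small b (2 * H * b * (1 + M) / (1 - b)) 2^-1 b01.
  by rewrite invr_gt0.
have dec m m' : (m <= m')%N -> b ^+ m' <= b ^+ m.
  by move=> mm'; rewrite ler_wiXn2l// ltW.
exists (maxn m1 m2); split.
  by apply: le_trans h1; rewrite ler_wpM2l ?dec ?leq_maxl// mulr_ge0// mulr_ge0// ltW.
apply: le_trans h2; rewrite ler_wpM2l ?dec ?leq_maxr//.
by rewrite divr_ge0 ?(ltW ka0)// ?mulr_ge0 ?(ltW b0)// addr_ge0.
Qed.

Section start_level.
Variable m0 : nat.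
Hypothesis m0c1 : H * b * c1 * b ^+ m0 <= (1 - b) / 2.
Hypothesis m0P : 2 * H * b * (1 + M) / (1 - b) * b ^+ m0 <= 2^-1.

Lemma block_constants B : 0 <= B ->
  [/\ Pc B * b + H * b * (1 + B * M + Cc B * b ^+ m0) <= Pc B,
      2 * Cc B * (a * b) + Pc B * M * a <= Cc B &
      Pc B * b ^+ m0 <= (1 + B) / 2].
Proof.
move=> B0; split.
- have EP : Pc B * (1 - b) = 2 * (H * b * (1 + B * M)).
    by rewrite /Pc divfK ?gt_eqF//; ring.
  have := ler_wpM2r (Pc0 B0) m0c1.
  have -> : H * b * c1 * b ^+ m0 * Pc B = H * b * (Cc B * b ^+ m0) by rewrite /Cc; ring.
  move: EP; rewrite /Cc; lra.
- have : Cc B * (1 - 2 * (a * b)) = Pc B * M * a.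
    have E1 : c1 * (1 - 2 * (a * b)) = M * a by rewrite /c1 divfK// gt_eqF.
    by rewrite /Cc mulrAC E1; ring.
  by lra.
- have BM : 1 + B * M <= (1 + M) * (1 + B) by move: B0 M0; nra.
  have := ler_wpM2r (addr_ge0 ler01 B0) m0P.
  have : Pc B * b ^+ m0 <= 2 * H * b * (1 + M) / (1 - b) * b ^+ m0 * (1 + B).
    have E1 (w : R) : 2 * H * b * w / (1 - b) * b ^+ m0 = 2 * H * b / (1 - b) * b ^+ m0 * w.
      by ring.
    rewrite /Pc !E1 -[leRHS]mulrA ler_wpM2l// mulr_ge0 ?exprn_ge0 ?(ltW b0)//.
    by rewrite divr_ge0 ?(ltW ka0)// mulr_ge0 ?(ltW b0)// mulr_ge0.
  lra.
Qed.

Lemma block_estimate_bound n y z v (Sc : euler_scheme n y z v) B : (m0 <= n)%N -> 0 <= B ->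
  forall j i, (j <= n - m0)%N ->
  (forall s, (i * 2 ^ j <= s < i.+1 * 2 ^ j)%N -> `|v s| <= B) ->
  (forall s, (i * 2 ^ j <= s < i.+1 * 2 ^ j)%N ->
    `|v s - v (i * 2 ^ j)%N| <= Pc B * b ^+ (n - j)) /\
  (forall s t, (i * 2 ^ j <= s)%N -> (s <= t)%N -> (t <= i.+1 * 2 ^ j)%N ->
    (s < i.+1 * 2 ^ j)%N -> `|remainder y z v s t| <= Cc B * (a * b) ^+ (n - j)).
Proof.
move=> m0n B0 j i jn; have [K1 K2 _] := block_constants B0.
by apply: (block_estimate Sc m0n B0 (Pc0 B0) (Cc0 B0)).
Qed.

(** On one block of level [m0], whatever [n], the bound [B] of the velocities satisfies
[B <= X1 + (1 + B) / 2], where [X1] bounds the velocity at the left end of the block. *)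
Lemma block_growth (X : R) : 0 <= X -> exists2 X' : R, X <= X' &
  forall n y z v i, euler_scheme n y z v -> (m0 <= n)%N ->
    `|v 0%N| <= X ->
    (forall k, (k < i * 2 ^ (n - m0))%N -> `|v k| <= X) ->
    (forall k, (k <= i * 2 ^ (n - m0))%N -> `|z k| <= X) ->
    (forall k, (k < i.+1 * 2 ^ (n - m0))%N -> `|v k| <= X') /\
    (forall k, (k <= i.+1 * 2 ^ (n - m0))%N -> `|z k| <= X').
Proof.
move=> X0; pose X1 := X + H * (1 + 2 * X); pose B := 2 * X1 + 1.
have X10 : 0 <= X1 by rewrite addr_ge0// mulr_ge0// addr_ge0// mulr_ge0.
have B0 : 0 <= B by rewrite addr_ge0// mulr_ge0.
pose X2 := X + Cc B + X1 * M.
have X20 : X <= X2 by rewrite /X2 -addrA lerDl addr_ge0 ?Cc0// mulr_ge0.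
exists (B + X2); first by rewrite (le_trans X20)// lerDr.
move=> n y z v i Sc m0n v0 vX zX; set N := (2 ^ (n - m0))%N.
have N0 : (0 < N)%N by rewrite expn_gt0.
have vs0 : `|v (i * N)%N| <= X1.
  have [->|i0] := posnP i.
    by rewrite mul0n (le_trans v0)// lerDl mulr_ge0// addr_ge0// mulr_ge0.
  have s0 : (0 < i * N)%N by rewrite muln_gt0 i0.
  have ps0 := parent_lt s0.
  have := scheme_parent Sc s0; have := vX _ ps0.
  have zz : `|z (i * N)%N - z (parent (i * N))| <= 2 * X.
    rewrite (le_trans (ler_normB _ _))// mulr_natl mulr2n lerD// zX//.
    exact: ltnW.
  have : H * `|z (i * N)%N - z (parent (i * N))| `^ gamma <= H * (1 + 2 * X).
    rewrite ler_wpM2l// (le_trans (powR_le1D (normr_ge0 _)))// lerD2l//.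
  move=> h1 h2 h3; rewrite -[v (i * N)%N](subrK (v (parent (i * N)))).
  rewrite (le_trans (ler_normD _ _))// addrC lerD//.
  exact: le_trans h3 h1.
have step B' : 0 <= B' -> (forall s, (i * N <= s < i.+1 * N)%N -> `|v s| <= B') ->
    forall s, (i * N <= s < i.+1 * N)%N -> `|v s| <= X1 + (1 + B') / 2.
  move=> B'0 vB' s sN; have [osc _] := block_estimate_bound Sc m0n B'0 (leqnn _) vB'.
  have := osc s sN; rewrite subKn// => h.
  have [_ _ h3] := block_constants B'0.
  rewrite -[v s](subrK (v (i * N)%N)) (le_trans (ler_normD _ _))// addrC lerD//.
  exact: le_trans h h3.
have vB s : (i * N <= s < i.+1 * N)%N -> `|v s| <= B.
  pose B' := \big[Num.max/0]_(s < i.+1 * N | (i * N <= s)%N) `|v s|.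
  have B'0 : 0 <= B' by exact: bigmax_ge_id.
  have vB' s' : (i * N <= s' < i.+1 * N)%N -> `|v s'| <= B'.
    by move=> /andP[l1 l2]; rewrite /B' (le_bigmax_cond _ _ (j := Ordinal l2)).
  have B'B : B' <= X1 + (1 + B') / 2.
    apply: bigmax_le => [|s' l1]; first by rewrite addr_ge0// divr_ge0// addr_ge0.
    by apply: step => //; rewrite l1 ltn_ord.
  move=> /vB' /le_trans; apply; move: B'B; rewrite /B; lra.
have [_ rem] := block_estimate_bound Sc m0n B0 (leqnn _) vB.
have EN : (i.+1 * N = i * N + N)%N by rewrite mulSn addnC.
have ex1 k : (a * b) ^+ k <= 1.
  by rewrite exprn_ile1// ?ltW//; move: ab12 ab0; lra.
split=> k kN.
  have [ki|ik] := ltnP k (i * N).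
    by rewrite (le_trans (vX _ ki))// (le_trans X20)// lerDr.
  by rewrite (le_trans (vB k _)) ?ik ?kN// lerDl (le_trans X0).
apply: (@le_trans _ _ X2); last by rewrite lerDr.
have [ki|ik] := leqP k (i * N); first by rewrite (le_trans (zX _ ki)).
have Ez : z k = z (i * N)%N + remainder y z v (i * N) k
    + v (i * N)%N *m (y k - y (i * N)%N).
  by rewrite /remainder -addrA subrK addrC subrK.
have h1 : `|remainder y z v (i * N) k| <= Cc B.
  apply: le_trans (rem _ _ (leqnn _) (ltnW ik) kN _) _; first by rewrite EN -ltn_subLR ?subnn.
  by rewrite ler_piMr// Cc0.
have h2 : `|v (i * N)%N *m (y k - y (i * N)%N)| <= X1 * M.
  have := @scheme_driver _ _ _ _ Sc (v (i * N)%N) (n - m0) i (i * N)%N k (leq_subr _ _)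
    (leqnn _) (ltnW ik) kN.
  move=> /le_trans; apply; apply: ler_pM => //.
    by rewrite mulr_ge0// exprn_ge0// ltW.
  by rewrite ler_piMr// exprn_ile1// ltW//; case/andP: a01.
have h3 := zX _ (leqnn (i * N)%N).
rewrite Ez (le_trans (ler_normD _ _))// (le_trans (lerD (ler_normD _ _) (lexx _)))//.
by rewrite /X2 lerD// lerD.
Qed.

Lemma scheme_growth (X0 : R) : 0 <= X0 -> forall i, exists2 X, X0 <= X &
  forall n y z v, euler_scheme n y z v -> (m0 <= n)%N ->
    `|z 0%N| <= X0 -> `|v 0%N| <= X0 ->
    (forall k, (k < i * 2 ^ (n - m0))%N -> `|v k| <= X) /\
    (forall k, (k <= i * 2 ^ (n - m0))%N -> `|z k| <= X).
Proof.
move=> X00; elim=> [|i [X XX IH]].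
  exists X0 => // n y z v Sc m0n z0 v0; rewrite mul0n; split=> // k.
  by rewrite leqn0 => /eqP ->.
have [X' XX' grow] := block_growth (le_trans X00 XX).
exists X'; first exact: le_trans XX'.
move=> n y z v Sc m0n z0 v0; have [vX zX] := IH n y z v Sc m0n z0 v0.
by apply: (grow n y z v i Sc m0n) => //; exact: le_trans XX.
Qed.

End start_level.

(** The bounds that survive the passage to the limit; [K] does not depend on the
level [n] of the scheme. *)
Lemma euler_uniform_estimate (X0 : R) : 0 <= X0 -> exists m0 K, 0 <= K /\
  forall n y z v, euler_scheme n y z v -> (m0 <= n)%N ->
    `|z 0%N| <= X0 -> `|v 0%N| <= X0 ->
    [/\ forall k, (k < 2 ^ n)%N -> `|v k| <= K,
        forall k, (k <= 2 ^ n)%N -> `|z k| <= K,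
        forall m i s, (m <= n)%N -> (i < 2 ^ m)%N ->
          (i * 2 ^ (n - m) <= s < i.+1 * 2 ^ (n - m))%N ->
          `|v s - v (i * 2 ^ (n - m))%N| <= K * b ^+ m &
        forall m i s t, (m <= n)%N -> (i < 2 ^ m)%N ->
          (i * 2 ^ (n - m) <= s)%N -> (s <= t)%N -> (t <= i.+1 * 2 ^ (n - m))%N ->
          (s < i.+1 * 2 ^ (n - m))%N ->
          `|remainder y z v s t| <= K * (a * b) ^+ m].
Proof.
move=> X00; have [m0 [h1 h2]] := exists_start_level.
have [X XX grow] := scheme_growth h1 h2 X00 (2 ^ m0).
have X'0 : 0 <= X by exact: le_trans XX.
have bk k : 0 < b ^+ k by rewrite exprn_gt0.
have abk k : 0 < (a * b) ^+ k by rewrite exprn_gt0.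
have PX := Pc0 X'0; have CX := Cc0 X'0.
pose K1 := 2 * X / b ^+ m0; pose K2 := (2 * X + X * M) / (a * b) ^+ m0.
have K10 : 0 <= K1 by rewrite divr_ge0 ?mulr_ge0// ltW.
have K20 : 0 <= K2 by rewrite divr_ge0 ?(ltW (abk _))// addr_ge0 ?mulr_ge0.
pose K := X + Pc X + Cc X + K1 + K2.
exists m0, K; split; first by rewrite !addr_ge0.
move=> n y z v Sc m0n z0 v0.
have [] := grow n y z v Sc m0n z0 v0; rewrite -expnD subnKC// => vX zX.
have blk m i : (m <= n)%N -> (i < 2 ^ m)%N -> (i.+1 * 2 ^ (n - m) <= 2 ^ n)%N.
  by move=> mn im; rewrite -{2}(subnKC mn) expnD leq_mul2r im orbT.
split=> [k kn|k kn|m i s mn im sN|m i s t mn im is_ st ti si].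
- by rewrite (le_trans (vX k kn))// /K -!addrA lerDl !addr_ge0.
- by rewrite (le_trans (zX k kn))// /K -!addrA lerDl !addr_ge0.
- have iN := blk m i mn im; have [m0m|mm0] := leqP m0 m.
    have jn : (n - m <= n - m0)%N by rewrite leq_sub2l.
    have vB s' : (i * 2 ^ (n - m) <= s' < i.+1 * 2 ^ (n - m))%N -> `|v s'| <= X.
      by move=> /andP[_ l2]; apply: vX; exact: leq_trans l2 iN.
    have [osc _] := block_estimate_bound h1 h2 Sc m0n X'0 jn vB.
    rewrite (le_trans (osc s sN))// subKn// ler_wpM2r ?(ltW (bk _))// /K; lra.
  have s1 : (s < 2 ^ n)%N by case/andP: sN => _ l2; exact: leq_trans l2 iN.
  have s2 : (i * 2 ^ (n - m) < 2 ^ n)%N.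
    by apply: leq_ltn_trans s1; case/andP: sN.
  rewrite (le_trans (ler_normB _ _))// (le_trans (lerD (vX _ s1) (vX _ s2)))//.
  apply: (@le_trans _ _ (K1 * b ^+ m)).
    have -> : X + X = 2 * X by ring.
    rewrite /K1 mulrAC ler_pdivlMr// ler_wpM2l ?mulr_ge0//.
    by rewrite ler_wiXn2l ?(ltW b0) ?(ltW b1) ?(ltnW mm0).
  rewrite ler_wpM2r ?(ltW (bk _))// /K; lra.
- have iN := blk m i mn im; have [m0m|mm0] := leqP m0 m.
    have jn : (n - m <= n - m0)%N by rewrite leq_sub2l.
    have vB s' : (i * 2 ^ (n - m) <= s' < i.+1 * 2 ^ (n - m))%N -> `|v s'| <= X.
      by move=> /andP[_ l2]; apply: vX; exact: leq_trans l2 iN.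
    have [_ rem] := block_estimate_bound h1 h2 Sc m0n X'0 jn vB.
    rewrite (le_trans (rem s t is_ st ti si))// subKn// ler_wpM2r ?(ltW (abk _))// /K; lra.
  have s1 : (s < 2 ^ n)%N by exact: leq_trans si iN.
  have t1 : (t <= 2 ^ n)%N by exact: leq_trans ti iN.
  have drv : `|v s *m (y t - y s)| <= X * M.
    have jn : (n - m <= n)%N by exact: leq_subr.
    have := @scheme_driver _ _ _ _ Sc (v s) (n - m) i s t jn is_ st ti.
    move=> /le_trans; apply; apply: ler_pM => //.
    + by rewrite mulr_ge0// exprn_ge0// ltW.
    + exact: vX.
    + by rewrite ler_piMr// exprn_ile1// ltW//; case/andP: a01.
  apply: (@le_trans _ _ (2 * X + X * M)).
    rewrite /remainder (le_trans (ler_normB _ _))// lerD//.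
    rewrite (le_trans (ler_normB _ _))// mulr_natl mulr2n lerD// zX//.
    exact: ltnW.
  apply: (@le_trans _ _ (K2 * (a * b) ^+ m)).
    rewrite /K2 mulrAC ler_pdivlMr// ler_wpM2l ?addr_ge0 ?mulr_ge0//.
    rewrite ler_wiXn2l ?(ltW ab0) ?(ltnW mm0)//; move: ab12 ab0; lra.
  rewrite ler_wpM2r ?(ltW (abk _))// /K; lra.
Qed.

End euler_estimate.

(** * From dyadic times to all times *)

Section dyadic_blocks.
Context {R : realType}.
Implicit Types u : R.

Lemma dyadicM m l k : (m <= l)%N -> dyadic l (k * 2 ^ (l - m)) = dyadic m k :> R.
Proof.
move=> ml; rewrite /dyadic natrM natrX -{2}(subnKC ml) exprD invfM.
have h : (2 : R) ^+ (l - m) != 0 by rewrite expf_neq0.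
by rewrite mulrACA mulfV// mulr1.
Qed.

Lemma dyadic_le l i k : (dyadic l i <= dyadic l k :> R) = (i <= k)%N.
Proof. by rewrite /dyadic ler_pM2r ?invr_gt0 ?exprn_gt0// ler_nat. Qed.

Lemma dyadic_lt l i k : (dyadic l i < dyadic l k :> R) = (i < k)%N.
Proof. by rewrite /dyadic ltr_pM2r ?invr_gt0 ?exprn_gt0// ltr_nat. Qed.

Lemma dyadic_floor_ge l k u : 0 <= u -> (k <= dyadic_floor l u)%N = (dyadic l k <= u).
Proof.
move=> u0; have k0 : (0 : R) < 2 ^+ l by rewrite exprn_gt0.
by rewrite /dyadic_floor truncn_ge_nat ?mulr_ge0 ?(ltW k0)// /dyadic ler_pdivrMr// mulrC.
Qed.

Lemma dyadic_floor_lt l k u : 0 <= u -> (dyadic_floor l u < k)%N = (u < dyadic l k).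
Proof. by move=> u0; rewrite ltnNge dyadic_floor_ge// ltNge. Qed.

Lemma dyadic_floor_homo l u u' : 0 <= u -> u <= u' -> (dyadic_floor l u <= dyadic_floor l u')%N.
Proof.
move=> u0 uu'; rewrite dyadic_floor_ge ?(le_trans u0)//.
by case/andP: (dyadic_floor_itv l u0) => le _; exact: le_trans uu'.
Qed.

Lemma dyadic_expn2 l : dyadic l (2 ^ l) = 1 :> R.
Proof. by rewrite /dyadic natrX mulfV// expf_neq0. Qed.

Lemma dyadic_floor_lt_expn l u : 0 <= u < 1 -> (dyadic_floor l u < 2 ^ l)%N.
Proof. by move=> /andP[u0 u1]; rewrite dyadic_floor_lt// dyadic_expn2. Qed.

(** The point of level [l] below [u] lies in the interval of level [m] that contains [u]. *)
Lemma dyadic_floor_block m l u : (m <= l)%N -> 0 <= u ->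
  (dyadic_floor m u * 2 ^ (l - m) <= dyadic_floor l u
     < (dyadic_floor m u).+1 * 2 ^ (l - m))%N.
Proof.
move=> ml u0; rewrite dyadic_floor_ge// dyadic_floor_lt// !dyadicM//.
exact: dyadic_floor_itv.
Qed.

End dyadic_blocks.

Section dyadic_limit.
Context {R : realType} {p r : nat}.
Implicit Types g : nat -> nat -> 'M[R]_(p, r).

Definition dyadic_limit g (u : R) : 'M[R]_(p, r) :=
  lim (g l (dyadic_floor l u) @[l --> \oo]).

Lemma norm_cvg_le (v : nat -> 'M[R]_(p, r)) w (B : R) :
  v k @[k --> \oo] --> w -> (\forall k \near \oo, `|v k| <= B) -> `|w| <= B.
Proof.
move=> vw vB; apply/ler_addgt0Pr => ep ep0; near \oo => k.
have wk : `|w - v k| < ep by near: k; exact: cvgr_dist_lt vw _ ep0.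
have vk : `|v k| <= B by near: k.
by rewrite -[w](subrK (v k)) (le_trans (ler_normD _ _))// addrC lerD// ltW.
Unshelve. all: by end_near. Qed.

Lemma dyadic_limit_cvg g (ep : nat -> R) u : ep k @[k --> \oo] --> 0 ->
  (forall m l i k, (m <= l)%N -> (k < 2 ^ l)%N ->
    (i * 2 ^ (l - m) <= k < i.+1 * 2 ^ (l - m))%N -> `|g l k - g m i| <= ep m) ->
  0 <= u < 1 ->
  g l (dyadic_floor l u) @[l --> \oo] --> dyadic_limit g u /\
  forall m, `|dyadic_limit g u - g m (dyadic_floor m u)| <= ep m.
Proof.
move=> ep0 gep u01; have /andP[u0 _] := u01.
have osc m l : (m <= l)%N -> `|g l (dyadic_floor l u) - g m (dyadic_floor m u)| <= ep m.
  by move=> ml; apply: gep; [|exact: dyadic_floor_lt_expn|exact: dyadic_floor_block].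
have cg : cvg (g l (dyadic_floor l u) @[l --> \oo]).
  apply: cauchy_cvg; apply: cauchy_exP => e e0.
  have /cvgrPdist_lt/(_ e e0)[m _ mP] := ep0.
  exists (g m (dyadic_floor m u)); exists m => // l /= ml.
  rewrite -ball_normE /= distrC (le_lt_trans (osc m l ml))//.
  by have := mP m (leqnn m); rewrite sub0r normrN; apply/le_lt_trans/ler_norm.
split=> // m; apply: (norm_cvg_le (v := fun l => g l (dyadic_floor l u) - g m (dyadic_floor m u))).
  by apply: cvgB => //; exact: cvg_cst.
by exists m => // l /= /osc.
Qed.

End dyadic_limit.

Lemma cvg_sum_seq {R : realType} (I : Type) (s : seq I) (f : I -> nat -> R) (l : I -> R) :
  (forall i, f i k @[k --> \oo] --> l i) ->
  \sum_(i <- s) f i k @[k --> \oo] --> \sum_(i <- s) l i.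
Proof.
move=> fl; elim: s => [|i s IH].
  by rewrite big_nil; under eq_fun do rewrite big_nil; exact: cvg_cst.
rewrite big_cons; under eq_fun do rewrite big_cons.
exact: cvgD.
Qed.

Lemma cvg_mulmx {R : realType} {m n p} (A : nat -> 'M[R]_(m, n)) (B : nat -> 'M[R]_(n, p))
    (A' : 'M[R]_(m, n)) (B' : 'M[R]_(n, p)) :
  A k @[k --> \oo] --> A' -> B k @[k --> \oo] --> B' ->
  (A k *m B k) @[k --> \oo] --> (A' *m B').
Proof.
move=> cA cB; apply: cvg_mx_entries => i j; rewrite mxE.
under eq_fun do rewrite mxE.
by apply: cvg_sum_seq => k; apply: cvgM; exact: cvg_entry.
Qed.

Section dyadic_solutions.
Context {R : realType} {d e : nat}.
Variable F : 'cV[R]_e -> set 'M[R]_(e, d).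

(** A solution in the clock of the driver [y]: the velocity oscillates by at most
[K b^m] on dyadic intervals of level [m], and replacing the integral over such an
interval by its left-point value costs [K (a b)^m]. *)
Record dyadic_solution (K a b : R) (xi : 'cV[R]_e) (y : R -> 'cV[R]_d)
    (Z : R -> 'cV[R]_e) (V : R -> 'M[R]_(e, d)) : Prop := DyadicSolution {
  solution_start : Z 0 = xi;
  solution_value : forall u, 0 <= u < 1 -> F (Z u) (V u);
  solution_bound : forall u, 0 <= u < 1 -> `|V u| <= K;
  solution_oscillation : forall m s t, 0 <= s < 1 -> 0 <= t < 1 ->
    dyadic_floor m s = dyadic_floor m t -> `|V s - V t| <= K * b ^+ m;
  solution_remainder : forall m i s t, dyadic m i <= s -> s <= t ->
    t <= dyadic m i.+1 -> s < dyadic m i.+1 -> t < 1 ->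
    `|Z t - Z s - V s *m (y t - y s)| <= K * (a * b) ^+ m }.

Definition driver_bound (M a : R) (y : R -> 'cV[R]_d) : Prop :=
  forall m s t, 0 <= s -> s <= t -> t - s <= 2 ^- m -> `|y t - y s| <= M * a ^+ m.

(** What the limits of the Euler schemes at dyadic times inherit from the uniform
estimates. *)
Record dyadic_values (K a b : R) (xi : 'cV[R]_e) (y : R -> 'cV[R]_d)
    (Zd : nat -> nat -> 'cV[R]_e) (Vd : nat -> nat -> 'M[R]_(e, d)) : Prop := DyadicValues {
  values_start : forall l, Zd l 0 = xi;
  values_in : forall l k, (k < 2 ^ l)%N -> F (Zd l k) (Vd l k);
  values_bound : forall l k, (k < 2 ^ l)%N -> `|Vd l k| <= K;
  values_oscillation : forall m l i k, (m <= l)%N -> (k < 2 ^ l)%N ->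
    (i * 2 ^ (l - m) <= k < i.+1 * 2 ^ (l - m))%N ->
    `|Vd l k - Vd m i| <= K * b ^+ m;
  values_refine : forall m l k, (m <= l)%N -> (k < 2 ^ m)%N ->
    Zd l (k * 2 ^ (l - m))%N = Zd m k;
  values_remainder : forall m l i s t, (m <= l)%N ->
    (i * 2 ^ (l - m) <= s)%N -> (s <= t)%N -> (t <= i.+1 * 2 ^ (l - m))%N ->
    (s < i.+1 * 2 ^ (l - m))%N -> (t < 2 ^ l)%N ->
    `|Zd l t - Zd l s - Vd l s *m (y (dyadic l t) - y (dyadic l s))|
      <= K * (a * b) ^+ m }.

Section limit_of_dyadic_values.
Variables (gamma H a b K M : R) (xi : 'cV[R]_e) (y : R -> 'cV[R]_d).
Variables (Zd : nat -> nat -> 'cV[R]_e) (Vd : nat -> nat -> 'M[R]_(e, d)).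
Hypothesis gamma0 : 0 < gamma.
Hypothesis H0 : 0 <= H.
Hypothesis F0 : forall z, F z !=set0.
Hypothesis cF : forall z, closed (F z).
Hypothesis FH : hoelder_bound gamma F H.
Hypothesis a01 : 0 < a < 1.
Hypothesis b01 : 0 < b < 1.
Hypothesis K0 : 0 <= K.
Hypothesis yM : driver_bound M a y.
Hypothesis ZVd : dyadic_values K a b xi y Zd Vd.

Let Zd0 := values_start ZVd.
Let Fd := values_in ZVd.
Let VdK := values_bound ZVd.
Let Vd_osc := values_oscillation ZVd.
Let Zd_refine := values_refine ZVd.
Let Zd_rem := values_remainder ZVd.
Let a0 : 0 < a. Proof. by case/andP: a01. Qed.
Let b0 : 0 < b. Proof. by case/andP: b01. Qed.

Lemma cvg_geometric0 (C r : R) : 0 < r < 1 -> C * r ^+ k @[k --> \oo] --> 0.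
Proof.
move=> /andP[r0 r1]; rewrite -[X in _ --> X](mulr0 C); apply: cvgM; first exact: cvg_cst.
by apply: cvg_expr; rewrite ger0_norm ?ltW.
Qed.

(** The position moves by the left-point value, of order [a^m], up to a remainder of
order [(a b)^m]. *)
Lemma Zd_osc m l i k : (m <= l)%N -> (k < 2 ^ l)%N ->
  (i * 2 ^ (l - m) <= k < i.+1 * 2 ^ (l - m))%N ->
  `|Zd l k - Zd m i| <= (K + d%:R * K * M) * a ^+ m.
Proof.
move=> ml kl /andP[ik ki]; set s := (i * 2 ^ (l - m))%N in ik *.
have sl : (s < 2 ^ l)%N by exact: leq_ltn_trans kl.
have im : (i < 2 ^ m)%N.
  by move: sl; rewrite /s -{2}(subnKC ml) expnD ltn_pmul2r ?expn_gt0.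
have si : (s < i.+1 * 2 ^ (l - m))%N by exact: leq_ltn_trans ki.
rewrite -(Zd_refine ml im) -/s.
have := Zd_rem ml (leqnn s) ik (ltnW ki) si kl.
set D := Vd l s *m _ => rem.
have yD : `|D| <= d%:R * K * (M * a ^+ m).
  rewrite /D (le_trans (mx_norm_mul _ _))// ler_pM ?mulr_ge0//.
    by rewrite ler_wpM2l// VdK.
  apply: yM; rewrite ?dyadic_ge0 ?dyadic_le// lerBlDr.
  rewrite (@le_trans _ _ (dyadic l (i.+1 * 2 ^ (l - m))))//; first by rewrite dyadic_le ltnW.
  by rewrite dyadicM// dyadicS addrC lerD2l -(dyadicM _ ml).
rewrite -[Zd l k - _](subrK D) (le_trans (ler_normD _ _))// mulrDl.
rewrite lerD//; last by rewrite -mulrA.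
rewrite (le_trans rem)// ler_wpM2l// exprMn ler_piMr ?exprn_ge0 ?(ltW a0)//.
by rewrite exprn_ile1 ?(ltW b0)// ltW//; case/andP: b01.
Qed.

Lemma dyadic_values_cvg u : 0 <= u < 1 ->
  Zd l (dyadic_floor l u) @[l --> \oo] --> dyadic_limit Zd u /\
  Vd l (dyadic_floor l u) @[l --> \oo] --> dyadic_limit Vd u.
Proof.
move=> u01; split.
  exact: (dyadic_limit_cvg (cvg_geometric0 (K + d%:R * K * M) a01) Zd_osc u01).1.
exact: (dyadic_limit_cvg (cvg_geometric0 K b01) Vd_osc u01).1.
Qed.

Lemma dyadic_limit_solution :
  dyadic_solution (2 * K) a b xi y (dyadic_limit Zd) (dyadic_limit Vd).
Proof.
have cV u (u01 : 0 <= u < 1) := dyadic_limit_cvg (cvg_geometric0 K b01) Vd_osc u01.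
have cZ u (u01 : 0 <= u < 1) :=
  dyadic_limit_cvg (cvg_geometric0 (K + d%:R * K * M) a01) Zd_osc u01.
have K2 : K <= 2 * K by rewrite mulr_natl mulr2n lerDl.
split.
- have E0 : (fun l => Zd l (dyadic_floor l (0 : R))) = fun=> xi.
    by apply/funext => l; rewrite /dyadic_floor mulr0 truncn0 Zd0.
  by rewrite /dyadic_limit E0; exact: lim_cst.
- move=> u u01; have [cz _] := cZ u u01; have [cv _] := cV u u01.
  apply: (hoelder_closed_graph gamma0 H0 F0 cF FH _ cz cv).
  by apply: nearW => l; apply: Fd; exact: dyadic_floor_lt_expn.
- move=> u u01; have [cv _] := cV u u01; apply: le_trans K2; apply: (norm_cvg_le cv).
  by apply: nearW => l; apply: VdK; exact: dyadic_floor_lt_expn.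
- move=> m s t s01 t01 Est; have [_ /(_ m) hs] := cV s s01; have [_ /(_ m) ht] := cV t t01.
  rewrite (le_trans (ler_distD (Vd m (dyadic_floor m s)) _ _))//.
  by rewrite {2}Est [X in _ + X]distrC mulrDl mul1r mulrDl lerD.
move=> m i s t is_ st ti si t1.
have s0 : 0 <= s by exact: le_trans (dyadic_ge0 _ _) is_.
have t0 : 0 <= t by exact: le_trans st.
have s01 : 0 <= s < 1 by rewrite s0 (le_lt_trans st).
have t01 : 0 <= t < 1 by rewrite t0.
have [czs _] := cZ s s01; have [czt _] := cZ t t01; have [cvs _] := cV s s01.
have cy u : 0 <= u -> y (dyadic l (dyadic_floor l u)) @[l --> \oo] --> y u.
  move=> u0; apply/cvgrPdist_lt => ep ep0.
  have /cvgrPdist_lt/(_ ep ep0)[m1 _ mP] := cvg_geometric0 M a01.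
  exists m1 => // l /= ml; have := mP l ml; rewrite sub0r normrN.
  apply/le_lt_trans/(le_trans _ (ler_norm _)).
  have /andP[f1 f2] := dyadic_floor_near l u0.
  by apply: yM; rewrite ?dyadic_ge0// lerBlDr addrC -lerBlDr ltW.
apply: le_trans (ler_wpM2r _ K2).
  apply: (norm_cvg_le (v := fun l => Zd l (dyadic_floor l t) - Zd l (dyadic_floor l s)
    - Vd l (dyadic_floor l s) *m
        (y (dyadic l (dyadic_floor l t)) - y (dyadic l (dyadic_floor l s))))).
    apply: cvgB; first exact: cvgB.
    by apply: cvg_mulmx => //; apply: cvgB; exact: cy.
  exists m => // l /= ml; apply: (Zd_rem (i := i) ml).
  - by rewrite dyadic_floor_ge// dyadicM.
  - exact: dyadic_floor_homo.
  - rewrite -ltnS dyadic_floor_lt//; apply: le_lt_trans ti _.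
    by rewrite -(dyadicM _ ml) dyadic_lt.
  - by rewrite dyadic_floor_lt// dyadicM.
  - exact: dyadic_floor_lt_expn.
by rewrite exprn_ge0// mulr_ge0// ltW.
Qed.

End limit_of_dyadic_values.

End dyadic_solutions.

(** * Measurable solutions in the clock of the driver *)

Section euler_recursion.
Context {R : realType} {d e : nat}.
Variable pi : 'cV[R]_e -> 'M[R]_(e, d) -> 'M[R]_(e, d).

(** The second component lists the velocities: that of the parent of a grid point is
   read off this list to choose the next one. *)
Fixpoint euler (xi : 'cV[R]_e) (dy : nat -> 'cV[R]_d) (k : nat) :
    'cV[R]_e * (nat -> 'M[R]_(e, d)) :=
  if k is k'.+1 then
    let zv := euler xi dy k' in
    let z' := zv.1 + zv.2 k' *m dy k' in
    (z', fun j => if (j <= k')%N then zv.2 j else pi z' (zv.2 (parent k)))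
  else (xi, fun=> pi xi 0).

Definition euler_position xi dy k := (euler xi dy k).1.
Definition euler_velocity xi dy k := (euler xi dy k).2 k.

Lemma euler_history xi dy j k : (j <= k)%N ->
  (euler xi dy k).2 j = euler_velocity xi dy j.
Proof.
elim: k => [|k IH]; first by rewrite leqn0 => /eqP ->.
rewrite leq_eqVlt => /orP[/eqP ->//|jk]; rewrite /= -ltnS jk.
by apply: IH; rewrite -ltnS.
Qed.

Lemma euler_positionS xi dy k : euler_position xi dy k.+1 =
  euler_position xi dy k + euler_velocity xi dy k *m dy k.
Proof. by []. Qed.

Lemma euler_velocityS xi dy k : euler_velocity xi dy k.+1 =
  pi (euler_position xi dy k.+1) (euler_velocity xi dy (parent k.+1)).
Proof.
rewrite {1}/euler_velocity /= ltnn; congr pi.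
by apply: euler_history; rewrite -ltnS; exact: parent_lt.
Qed.

Lemma measurable_euler (dm : measure_display) (Om : measurableType dm)
    (xi : Om -> 'cV[R]_e) (dy : Om -> nat -> 'cV[R]_d) :
  (forall (a : Om -> 'cV[R]_e) w, measurable_entries a -> measurable_entries w ->
    measurable_entries (fun t => pi (a t) (w t))) ->
  measurable_entries xi -> (forall k, measurable_entries (dy ^~ k)) ->
  forall k, measurable_entries (fun w => euler_position (xi w) (dy w) k) /\
    measurable_entries (fun w => euler_velocity (xi w) (dy w) k).
Proof.
move=> mpi mxi mdy k.
suff [h1 h2] : measurable_entries (fun w => (euler (xi w) (dy w) k).1) /\
    forall j, measurable_entries (fun w => (euler (xi w) (dy w) k).2 j).
  by split; [exact: h1|exact: h2].
elim: k => [|k [IH1 IH2]] /=.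
  by split=> // j; apply: mpi => //; exact: measurable_entries_cst.
have m1 : measurable_entries (fun w =>
    (euler (xi w) (dy w) k).1 + (euler (xi w) (dy w) k).2 k *m dy w k).
  by apply: measurable_entriesD => //; exact: measurable_entriesM.
split; first exact: m1.
by move=> j; case: (j <= k)%N; [exact: IH2|exact: mpi].
Qed.

End euler_recursion.

Section solutions.
Context {R : realType} {d e : nat}.
Variable F : 'cV[R]_e -> set 'M[R]_(e, d).
Variables (gamma H a : R) (pi : 'cV[R]_e -> 'M[R]_(e, d) -> 'M[R]_(e, d)).
Hypothesis gamma01 : 0 < gamma <= 1.
Hypothesis H0 : 0 <= H.
Hypothesis F0 : forall z, F z !=set0.
Hypothesis cF : forall z, closed (F z).
Hypothesis FH : hoelder_bound gamma F H.
Hypothesis a01 : 0 < a < 1.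
Hypothesis ab12 : 2 * (a * a `^ gamma) < 1.
Hypothesis piF : forall z w, F z (pi z w) /\ `|pi z w - w| <= distance (F z) w.

Definition increments (y : R -> 'cV[R]_d) (n k : nat) : 'cV[R]_d :=
  y (dyadic n k.+1) - y (dyadic n k).

Lemma euler_velocity_value xi dy k :
  F (euler_position pi xi dy k) (euler_velocity pi xi dy k).
Proof. by case: k => [|k]; [exact: (piF _ _).1|rewrite euler_velocityS; exact: (piF _ _).1]. Qed.

Lemma euler_is_scheme (M : R) (y : R -> 'cV[R]_d) xi n : 0 <= M -> driver_bound M a y ->
  euler_scheme gamma H (d%:R * M) a n (fun k => y (dyadic n k))
    (euler_position pi xi (increments y n)) (euler_velocity pi xi (increments y n)).
Proof.
move=> M0 yM; split=> [k|[//|k] _|w j i s t jn is_ st ti].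
- by rewrite euler_positionS.
- rewrite {1}euler_velocityS (le_trans (piF _ _).2)// distrC.
  by apply: FH; exact: euler_velocity_value.
have -> : `|w| * (d%:R * M * a ^+ (n - j)) = d%:R * `|w| * (M * a ^+ (n - j)) by ring.
rewrite (le_trans (mx_norm_mul _ _))// ler_wpM2l ?mulr_ge0//.
have jn' : (n - j <= n)%N by exact: leq_subr.
apply: yM; rewrite ?dyadic_ge0 ?dyadic_le// lerBlDr addrC.
rewrite -(subKn jn) in is_ ti.
rewrite (@le_trans _ _ (dyadic n (i.+1 * 2 ^ (n - (n - j)))))//; first by rewrite dyadic_le.
by rewrite dyadicM// dyadicS lerD2r -(dyadicM _ jn') dyadic_le.
Qed.

Let b01 : 0 < a `^ gamma < 1.
Proof.
case/andP: a01 => a0 a1; case/andP: gamma01 => g0 _.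
rewrite powR_gt0//=; have := gt0_ltr_powR g0 _ _ a1.
by rewrite powR1 !nnegrE; apply => //; exact: ltW.
Qed.

Lemma norm_row_mx m n1 n2 (A : 'M[R]_(m, n1)) (B : 'M[R]_(m, n2)) :
  `|row_mx A B| <= `|A| + `|B|.
Proof.
apply: mx_norm_le => [|i j]; first by rewrite addr_ge0.
rewrite mxE; case: fintype.split => k; rewrite (le_trans (mx_entry_le _ _ _))//.
  by rewrite lerDl.
by rewrite lerDr.
Qed.

Lemma cvg_lsubmx m n1 n2 (u : nat -> 'M[R]_(m, n1 + n2)) (w : 'M[R]_(m, n1 + n2)) :
  u k @[k --> \oo] --> w -> lsubmx (u k) @[k --> \oo] --> lsubmx w.
Proof.
move=> uw; apply: cvg_mx_entries => i j; rewrite mxE.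
by under eq_fun do rewrite mxE; exact: cvg_entry.
Qed.

Lemma cvg_rsubmx m n1 n2 (u : nat -> 'M[R]_(m, n1 + n2)) (w : 'M[R]_(m, n1 + n2)) :
  u k @[k --> \oo] --> w -> rsubmx (u k) @[k --> \oo] --> rsubmx w.
Proof.
move=> uw; apply: cvg_mx_entries => i j; rewrite mxE.
by under eq_fun do rewrite mxE; exact: cvg_entry.
Qed.

(** Every field is a closed condition on finitely many values of the schemes, once
dyadic times of level [l] are written as indices of level [n >= l]. *)
Lemma limit_dyadic_values (K : R) (m0 : nat) (xi : 'cV[R]_e) (y : R -> 'cV[R]_d)
    (zn : nat -> nat -> 'cV[R]_e) (vn : nat -> nat -> 'M[R]_(e, d))
    (phi : nat -> nat) (Zd : nat -> nat -> 'cV[R]_e) (Vd : nat -> nat -> 'M[R]_(e, d)) :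
  (forall n, zn n 0 = xi) -> (forall n k, F (zn n k) (vn n k)) ->
  (forall n, (m0 <= n)%N ->
    [/\ forall k, (k < 2 ^ n)%N -> `|vn n k| <= K,
        forall k, (k <= 2 ^ n)%N -> `|zn n k| <= K,
        forall m i s, (m <= n)%N -> (i < 2 ^ m)%N ->
          (i * 2 ^ (n - m) <= s < i.+1 * 2 ^ (n - m))%N ->
          `|vn n s - vn n (i * 2 ^ (n - m))%N| <= K * (a `^ gamma) ^+ m &
        forall m i s t, (m <= n)%N -> (i < 2 ^ m)%N ->
          (i * 2 ^ (n - m) <= s)%N -> (s <= t)%N -> (t <= i.+1 * 2 ^ (n - m))%N ->
          (s < i.+1 * 2 ^ (n - m))%N ->
          `|remainder (fun k => y (dyadic n k)) (zn n) (vn n) s t|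
            <= K * (a * a `^ gamma) ^+ m]) ->
  (forall k, (k <= phi k)%N) ->
  (forall m k, (k < 2 ^ m)%N ->
    zn (phi j) (k * 2 ^ (phi j - m))%N @[j --> \oo] --> Zd m k /\
    vn (phi j) (k * 2 ^ (phi j - m))%N @[j --> \oo] --> Vd m k) ->
  dyadic_values F K a (a `^ gamma) xi y Zd Vd.
Proof.
move=> zn0 znF est kphi cvd.
have late N : \forall j \near \oo, (N <= phi j)%N.
  by exists N => // j /= Nj; exact: leq_trans (kphi j).
have scale n m l : (m <= l)%N -> (l <= n)%N -> (2 ^ (n - m) = 2 ^ (l - m) * 2 ^ (n - l))%N.
  by move=> ml ln; rewrite -expnD addnC addnBA// subnK.
have top n l k : (l <= n)%N -> (k < 2 ^ l)%N -> (k * 2 ^ (n - l) < 2 ^ n)%N.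
  by move=> ln kl; rewrite -[X in (_ < 2 ^ X)%N](subnKC ln) expnD ltn_pmul2r ?expn_gt0.
have idx m l i k : (m <= l)%N -> (k < 2 ^ l)%N -> (i * 2 ^ (l - m) <= k)%N -> (i < 2 ^ m)%N.
  move=> ml kl ik; have := leq_ltn_trans ik kl.
  by rewrite -[X in (_ < 2 ^ X)%N](subnKC ml) expnD ltn_pmul2r ?expn_gt0.
have g0 : 0 < gamma by case/andP: gamma01.
have zcv m k km := (cvd m k km).1; have vcv m k km := (cvd m k km).2.
split.
- move=> l; have := zcv l 0%N (expn_gt0 2 l).
  have -> : (fun j => zn (phi j) (0 * 2 ^ (phi j - l))%N) = fun=> xi.
    by apply/funext => j; rewrite mul0n zn0.
  by move=> cx; rewrite -(cvg_lim _ cx)// lim_cst.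
- move=> l k kl; apply: (hoelder_closed_graph g0 H0 F0 cF FH _ (zcv l k kl) (vcv l k kl)).
  by apply: nearW => j; exact: znF.
- move=> l k kl; apply: (norm_cvg_le (vcv l k kl)).
  apply: filterS (late (maxn m0 l)) => j; rewrite geq_max => /andP[h1 h2].
  by have [+ _ _ _] := est _ h1; apply; exact: top.
- move=> m l i k ml kl /andP[ik ki]; have im := idx m l i k ml kl ik.
  apply: (norm_cvg_le (cvgB (vcv l k kl) (vcv m i im))).
  apply: filterS (late (maxn m0 l)) => j; rewrite geq_max => /andP[h1 h2].
  have [_ _ + _] := est _ h1; apply=> //; first exact: leq_trans ml h2.
  by rewrite (scale _ m l)// !mulnA leq_pmul2r ?expn_gt0// ltn_pmul2r ?expn_gt0// ik.
- move=> m l k ml km.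
  have kl : (k * 2 ^ (l - m) < 2 ^ l)%N by exact: top.
  have c2 : zn (phi j) (k * 2 ^ (l - m) * 2 ^ (phi j - l))%N @[j --> \oo] --> Zd m k.
    apply: cvg_trans (zcv _ _ km).
    apply: near_eq_cvg; apply: filterS (late l) => j lj.
    by rewrite (scale _ m l)// mulnA.
  by rewrite -(cvg_lim _ (zcv _ _ kl))// (cvg_lim _ c2).
move=> m l i s t ml is_ st ti si tl.
have sl : (s < 2 ^ l)%N by exact: leq_ltn_trans tl.
have im := idx m l i s ml sl is_.
apply: (@norm_cvg_le _ _ _ (fun j => zn (phi j) (t * 2 ^ (phi j - l))%N
  - zn (phi j) (s * 2 ^ (phi j - l))%N - vn (phi j) (s * 2 ^ (phi j - l))%N *m
    (y (dyadic l t) - y (dyadic l s)))).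
  apply: cvgB; first by apply: cvgB; exact: zcv.
  by apply: cvg_mulmx; [exact: vcv|exact: cvg_cst].
apply: filterS (late (maxn m0 l)) => j; rewrite geq_max => /andP[h1 h2].
have [_ _ _] := est _ h1.
move=> /(_ m i (s * 2 ^ (phi j - l))%N (t * 2 ^ (phi j - l))%N).
rewrite /remainder !(dyadicM _ h2); apply=> //; first exact: leq_trans ml h2.
- by rewrite (scale _ m l)// mulnA leq_pmul2r ?expn_gt0.
- by rewrite leq_pmul2r ?expn_gt0.
- by rewrite (scale _ m l)// mulnA leq_pmul2r ?expn_gt0.
- by rewrite (scale _ m l)// mulnA ltn_pmul2r ?expn_gt0.
Qed.

Lemma measurable_dyadic_floor dm (Om : measurableType dm) (th : Om -> R) l k :
  measurable_fun setT th -> (forall w, 0 <= th w) ->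
  measurable [set w | dyadic_floor l (th w) = k].
Proof.
move=> mth th0; rewrite (_ : mkset _ =
    [set w | dyadic l k <= th w] `&` [set w | th w < dyadic l k.+1]); last first.
  apply/seteqP; split=> w /=.
    by move=> <-; have /andP[h1 h2] := dyadic_floor_itv l (th0 w).
  move=> [h1 h2]; apply/eqP; rewrite eqn_leq dyadic_floor_ge// h1 andbT.
  by rewrite -ltnS dyadic_floor_lt.
apply: measurableI; rewrite -[X in measurable X]setTI.
  exact: (measurable_fun_ler (measurable_cst _) mth measurableT (Y := [set true])).
exact: (measurable_fun_ltr mth (measurable_cst _) measurableT (Y := [set true])).
Qed.

(** Positions and velocities are put side by side in one matrix, so that a single
cluster point is selected for both; only dyadic times before one enter. The value at
a random time is the limit of the values at its dyadic floors, which take countably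
many values. *)
Theorem measurable_dyadic_solutions dm (Om : measurableType dm)
    (xi : Om -> 'cV[R]_e) (y : Om -> R -> 'cV[R]_d) (M : Om -> R) :
  (forall dm' (Om' : measurableType dm') (z : Om' -> 'cV[R]_e) w,
    measurable_entries z -> measurable_entries w ->
    measurable_entries (fun t => pi (z t) (w t))) ->
  measurable_entries xi ->
  (forall u, 0 <= u -> measurable_entries (y ^~ u)) ->
  (forall w, 0 <= M w) -> (forall w, driver_bound (M w) a (y w)) ->
  exists (Z : Om -> R -> 'cV[R]_e) (V : Om -> R -> 'M[R]_(e, d)),
    (forall w, exists2 K, 0 <= K &
      dyadic_solution F K a (a `^ gamma) (xi w) (y w) (Z w) (V w)) /\
    forall th : Om -> R, measurable_fun setT th -> (forall w, 0 <= th w < 1) ->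
      measurable_entries (fun w => Z w (th w)) /\
      measurable_entries (fun w => V w (th w)).
Proof.
move=> mpi mxi my M0 yM.
pose zn n k w := euler_position pi (xi w) (increments (y w) n) k.
pose vn n k w := euler_velocity pi (xi w) (increments (y w) n) k.
have mzv n k : measurable_entries (zn n k) /\ measurable_entries (vn n k).
  apply: (measurable_euler (dy := fun w => increments (y w) n)) => // [z w|j].
    exact: mpi.
  by apply: measurable_entriesB; apply: my; exact: dyadic_ge0.
have est w := @euler_uniform_estimate R d e _ _ _ _ gamma01 H0 (mulr_ge0 (ler0n R d) (M0 w)) a01 ab12 _
  (addr_ge0 (normr_ge0 (xi w)) (normr_ge0 (pi (xi w) 0))).
have {}est w : exists m0 K, 0 <= K /\ forall n, (m0 <= n)%N ->
    [/\ forall k, (k < 2 ^ n)%N -> `|vn n k w| <= K,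
        forall k, (k <= 2 ^ n)%N -> `|zn n k w| <= K,
        forall m i s, (m <= n)%N -> (i < 2 ^ m)%N ->
          (i * 2 ^ (n - m) <= s < i.+1 * 2 ^ (n - m))%N ->
          `|vn n s w - vn n (i * 2 ^ (n - m))%N w| <= K * (a `^ gamma) ^+ m &
        forall m i s t, (m <= n)%N -> (i < 2 ^ m)%N ->
          (i * 2 ^ (n - m) <= s)%N -> (s <= t)%N -> (t <= i.+1 * 2 ^ (n - m))%N ->
          (s < i.+1 * 2 ^ (n - m))%N ->
          `|remainder (fun k => y w (dyadic n k)) (fun k => zn n k w) (fun k => vn n k w) s t|
            <= K * (a * a `^ gamma) ^+ m].
  have [m0 [K [K0 KP]]] := est w; exists m0, K; split=> // n m0n.
  apply: (KP n (fun k => y w (dyadic n k)) (fun k => zn n k w) (fun k => vn n k w) _ m0n).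
  - exact: euler_is_scheme.
  - by rewrite /zn /euler_position /= lerDl.
  - by rewrite /vn /euler_velocity /= lerDr.
pose u n (mk : nat * nat) w : 'M[R]_(e, 1 + d) := if (mk.2 < 2 ^ mk.1)%N then
  row_mx (zn n (mk.2 * 2 ^ (n - mk.1))%N w) (vn n (mk.2 * 2 ^ (n - mk.1))%N w) else 0.
have [n mk|w mk|c mc cP] := @measurable_cluster_mx R _ Om (nat * nat)%type _ _ u.
- rewrite /u; case: (mk.2 < 2 ^ mk.1)%N; last exact: measurable_entries_cst.
  have [mz mv] := mzv n (mk.2 * 2 ^ (n - mk.1))%N.
  move=> i j; under eq_fun do rewrite mxE.
  by case: fintype.split => k; [exact: mz|exact: mv].
- have [m0 [K [K0 KP]]] := est w; exists (K + K), (maxn m0 mk.1) => n.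
  rewrite geq_max => /andP[m0n mn]; rewrite /u; case: ifP => km; last by rewrite normr0 addr_ge0.
  have [hv hz _ _] := KP n m0n.
  have kn : (mk.2 * 2 ^ (n - mk.1) < 2 ^ n)%N.
    by rewrite -[X in (_ < 2 ^ X)%N](subnKC mn) expnD ltn_pmul2r ?expn_gt0.
  by rewrite (le_trans (norm_row_mx _ _))// lerD ?hv ?hz// ltnW.
pose Zd w m k : 'cV[R]_e := lsubmx (c (m, k) w).
pose Vd w m k : 'M[R]_(e, d) := rsubmx (c (m, k) w).
have vals w : exists2 K, 0 <= K & dyadic_values F K a (a `^ gamma) (xi w) (y w) (Zd w) (Vd w).
  have [m0 [K [K0 KP]]] := est w; have [phi kphi phiP] := cP w; exists K => //.
  apply: (@limit_dyadic_values K m0 (xi w) (y w) (fun n k => zn n k w) (fun n k => vn n k w)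
    phi) => // [n k|m k km]; first exact: euler_velocity_value.
  have := phiP (m, k); rewrite /u /= km => cu.
  have lE : (fun j => lsubmx (row_mx (zn (phi j) (k * 2 ^ (phi j - m))%N w)
      (vn (phi j) (k * 2 ^ (phi j - m))%N w))) = fun j => zn (phi j) (k * 2 ^ (phi j - m))%N w.
    by apply/funext => j; rewrite row_mxKl.
  have rE : (fun j => rsubmx (row_mx (zn (phi j) (k * 2 ^ (phi j - m))%N w)
      (vn (phi j) (k * 2 ^ (phi j - m))%N w))) = fun j => vn (phi j) (k * 2 ^ (phi j - m))%N w.
    by apply/funext => j; rewrite row_mxKr.
  by split; [rewrite -lE; exact: cvg_lsubmx|rewrite -rE; exact: cvg_rsubmx].
have g0 : 0 < gamma by case/andP: gamma01.
exists (fun w => dyadic_limit (Zd w)), (fun w => dyadic_limit (Vd w)); split=> [w|th mth th01].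
  have [K K0 DV] := vals w; exists (2 * K); first by rewrite mulr_ge0.
  exact: (dyadic_limit_solution g0 H0 F0 cF FH a01 b01 K0 (yM w) DV).
have th0 w : 0 <= th w by case/andP: (th01 w).
have cv w : Zd w l (dyadic_floor l (th w)) @[l --> \oo] --> dyadic_limit (Zd w) (th w) /\
    Vd w l (dyadic_floor l (th w)) @[l --> \oo] --> dyadic_limit (Vd w) (th w).
  have [K K0 DV] := vals w.
  exact: (dyadic_values_cvg a01 b01 K0 (yM w) DV).
split.
  apply: (measurable_entries_cvg (f_ := fun l w => Zd w l (dyadic_floor l (th w)))).
    move=> l i j; apply: (measurable_countable_index
      (K := fun w => dyadic_floor l (th w)) (f := fun k w => Zd w l k i j)) => k.
      exact: measurable_dyadic_floor.
    by rewrite /Zd; under eq_fun do rewrite mxE; exact: mc.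
  by move=> w; case: (cv w).
apply: (measurable_entries_cvg (f_ := fun l w => Vd w l (dyadic_floor l (th w)))).
  move=> l i j; apply: (measurable_countable_index
    (K := fun w => dyadic_floor l (th w)) (f := fun k w => Vd w l k i j)) => k.
    exact: measurable_dyadic_floor.
  by rewrite /Vd; under eq_fun do rewrite mxE; exact: mc.
by move=> w; case: (cv w).
Qed.

End solutions.

(** * Variation of the solutions in the clock of the driver *)

Section dyadic_control.
Context {R : realType}.
Implicit Types (u v g : R).

Definition staircase g N u : R := \sum_(m < N) g ^+ m * (dyadic_floor m.+1 u)%:R.

(** An increasing function which grows by at least [g ^ m] between two points
separated by the dyadic points of level [m + 1]; it is bounded because there are
[2 ^ (m + 1)] such points and [2 * g < 1]. *)
Definition dyadic_control g u : R := sup [set staircase g N u | N in setT].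

Lemma separation_level u v : 0 <= u -> u < v -> v < 1 ->
  exists m, dyadic_floor m u = dyadic_floor m v /\ (dyadic_floor m.+1 u < dyadic_floor m.+1 v)%N.
Proof.
move=> u0 uv v1; have v0 : 0 <= v by rewrite (le_trans u0)// ltW.
have ex : exists m, (dyadic_floor m u < dyadic_floor m v)%N.
  have e0 : 0 < v - u by rewrite subr_gt0.
  have [m _ mP] := near_infty_natSinv_expn_lt (PosNum e0).
  have := mP m (leqnn m); rewrite div1r /= => small; exists m.
  rewrite dyadic_floor_lt//.
  have /andP[_] := dyadic_floor_itv m v0; rewrite dyadicS => h.
  by move: h small; set x := _ ^-1; lra.
case: (ex_minnP ex) => -[|m] lt min.
  suff E : forall w : R, 0 <= w -> w < 1 -> dyadic_floor 0 w = 0%N.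
    by move: lt; rewrite !E// (lt_trans uv).
  by move=> w w0 w1; apply/eqP; rewrite -leqn0 -ltnS dyadic_floor_lt// /dyadic expr0 divr1.
exists m; split=> //; apply/eqP; rewrite eqn_leq dyadic_floor_homo ?(ltW uv)//=.
by rewrite leqNgt; apply/negP => /min; rewrite ltnn.
Qed.

Section fixed_ratio.
Variable g : R.
Hypothesis g0 : 0 < g.
Hypothesis g2 : 2 * g < 1.

Let g_ge0 := ltW g0.

Lemma staircase_ge0 N u : 0 <= staircase g N u.
Proof. by apply: sumr_ge0 => m _; rewrite mulr_ge0// exprn_ge0. Qed.

Lemma staircase_le N u : 0 <= u < 1 -> staircase g N u <= 2 / (1 - 2 * g).
Proof.
move=> u01; have k0 : 0 < 1 - 2 * g by rewrite subr_gt0.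
apply: (@le_trans _ _ (2 * \sum_(m < N) (2 * g) ^+ m)).
  rewrite /staircase mulr_sumr; apply: ler_sum => m _.
  rewrite exprMn mulrA mulrC ler_wpM2r ?exprn_ge0// -exprS -natrX ler_nat.
  by rewrite ltnW// dyadic_floor_lt_expn.
rewrite ler_pM2l// -[leRHS]mul1r ler_pdivlMr// mulrC.
have := subrX1 (2 * g) N => E.
have : 0 <= (2 * g) ^+ N by rewrite exprn_ge0// mulr_ge0.
by move: E; set S := \sum_(_ < _) _; lra.
Qed.

Lemma staircase_homoN N N' u : (N <= N')%N -> staircase g N u <= staircase g N' u.
Proof.
move=> NN'; rewrite /staircase -(subnKC NN') big_split_ord /= lerDl.
by apply: sumr_ge0 => m _; rewrite mulr_ge0// exprn_ge0.
Qed.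

Lemma dyadic_control_has_sup u : 0 <= u < 1 -> has_sup [set staircase g N u | N in setT].
Proof.
move=> u01; split; first by exists (staircase g 0 u), 0%N.
by exists (2 / (1 - 2 * g)) => _ [N _ <-]; exact: staircase_le.
Qed.

Lemma dyadic_control_bounds u : 0 <= u < 1 -> 0 <= dyadic_control g u <= 2 / (1 - 2 * g).
Proof.
move=> u01; have hs := dyadic_control_has_sup u01; apply/andP; split.
  apply: (le_trans (staircase_ge0 0 u)); apply: ub_le_sup; first by case: hs.
  by exists 0%N.
by apply: ge_sup; [case: hs|move=> _ [N _ <-]; exact: staircase_le].
Qed.

Lemma dyadic_control_growth u v m : 0 <= u -> u < v -> v < 1 ->
  (dyadic_floor m.+1 u < dyadic_floor m.+1 v)%N ->
  g ^+ m <= dyadic_control g v - dyadic_control g u.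
Proof.
move=> u0 uv v1 lt; rewrite lerBrDr -lerBrDl.
have v0 : 0 <= v by rewrite (le_trans u0)// ltW.
have u01 : 0 <= u < 1 by rewrite u0 (lt_trans uv).
have v01 : 0 <= v < 1 by rewrite v0.
apply: ge_sup => [|_ [N _ <-]]; first by case: (dyadic_control_has_sup u01).
rewrite lerBrDl; pose N' := maxn N m.+1.
apply: (@le_trans _ _ (g ^+ m + staircase g N' u)).
  by rewrite lerD2l staircase_homoN// leq_maxl.
apply: (@le_trans _ _ (staircase g N' v)); last first.
  by apply: ub_le_sup; [case: (dyadic_control_has_sup v01)|exists N'].
have mN : (m < N')%N by rewrite leq_maxr.
rewrite /staircase (bigD1 (Ordinal mN))//= [leRHS](bigD1 (Ordinal mN))//= addrA lerD//.
  rewrite -[X in X + _ <= _]mulr1 -mulrDr ler_wpM2l ?exprn_ge0//.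
  by rewrite -(natrD _ 1%N) ler_nat add1n.
apply: ler_sum => j _; rewrite ler_wpM2l ?exprn_ge0// ler_nat.
by rewrite dyadic_floor_homo// ltW.
Qed.

End fixed_ratio.

End dyadic_control.

Section solution_variation.
Context {R : realType} {d e : nat}.
Variables (F : 'cV[R]_e -> set 'M[R]_(e, d)) (K M a b : R).
Variables (xi : 'cV[R]_e) (y : R -> 'cV[R]_d) (Z : R -> 'cV[R]_e) (V : R -> 'M[R]_(e, d)).
Hypothesis K0 : 0 <= K.
Hypothesis M0 : 0 <= M.
Hypothesis a01 : 0 < a < 1.
Hypothesis b01 : 0 < b < 1.
Hypothesis ab12 : 2 * (a * b) < 1.
Hypothesis yM : driver_bound M a y.
Hypothesis sol : dyadic_solution F K a b xi y Z V.

Let a0 : 0 < a. Proof. by case/andP: a01. Qed.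
Let b0 : 0 < b. Proof. by case/andP: b01. Qed.
Let a1 : a <= 1. Proof. by case/andP: a01 => _ /ltW. Qed.
Let b1 : b <= 1. Proof. by case/andP: b01 => _ /ltW. Qed.

Definition defect (s t : R) := Z t - Z s - V s *m (y t - y s).

Lemma defect_split s c t :
  defect s t = defect s c + defect c t + (V c - V s) *m (y t - y c).
Proof.
exact: left_point_split.
Qed.

(** If [l = m], both points lie in one interval of level [m]. Otherwise a dyadic point
[be] of level [m + 1] separates [u] from [v], and the defects from [u] to [be] and
from [be] to [v] live in the two intervals of level [l] adjacent to [be]. *)
Lemma defect_bound u v m l : 0 <= u -> u < v -> v < 1 ->
  dyadic_floor m u = dyadic_floor m v ->
  (dyadic_floor m.+1 u < dyadic_floor m.+1 v)%N ->
  (m <= l)%N -> v - u <= 2 ^- l ->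
  `|defect u v| <= (2 * K + d%:R * K * M) * (b ^+ m * a ^+ l).
Proof.
move=> u0 uv v1 Em lt ml uvl.
have v0 : 0 <= v by rewrite (le_trans u0)// ltW.
have ba0 : 0 <= b ^+ m * a ^+ l by rewrite mulr_ge0// exprn_ge0// ltW.
have dKM : 0 <= d%:R * K * M by rewrite !mulr_ge0.
move: ml; rewrite leq_eqVlt => /orP[/eqP El|ml].
  subst l; have /andP[f1 f2] := dyadic_floor_itv m u0.
  have /andP[f3 f4] := dyadic_floor_itv m v0.
  have := solution_remainder sol f1 (ltW uv) _ f2 v1; rewrite Em => /(_ (ltW f4)).
  move=> /le_trans; apply; rewrite exprMn [a ^+ m * _]mulrC ler_wpM2r//.
  by move: K0 dKM; lra.
pose p := dyadic_floor m.+1 v; pose be : R := dyadic m.+1 p.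
have ube : u < be by rewrite -dyadic_floor_lt.
have bev : be <= v by rewrite -dyadic_floor_ge.
have be0 : 0 <= be by exact: dyadic_ge0.
have be1 : be < 1 by exact: le_lt_trans v1.
have p0 : (0 < p)%N by exact: leq_ltn_trans lt.
pose p' := (p * 2 ^ (l - m.+1))%N.
have Ebe : be = dyadic l p' by rewrite /p' dyadicM.
have p'0 : (0 < p')%N by rewrite muln_gt0 p0 expn_gt0.
have Ebe' : be = dyadic l p'.-1 + 2 ^- l by rewrite -dyadicS prednK.
have h1 : `|defect u be| <= K * (a * b) ^+ l.
  apply: (solution_remainder sol (m := l) (i := p'.-1)) => //.
  - by move: Ebe' uvl bev; set x := _ ^-1; lra.
  - exact: ltW.
  - by rewrite prednK// -Ebe.
  - by rewrite prednK// -Ebe.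
have Ebv : v <= be + 2 ^- l by move: uvl ube; set x := _ ^-1; lra.
have h2 : `|defect be v| <= K * (a * b) ^+ l.
  apply: (solution_remainder sol (m := l) (i := p')) => //.
  - by rewrite Ebe.
  - by rewrite dyadicS -Ebe.
  - by rewrite dyadicS -Ebe ltrDl invr_gt0 exprn_gt0.
have h3 : `|(V be - V u) *m (y v - y be)| <= d%:R * K * M * (b ^+ m * a ^+ l).
  rewrite (le_trans (mx_norm_mul _ _))//.
  have -> : d%:R * K * M * (b ^+ m * a ^+ l) = d%:R * (K * b ^+ m) * (M * a ^+ l) by ring.
  apply: ler_pM; rewrite ?mulr_ge0//.
    rewrite ler_wpM2l//; apply: (solution_oscillation sol); rewrite ?be0 ?u0 ?(lt_trans uv)//.
    apply/eqP; rewrite eqn_leq {1}Em !dyadic_floor_homo ?(ltW ube)//.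
  apply: yM => //; move: uvl ube; set x := _ ^-1; lra.
have h4 : K * (a * b) ^+ l <= K * (b ^+ m * a ^+ l).
  rewrite ler_wpM2l// exprMn mulrC ler_wpM2r ?exprn_ge0 ?(ltW a0)//.
  by rewrite ler_wiXn2l ?(ltW b0)// ltnW.
rewrite (defect_split u be v) (le_trans (ler_normD _ _))//.
rewrite (le_trans (lerD (ler_normD _ _) (lexx _)))//.
by move: h1 h2 h3 h4; lra.
Qed.

Let C := 2 * K + d%:R * K * M.
Let C0 : 0 <= C. Proof. by rewrite addr_ge0 ?mulr_ge0// !mulr_ge0. Qed.

Lemma small_separation (u v : R) m : 0 <= u -> u < v -> dyadic_floor m u = dyadic_floor m v ->
  v - u <= 2 ^- m.
Proof.
move=> u0 uv Em; have v0 : 0 <= v by rewrite (le_trans u0)// ltW.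
have /andP[f1 f2] := dyadic_floor_itv m u0.
have /andP[f3 f4] := dyadic_floor_itv m v0.
by move: f1 f4; rewrite -Em dyadicS; set x := _ ^-1; lra.
Qed.

(** The defects are summable over any partition, with a total that vanishes with
the mesh: this is the convergence of the Young sums. *)
Lemma defect_control : exists rho Gam B, [/\ 0 < rho < 1, 0 <= B,
  forall u, 0 <= u < 1 -> 0 <= Gam u <= B &
  forall u v l, 0 <= u -> u < v -> v < 1 -> v - u <= 2 ^- l ->
    `|defect u v| <= rho ^+ l * (Gam v - Gam u)].
Proof.
have ab0 : 0 < a * b by rewrite mulr_gt0.
(* The factor [a^l] is split as [rho^l (a / rho)^l]: the first one vanishes with the
mesh, and [rho] is so close to one that [2 * (b * (a / rho)) < 1]. *)
pose mx := Num.max a (2 * (a * b)).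
have mx1 : mx < 1 by rewrite gt_max ab12 andbT; case/andP: a01.
have amx : a <= mx by rewrite le_max lexx.
have abmx : 2 * (a * b) <= mx by rewrite le_max lexx orbT.
pose rho := (mx + 1) / 2.
have rho1 : rho < 1 by rewrite /rho; lra.
have mxrho : mx < rho by rewrite /rho; lra.
have rho0 : 0 < rho by rewrite (lt_trans _ mxrho)// (lt_le_trans a0).
pose g := b * (a / rho).
have ar0 : 0 < a / rho by rewrite divr_gt0.
have ar1 : a / rho <= 1 by rewrite ler_pdivrMr// mul1r (le_trans amx)// ltW.
have g0 : 0 < g by rewrite mulr_gt0.
have g2 : 2 * g < 1.
  have -> : 2 * g = 2 * (a * b) / rho by rewrite /g; ring.
  by rewrite ltr_pdivrMr// mul1r (le_lt_trans abmx).
exists rho, (fun u => C * dyadic_control g u), (C * (2 / (1 - 2 * g))).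
have B0 : 0 <= 2 / (1 - 2 * g) by rewrite divr_ge0// subr_ge0 ltW.
split; [by rewrite rho0|by rewrite mulr_ge0| |].
  move=> u u01; have /andP[h1 h2] := dyadic_control_bounds g0 g2 u01.
  by rewrite mulr_ge0//= ler_wpM2l.
move=> u v l u0 uv v1 uvl; have [m [Em lt]] := separation_level u0 uv v1.
have uvm := small_separation u0 uv Em.
pose l' := maxn l m.
have uvl' : v - u <= 2 ^- l' by rewrite /l' /maxn; case: ifP.
rewrite (le_trans (defect_bound u0 uv v1 Em lt (leq_maxr l m) uvl'))//.
rewrite -/C -mulrBr [leRHS]mulrCA ler_wpM2l//.
apply: (@le_trans _ _ (rho ^+ l * g ^+ m)); last first.
  rewrite ler_wpM2l ?exprn_ge0 ?(ltW rho0)//.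
  exact: dyadic_control_growth.
have -> : a ^+ l' = rho ^+ l' * (a / rho) ^+ l' by rewrite -exprMn mulrC divfK ?gt_eqF.
have -> : g ^+ m = b ^+ m * (a / rho) ^+ m by rewrite -exprMn.
rewrite mulrCA ler_pM ?mulr_ge0 ?exprn_ge0 ?(ltW rho0) ?(ltW b0) ?(ltW ar0)//.
  by rewrite ler_wiXn2l ?(ltW rho0) ?(ltW rho1) ?leq_maxl.
rewrite ler_wpM2l ?exprn_ge0 ?(ltW b0)//.
by rewrite ler_wiXn2l ?(ltW ar0) ?leq_maxr.
Qed.

Lemma position_increment u v l : 0 <= u -> u < v -> v < 1 -> v - u <= 2 ^- l ->
  `|Z v - Z u| <= (C + d%:R * K * M) * a ^+ l.
Proof.
move=> u0 uv v1 uvl; have [m [Em lt]] := separation_level u0 uv v1.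
have uvm := small_separation u0 uv Em.
have uvl' : v - u <= 2 ^- (maxn l m) by rewrite /maxn; case: ifP.
have h1 := defect_bound u0 uv v1 Em lt (leq_maxr l m) uvl'.
have h2 : C * (b ^+ m * a ^+ maxn l m) <= C * a ^+ l.
  rewrite ler_wpM2l// mulrC.
  rewrite (@le_trans _ _ (a ^+ maxn l m))//.
    by rewrite ler_piMr ?exprn_ge0 ?(ltW a0)// exprn_ile1// ltW.
  by rewrite ler_wiXn2l ?(ltW a0)// leq_maxl.
have h3 : `|V u *m (y v - y u)| <= d%:R * K * M * a ^+ l.
  have -> : d%:R * K * M * a ^+ l = d%:R * K * (M * a ^+ l) by ring.
  rewrite (le_trans (mx_norm_mul _ _))//.
  apply: ler_pM; rewrite ?mulr_ge0//; last by apply: yM => //; exact: ltW.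
  by rewrite ler_wpM2l//; apply: (solution_bound sol); rewrite u0 (lt_trans uv).
have -> : Z v - Z u = defect u v + V u *m (y v - y u) by rewrite /defect subrK.
rewrite (le_trans (ler_normD _ _))// mulrDl lerD//; exact: le_trans h2.
Qed.

(** Two points at distance about [2^-l] have positions at distance [O(a^l)], and [a^q = 1/2]. *)
Lemma position_variation q : 0 < q -> a `^ q = 2^-1 ->
  exists2 C', 0 <= C' & forall u v, 0 <= u -> u < v -> v < 1 ->
    `|Z v - Z u| `^ q <= C' * (v - u).
Proof.
move=> q0 aq; set C1 := C + d%:R * K * M.
have C10 : 0 <= C1 by rewrite addr_ge0// !mulr_ge0.
exists (2 * C1 `^ q); first by rewrite mulr_ge0 ?powR_ge0.
move=> u v u0 uv v1.
have [l [h1 h2]] : exists l, v - u <= 2 ^- l /\ 2 ^- l <= 2 * (v - u).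
  have ex : exists l, (2 ^- l <= 2 * (v - u)).
    have e0 : 0 < 2 * (v - u) by rewrite mulr_gt0// subr_gt0.
    have [l _ lP] := near_infty_natSinv_expn_lt (PosNum e0).
    by exists l; have := lP l (leqnn l); rewrite div1r /= => /ltW.
  case: (ex_minnP ex) => -[|l] hl min.
    by exists 0%N; split=> //; rewrite expr0 invr1; lra.
  exists l.+1; split=> //; rewrite leNgt; apply/negP => lt.
  have : 2 ^- l <= 2 * (v - u).
    rewrite -ler_pdivrMl// -invfM -exprS; exact: ltW.
  by move=> /min; rewrite ltnn.
apply: (@le_trans _ _ ((C1 * a ^+ l) `^ q)).
  apply: ge0_ler_powR; rewrite ?nnegrE ?mulr_ge0 ?exprn_ge0 ?(ltW a0) ?(ltW q0)//.
  exact: position_increment.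
rewrite powRM ?exprn_ge0 ?(ltW a0)// [2 * _]mulrC -mulrA ler_wpM2l ?powR_ge0//.
have -> : (a ^+ l) `^ q = 2 ^- l.
  by rewrite -powR_mulrn ?(ltW a0)// powRAC aq powR_mulrn ?invr_ge0// exprVn.
by [].
Qed.

(** Two points first separated at level [m + 1] have velocities at distance [O(b^m)]. *)
Lemma velocity_variation p : 0 < p -> 2 * b `^ p < 1 ->
  exists Gam B, [/\ 0 <= B, forall u, 0 <= u < 1 -> 0 <= Gam u <= B &
    forall u v, 0 <= u -> u < v -> v < 1 -> `|V v - V u| `^ p <= Gam v - Gam u].
Proof.
move=> p0 bp; pose g := b `^ p; have g0 : 0 < g by rewrite powR_gt0.
have B0 : 0 <= 2 / (1 - 2 * g) by rewrite divr_ge0// subr_ge0 ltW.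
exists (fun u => K `^ p * dyadic_control g u), (K `^ p * (2 / (1 - 2 * g))); split.
- by rewrite mulr_ge0 ?powR_ge0.
- move=> u u01; have /andP[h1 h2] := dyadic_control_bounds g0 bp u01.
  by rewrite mulr_ge0 ?powR_ge0//= ler_wpM2l ?powR_ge0.
move=> u v u0 uv v1; have [m [Em lt]] := separation_level u0 uv v1.
have v0 : 0 <= v by rewrite (le_trans u0)// ltW.
rewrite -mulrBr; apply: (@le_trans _ _ (K `^ p * g ^+ m)); last first.
  by rewrite ler_wpM2l ?powR_ge0//; exact: dyadic_control_growth.
have -> : g ^+ m = (b ^+ m) `^ p.
  by rewrite /g -powR_mulrn ?powR_ge0// powRAC powR_mulrn// ltW.
rewrite -powRM ?exprn_ge0 ?(ltW b0)//.
apply: ge0_ler_powR; rewrite ?nnegrE ?mulr_ge0 ?exprn_ge0 ?(ltW b0) ?(ltW p0)//.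
by apply: (solution_oscillation sol); rewrite ?v0 ?u0 ?(lt_trans uv).
Qed.

Lemma velocity_right_continuous t (ep : R) : 0 <= t < 1 -> 0 < ep ->
  exists2 dl, 0 < dl & forall s, t <= s -> s < t + dl -> s < 1 -> `|V s - V t| < ep.
Proof.
move=> /andP[t0 t1] ep0.
have /cvgrPdist_lt/(_ ep ep0)[m _ /(_ m (leqnn m))] := cvg_geometric0 K b01.
rewrite sub0r normrN => mP; have /andP[f1 f2] := dyadic_floor_itv m t0.
exists (dyadic m (dyadic_floor m t).+1 - t); first by rewrite subr_gt0.
move=> s ts; rewrite addrC subrK => sd s1; apply: le_lt_trans mP.
apply: le_trans (ler_norm _); have s0 : 0 <= s by exact: le_trans ts.
apply: (solution_oscillation sol); rewrite ?s0 ?t0//.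
apply/eqP; rewrite eqn_leq (@dyadic_floor_homo _ m t s)// andbT.
by rewrite -ltnS dyadic_floor_lt.
Qed.

Lemma velocity_left_cauchy t (ep : R) : 0 < t -> t < 1 -> 0 < ep ->
  exists2 dl, 0 < dl & forall s s', 0 <= s -> t - dl <= s -> s < t ->
    0 <= s' -> t - dl <= s' -> s' < t -> `|V s - V s'| < ep.
Proof.
move=> t0 t1 ep0.
have /cvgrPdist_lt/(_ ep ep0)[m _ /(_ m (leqnn m))] := cvg_geometric0 K b01.
rewrite sub0r normrN => mP.
have ex : exists k, t <= dyadic m k.
  have /andP[_ /ltW] := dyadic_floor_itv m (ltW t0).
  by exists (dyadic_floor m t).+1.
case: (ex_minnP ex) => -[|k] tk min.
  by move: tk; rewrite /dyadic mul0r leNgt t0.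
have kt : dyadic m k < t by rewrite ltNge; apply/negP => /min; rewrite ltnn.
exists (t - dyadic m k); first by rewrite subr_gt0.
have fl s : 0 <= s -> t - (t - dyadic m k) <= s -> s < t -> dyadic_floor m s = k.
  move=> s0; rewrite subKr => ks st; apply/eqP; rewrite eqn_leq.
  by rewrite dyadic_floor_ge// ks andbT -ltnS dyadic_floor_lt// (lt_le_trans st).
move=> s s' s0 ds st s'0 ds' s't; apply: le_lt_trans mP; apply: le_trans (ler_norm _).
apply: (solution_oscillation sol); rewrite ?s0 ?s'0 ?(lt_trans st) ?(lt_trans s't)//.
by rewrite !fl.
Qed.

Lemma velocity_left_limit t : 0 < t -> t < 1 ->
  exists w, forall ep, 0 < ep -> exists2 dl, 0 < dl &
    forall s, 0 <= s -> t - dl <= s -> s < t -> `|w - V s| < ep.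
Proof.
move=> t0 t1; pose u k : R := t - t * k.+1%:R^-1.
have k1 k : t * k.+1%:R^-1 <= t.
  by rewrite ger_pMr// invf_le1 ?ler1n.
have u0 k : 0 <= u k by rewrite subr_ge0.
have ut k : u k < t by rewrite ltrBlDr ltrDl mulr_gt0.
have ud dl : 0 < dl -> \forall k \near \oo, t - dl <= u k.
  move=> dl0; have d0 : 0 < dl / t by rewrite divr_gt0.
  have := near_infty_natSinv_lt (PosNum d0); apply: filterS => k /= /ltW.
  by rewrite ler_pdivlMr// mulrC /u => h; rewrite lerD2l lerN2.
have cu : cvg (V (u k) @[k --> \oo]).
  apply: cauchy_cvg; apply: cauchy_exP => ep ep0.
  have [dl dl0 dlP] := velocity_left_cauchy t0 t1 ep0.
  have [m _ mP] := ud dl dl0; exists (V (u m)).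
  exists m => // k mk; rewrite /= -ball_normE /=.
  by apply: dlP => //; apply: mP => //=.
exists (lim (V (u k) @[k --> \oo])) => ep ep0.
have ep2 : 0 < ep / 2 by rewrite divr_gt0.
have [dl dl0 dlP] := velocity_left_cauchy t0 t1 ep2.
exists dl => // s s0 ds st; apply: (@le_lt_trans _ _ (ep / 2)); last first.
  by rewrite ltr_pdivrMr// ltr_pMr// ltr1n.
apply: (norm_cvg_le (v := fun k => V (u k) - V s)).
  by apply: cvgB => //; exact: cvg_cst.
by apply: filterS (ud dl dl0) => k dk; apply: ltW; apply: dlP.
Qed.

End solution_variation.

(** * Change of time *)

Section time_change.
Context {R : realType} {d : nat}.
Variables (q T C : R) (x : R -> 'cV[R]_d).
Hypothesis q12 : 1 <= q < 2.
Hypothesis T0 : 0 < T.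
Hypothesis cx : continuous x.
Hypothesis xC : forall l, path <=%R 0 l -> power_sum q x 0 l <= C.
Local Notation W := (cumulated q x).

(** The term [t] makes it strictly increasing, and the summand 1 of the denominator
keeps its values on [0, T] below one, where the dyadic solutions live. *)
Definition clock (q T : R) (x : R -> 'cV[R]_d) (t : R) : R :=
  (t + cumulated q x t) / (1 + T + cumulated q x T).
Local Notation th := (clock q T x).

Let q0 : 0 < q. Proof. by case/andP: q12 => + _; apply: lt_le_trans. Qed.

Lemma clock_speed_gt0 : 0 < 1 + T + W T.
Proof. by have := cumulated_ge0 xC T; move: T0; lra. Qed.

Lemma clock_continuous : continuous th.
Proof.
move=> t; apply: cvgM; last exact: cvg_cst.
by apply: cvgD; [exact: cvg_id|exact: (cumulated_continuous q12 cx xC)].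
Qed.

Lemma clock_lt s t : (th s < th t) = (s < t).
Proof.
have h := le_cumulated_homo q12 xC.
rewrite /clock ltr_pM2r ?invr_gt0 ?clock_speed_gt0//.
have [st|ts] := ltP s t; first by have := h _ _ (ltW st); lra.
by apply/negbTE; rewrite -leNgt lerD// h.
Qed.

Lemma clock_le s t : (th s <= th t) = (s <= t).
Proof. by rewrite !leNgt clock_lt. Qed.

Lemma clock0 : th 0 = 0.
Proof. by rewrite /clock (cumulated_le0 q12 xC) ?addr0 ?mul0r. Qed.

Lemma clock_itv t : 0 <= t <= T -> 0 <= th t < 1.
Proof.
move=> /andP[t0 tT]; rewrite -{1}clock0 clock_le t0 /=.
rewrite (@le_lt_trans _ _ (th T)) ?clock_le//.
by rewrite /clock ltr_pdivrMr ?clock_speed_gt0// mul1r; lra.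
Qed.

Lemma clock_onto u : 0 <= u -> exists t, th t = u.
Proof.
move=> u0; set L := 1 + T + W T; have L0 : 0 < L := clock_speed_gt0.
have Lu : 0 <= L * u by rewrite mulr_ge0// ltW.
have cth : {within `[0, L * u], continuous th}.
  by apply: continuous_subspaceT => t; exact: clock_continuous.
have [|t _ tu] := @IVT R th 0 (L * u) u Lu cth; last by exists t.
have h : th 0 <= th (L * u) by rewrite clock_le.
rewrite min_l// max_r// clock0 u0 /= /clock ler_pdivlMr// -/L.
by rewrite mulrC lerDl (cumulated_ge0 xC).
Qed.

Definition clock_inverse (u : R) : R := xget 0 [set t | th t = u].

Lemma clock_inverseK u : 0 <= u -> th (clock_inverse u) = u.
Proof. by move=> /clock_onto[t tu]; rewrite /clock_inverse; case: xgetP => [s _ //|/(_ t)]. Qed.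

Lemma clockK t : 0 <= t -> clock_inverse (th t) = t.
Proof.
move=> t0; have h : 0 <= th t by rewrite -clock0 clock_le.
apply/eqP; rewrite eq_le -[X in X && _]clock_le -[X in _ && X]clock_le.
by rewrite clock_inverseK// lexx.
Qed.

Lemma clock_inverse_ge0 u : 0 <= u -> 0 <= clock_inverse u.
Proof. by move=> u0; rewrite -clock_le clock0 clock_inverseK. Qed.

(** The increments of [x], to the power q, are bounded by those of the cumulated
variation, hence by those of the clock up to its speed. *)
Lemma clock_driver_bound : exists2 M, 0 <= M &
  driver_bound M (2 `^ (- q^-1)) (x \o clock_inverse).
Proof.
set L := 1 + T + W T; have L0 : 0 < L := clock_speed_gt0.
exists (L `^ q^-1); first exact: powR_ge0.
move=> m s t s0 st tsm /=; have t0 : 0 <= t by exact: le_trans st.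
set s' := clock_inverse s; set t' := clock_inverse t.
have s't' : s' <= t' by rewrite -clock_le !clock_inverseK.
have s'0 : 0 <= s' by exact: clock_inverse_ge0.
have inc := cumulated_increment xC s'0 s't'.
have Lst : W t' - W s' <= L * 2 ^- m.
  apply: (@le_trans _ _ (L * (t - s))); last by rewrite ler_wpM2l// ltW.
  rewrite -[in leRHS](clock_inverseK t0) -[in leRHS](clock_inverseK s0) /clock -/L.
  by rewrite mulrBr ![L * _]mulrC !divfK ?gt_eqF// -/s' -/t'; lra.
have E : (L * 2 ^- m) `^ q^-1 = L `^ q^-1 * (2 `^ (- q^-1)) ^+ m.
  rewrite powRM ?(ltW L0) ?invr_ge0 ?exprn_ge0//; congr (_ * _).
  have E1 : 2 ^- m = 2 `^ (- m%:R) :> R by rewrite powR_invn.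
  have E2 : (2 `^ (- q^-1)) ^+ m = 2 `^ (- q^-1 * m%:R) by rewrite powRrM powR_mulrn ?powR_ge0.
  by rewrite E1 E2 -powRrM mulNr mulNr [q^-1 * _]mulrC.
rewrite -E leNgt; apply/negP => lt.
have := gt0_ltr_powR q0 _ _ lt; rewrite !nnegrE powR_ge0 normr_ge0 -powRrM mulVf ?gt_eqF//.
rewrite powRr1 ?mulr_ge0 ?invr_ge0 ?exprn_ge0 ?(ltW L0)// => /(_ erefl erefl).
by rewrite ltNge (le_trans inc).
Qed.

End time_change.

Section measurable_clock.
Context {R : realType} {d : nat} {dm : measure_display} {Om : measurableType dm}.
Variables (q T : R) (x : Om -> R -> 'cV[R]_d).
Hypothesis q12 : 1 <= q < 2.
Hypothesis T0 : 0 < T.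
Hypothesis mx : forall t, 0 <= t -> measurable_entries (x ^~ t).
Hypothesis cx : forall w, continuous (x w).
Hypothesis xC : forall w, exists C, forall l, path <=%R 0 l -> power_sum q (x w) 0 l <= C.

Let q0 : 0 < q. Proof. by case/andP: q12 => + _; apply: lt_le_trans. Qed.

Lemma measurable_power_sum a l : 0 <= a -> (forall s, s \in l -> 0 <= s) ->
  measurable_fun setT (fun w => power_sum q (x w) a l).
Proof.
elim: l a => [|b l IH] a a0 l0 /=; first exact: measurable_cst.
have b0 : 0 <= b by rewrite l0// mem_head.
apply: measurable_funD; last by apply: IH => // s sl; rewrite l0// inE sl orbT.
apply: (measurableT_comp (f := fun r : R => r `^ q)); first exact: measurable_powR.
by apply/measurable_entries_norm/measurable_entriesB; exact: mx.
Qed.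

(** By continuity of the path, moving the points of a partition to dyadic points below
them hardly changes its sum: countably many partitions suffice. *)
Lemma cumulated_gt_dyadic w t c : 0 <= t ->
  c < cumulated q (x w) t <-> exists kl : nat * seq nat,
    [/\ path leq 0%N kl.2, dyadic kl.1 (last 0%N kl.2) <= t &
        c < power_sum q (x w) 0 (map (dyadic kl.1) kl.2)].
Proof.
move=> t0; have [C xCw] := xC w; split=> [lt|[[k l] /= [pl lt cl]]]; last first.
  have d0 : dyadic k 0 = 0 :> R by rewrite /dyadic mul0r.
  apply: (lt_le_trans cl); apply: (le_cumulated xCw); last by rewrite -{1}d0 last_map.
  rewrite -{1}d0; elim: l {lt cl} 0%N pl => //= j l IH i /andP[ij pl].
  by rewrite le_dyadic//= IH.
have e0 : 0 < cumulated q (x w) t - c by rewrite subr_gt0.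
have [l [pl lt' cl]] := cumulated_adherent xCw t0 e0.
have {}cl : c < power_sum q (x w) 0 l by move: cl; lra.
pose fl k (s : R) := dyadic k (dyadic_floor k s) : R.
have l0 : forall s, s \in 0 :: l -> 0 <= s.
  by move=> s; rewrite inE => /orP[/eqP->//|]; apply/allP; apply: order_path_min pl; exact: le_trans.
have cv : power_sum q (x w) (fl k 0) (map (fl k) l) @[k --> \oo] --> power_sum q (x w) 0 l.
  by apply: cvg_power_sum => // s sl; apply: cvg_dyadic_floor; exact: l0.
have pfl k : path leq (dyadic_floor k (0 : R)) (map (dyadic_floor k) l).
  have : forall a : R, 0 <= a -> path <=%R a l ->
      path leq (dyadic_floor k a) (map (dyadic_floor k) l).
    elim: {pl lt' cl l0 cv} l => //= b l IH a a0 /andP[ab pl].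
    by rewrite dyadic_floor_homo//= IH// (le_trans a0).
  by apply.
near \oo => k; exists (k, map (dyadic_floor k) l); rewrite /=.
have f0 : dyadic_floor k (0 : R) = 0%N by rewrite /dyadic_floor mulr0 truncn0.
have : c < power_sum q (x w) (fl k 0) (map (fl k) l).
  by near: k; exact: cvgr_gt cv _ cl.
rewrite -map_comp {1}/fl f0 {1}/dyadic mul0r => ck; split=> //.
  by rewrite -{1}f0.
rewrite -f0 last_map (le_trans _ lt')//.
have ll : 0 <= last 0 l by apply: l0; exact: mem_last.
by have /andP[] := dyadic_floor_itv k ll.
Unshelve. all: by end_near. Qed.

Lemma measurable_cumulated t : 0 <= t ->
  measurable_fun setT (fun w => cumulated q (x w) t).
Proof.
move=> t0; apply: (measurability _ (RGenOInfty.measurableE R)) => _ [_ [c ->] <-].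
rewrite setTI (_ : _ @^-1` _ = \bigcup_(kl in [set kl : nat * seq nat |
    path leq 0%N kl.2 /\ dyadic kl.1 (last 0%N kl.2) <= t])
    [set w | c < power_sum q (x w) 0 (map (dyadic kl.1) kl.2)]).
  rewrite bigcup_mkcond; apply: countable_bigcupT_measurable => // kl; case: ifP => // _.
  rewrite -[X in measurable X]setTI.
  apply: (measurable_fun_ltr (measurable_cst c) _ measurableT (Y := [set true])) => //.
  by apply: measurable_power_sum => // s /mapP[j _ ->]; exact: dyadic_ge0.
apply/seteqP; split=> w; rewrite /preimage /= in_itv /= andbT.
  by move/(cumulated_gt_dyadic _ _ t0) => [kl [h1 h2 h3]]; exists kl.
by move=> [kl [h1 h2] h3]; apply/(cumulated_gt_dyadic _ _ t0); exists kl.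
Qed.

Lemma measurable_clock t : 0 <= t -> measurable_fun setT (fun w => clock q T (x w) t).
Proof.
move=> t0; apply: measurable_funM.
  by apply: measurable_funD; [exact: measurable_cst|exact: measurable_cumulated].
have -> : (fun w => (1 + T + cumulated q (x w) T)^-1) =
    (fun w => (1 + T + cumulated q (x w) T) `^ (-1)).
  apply/funext => w; have [C xCw] := xC w.
  by rewrite powR_inv1// ltW// (clock_speed_gt0 T0 xCw).
apply: (measurableT_comp (f := fun r : R => r `^ (-1))); first exact: measurable_powR.
by apply: measurable_funD => //; apply: measurable_cumulated; exact: ltW.
Qed.

(** The inverse clock at [u] exceeds [c] exactly when the clock at [c] does not exceed [u]. *)
Lemma measurable_clock_inverse u : 0 <= u ->
  measurable_fun setT (fun w => clock_inverse q T (x w) u).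
Proof.
move=> u0; apply: (measurability _ (RGenCInfty.measurableE R)) => _ [_ [c ->] <-].
rewrite setTI (_ : _ @^-1` _ = [set w | clock q T (x w) c <= u]); last first.
  have E w : (c <= clock_inverse q T (x w) u) = (clock q T (x w) c <= u).
    have [C xCw] := xC w.
    by rewrite -[LHS](clock_le q12 T0 xCw) (clock_inverseK q12 T0 (@cx w) xCw).
  by apply/seteqP; split=> w; rewrite /preimage /= in_itv /= andbT E.
have [c0|c0] := leP 0 c.
  rewrite -[X in measurable X]setTI.
  apply: (measurable_fun_ler _ (measurable_cst u) measurableT (Y := [set true])) => //.
  exact: measurable_clock.
rewrite (_ : mkset _ = setT); first exact: measurableT.
apply/seteqP; split=> // w _ /=; have [C xCw] := xC w.
by rewrite (le_trans _ u0)// -(clock0 T q12 xCw) (clock_le q12 T0 xCw) ltW.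
Qed.

Lemma measurable_driver u : 0 <= u ->
  measurable_entries (fun w => x w (clock_inverse q T (x w) u)).
Proof.
move=> u0; pose ta w := clock_inverse q T (x w) u.
have ta0 w : 0 <= ta w.
  by have [C xCw] := xC w; exact: (clock_inverse_ge0 q12 T0 (@cx w) xCw).
apply: (measurable_entries_cvg (f_ := fun k w => x w (dyadic k (dyadic_floor k (ta w))))).
  move=> k i j; apply: (measurable_countable_index
    (K := fun w => dyadic_floor k (ta w)) (f := fun l w => x w (dyadic k l) i j)) => l.
    by apply: measurable_dyadic_floor => //; exact: measurable_clock_inverse.
  by apply: mx; exact: dyadic_ge0.
move=> w; apply: continuous_cvg; first exact: cx.
exact: cvg_dyadic_floor.
Qed.

End measurable_clock.

(** * Paths on a compact interval *)

Section paths_on_interval.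
Context {R : realType} {T : R}.
Hypothesis T0 : 0 < T.
Local Notation I := `[0, T]%classic.

Lemma set_val_itv (t : I) : 0 <= set_val t <= T.
Proof. by case: t => t tI; have := set_mem tI; rewrite /= in_itv. Qed.

Lemma set_val_inj (s t : I) : set_val s = set_val t -> s = t.
Proof. by move=> E; apply: val_inj. Qed.

Lemma clamp_itv (s : R) : I (Num.min (Num.max 0 s) T).
Proof.
rewrite /= in_itv /=; apply/andP; split; last by rewrite ge_min lexx orbT.
by rewrite le_min le_max lexx (ltW T0).
Qed.

Definition clamp (s : R) : I := SigSub (mem_set (clamp_itv s)).

Lemma set_val_clamp s : set_val (clamp s) = Num.min (Num.max 0 s) T.
Proof. by []. Qed.

Lemma clampK (t : I) : clamp (set_val t) = t.
Proof.
apply: set_val_inj; have /andP[t0 tT] := set_val_itv t.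
by rewrite set_val_clamp max_r// min_l.
Qed.

Lemma clamp_homo s t : s <= t -> set_val (clamp s) <= set_val (clamp t).
Proof.
move=> st; rewrite !set_val_clamp le_min ge_min ge_max le_max lexx /=.
by rewrite le_max st orbT /= ge_min lexx orbT.
Qed.

Lemma clamp_continuous : continuous clamp.
Proof.
apply: continuous_comp_initial => s.
apply: (@continuous_min R R (cst 0 \max id) (cst T) s); last exact: cvg_cst.
by apply: (@continuous_max R R (cst 0) id s); [exact: cvg_cst|exact: cvg_id].
Qed.

Lemma near_set_val (t : I) (e : R) : 0 < e ->
  \forall s \near t, `|set_val t - set_val s| < e.
Proof.
move=> e0; have := @initial_continuous _ _ (set_val : I -> R) t.
by move/cvgrPdist_lt => /(_ e e0).
Qed.

Section variation.
Context {X : normedModType R}.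
Implicit Types f : I -> X.

Lemma finite_pvar_control (p : R) f (Gam : I -> R) (B : R) : 0 < p ->
  (forall t, 0 <= Gam t <= B) ->
  (forall s t, set_val s < set_val t -> `|f t - f s| `^ p <= Gam t - Gam s) ->
  finite_pvar I X p f.
Proof.
move=> p0 GB fG; apply: (@le_lt_trans _ _ (B `^ p^-1)%:E); last exact: ltry.
apply: ge_ereal_sup => _ [n [s [_ inc ->]]]; rewrite lee_fin.
have B0 : 0 <= B by have /andP[h1 h2] := GB (clamp 0); exact: le_trans h2.
have S0 : 0 <= \sum_(k < n) `|f (s k.+1) - f (s k)| `^ p.
  by apply: sumr_ge0 => k _; exact: powR_ge0.
apply: ge0_ler_powR; rewrite ?nnegrE ?invr_ge0 ?(ltW p0)//.
apply: (@le_trans _ _ (\sum_(k < n) (Gam (s k.+1) - Gam (s k)))).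
  by apply: ler_sum => k _; apply: fG; apply: inc.
rewrite -(big_mkord xpredT (fun k => Gam (s k.+1) - Gam (s k))) telescope_sumr//.
by have /andP[h1 h2] := GB (s n); have /andP[h3 h4] := GB (s 0%N); lra.
Qed.

Lemma finite_pvar_locW (p : R) f : finite_pvar I X p f -> finite_pvar_loc I X p f.
Proof.
move=> fp A _; apply: le_lt_trans fp; apply: ereal_sup_le => _ [n [s [_ inc ->]]] /=.
by exists n, s.
Qed.

(** Repeated points do not contribute to the sum, and can be dropped to get a strictly
increasing sequence. *)
Lemma power_sum_increasing (p a : R) f l : 0 < p -> path <=%R a l ->
  exists n (s : nat -> I), [/\ increasing_upto n s, s 0%N = clamp a &
    power_sum p (f \o clamp) a l = \sum_(k < n) `|f (s k.+1) - f (s k)| `^ p].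
Proof.
move=> p0; elim: l a => [a _|b l IH a /= /andP[ab pl]].
  by exists 0%N, (fun=> clamp a); split=> //; rewrite big_ord0.
have [n [s [inc s0 ->]]] := IH b pl.
have := clamp_homo ab; rewrite le_eqVlt => /orP[/eqP/set_val_inj E|lt].
  by exists n, s; split; rewrite ?s0 ?E// subrr normr0 powR0 ?gt_eqF// add0r.
exists n.+1, (fun k => if k is k'.+1 then s k' else clamp a); split=> //.
  by move=> [_|k]; [rewrite s0|rewrite ltnS; exact: inc].
by rewrite big_ord_recl /= s0.
Qed.

Lemma finite_pvar_power_sum (p : R) f : 0 < p -> finite_pvar I X p f ->
  exists C, forall l, path <=%R 0 l -> power_sum p (f \o clamp) 0 l <= C.
Proof.
move=> p0; rewrite /finite_pvar /= => fp.
have [B BP] : exists B : R, (pvariation p f setT <= B%:E)%E.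
  move: fp; case: pvariation => [r|//|] _; first by exists r.
  by exists 0; rewrite leNye.
exists (Num.max B 0 `^ p) => l /(power_sum_increasing f p0)[n [s [inc _ ->]]].
set S := \sum_(_ < _) _; have S0 : 0 <= S by apply: sumr_ge0 => k _; exact: powR_ge0.
have : S `^ p^-1 <= B.
  rewrite -lee_fin; apply: le_trans BP; apply: ereal_sup_ubound.
  by exists n, s; split.
have E : S = (S `^ p^-1) `^ p by rewrite -powRrM mulVf ?gt_eqF// powRr1.
move=> SB; rewrite E; apply: ge0_ler_powR; rewrite ?nnegrE ?powR_ge0 ?(ltW p0)//.
  by rewrite le_max lexx orbT.
by rewrite le_max SB.
Qed.

End variation.

Section solution_paths.
Context {d e : nat}.
Variables (F : 'cV[R]_e -> set 'M[R]_(e, d)) (K M a b : R).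
Variables (xi : 'cV[R]_e) (y : R -> 'cV[R]_d) (Z : R -> 'cV[R]_e) (V : R -> 'M[R]_(e, d)).
Variables (x : I -> 'cV[R]_d) (th : I -> R).
Hypothesis K0 : 0 <= K.
Hypothesis M0 : 0 <= M.
Hypothesis a01 : 0 < a < 1.
Hypothesis b01 : 0 < b < 1.
Hypothesis ab12 : 2 * (a * b) < 1.
Hypothesis yM : driver_bound M a y.
Hypothesis sol : dyadic_solution F K a b xi y Z V.
Hypothesis th01 : forall t, 0 <= th t < 1.
Hypothesis th_start : forall t, set_val t = 0 -> th t = 0.
Hypothesis th_lt : forall s t, set_val s < set_val t -> th s < th t.
Hypothesis th_unif : forall ep : R, 0 < ep -> exists2 dl, 0 < dl &
  forall s t, `|set_val t - set_val s| < dl -> `|th t - th s| < ep.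
Hypothesis xy : forall t, x t = y (th t).

Lemma clock_near (t : I) (ep : R) : 0 < ep -> \forall s \near t, `|th t - th s| < ep.
Proof.
move=> ep0; have [dl dl0 dlP] := th_unif ep0.
by apply: filterS (near_set_val t dl0) => s; exact: dlP.
Qed.

Lemma position_path q : 0 < q -> a `^ q = 2^-1 -> continuous_pvar I 'cV[R]_e q (Z \o th).
Proof.
move=> q0 aq; split.
  have [C [C0 CP]] := position_variation K0 M0 a01 b01 yM sol q0 aq.
  apply: (@finite_pvar_control _ q _ (fun t => C * th t) C) => //.
    move=> t; have /andP[t0 t1] := th01 t.
    by rewrite mulr_ge0//= ler_piMr// ltW.
  move=> s t st; rewrite -mulrBr; apply: CP; last by case/andP: (th01 t).
    by case/andP: (th01 s).
  exact: th_lt.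
move=> t; apply: (cvgrPdist_lt (FF := nbhs_filter t) (Z \o th) (Z (th t))).2 => ep ep0.
set C := 2 * K + d%:R * K * M + d%:R * K * M.
have /cvgrPdist_lt/(_ ep ep0)[l _ /(_ l (leqnn l))] := cvg_geometric0 C a01.
rewrite sub0r normrN => lP; have l0 : (0 : R) < 2 ^- l by rewrite invr_gt0 exprn_gt0.
have inc (s t' : I) : set_val s < set_val t' -> `|th t' - th s| < 2 ^- l ->
    `|Z (th t') - Z (th s)| < ep.
  move=> st lt; have sth := th_lt st.
  apply: le_lt_trans lP; apply: le_trans (ler_norm _).
  apply: (position_increment K0 M0 a01 b01 yM sol) => //.
  - by case/andP: (th01 s).
  - by case/andP: (th01 t').
  - by rewrite (le_trans (ler_norm _))// ltW.
apply: filterS (clock_near t l0) => s ts /=.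
have [lt|gt|/set_val_inj ->] := ltgtP (set_val s) (set_val t).
- exact: inc.
- by rewrite distrC; apply: inc => //; rewrite distrC.
by rewrite subrr normr0.
Qed.

Lemma velocity_path_pvar p : 0 < p -> 2 * b `^ p < 1 ->
  finite_pvar I 'M[R]_(e, d) p (V \o th).
Proof.
move=> p0 bp; have [Gam [B [B0 GB GV]]] := velocity_variation K0 b01 sol p0 bp.
apply: (@finite_pvar_control _ p _ (Gam \o th) B) => // [t|s t st]; first exact: GB.
apply: GV; [by case/andP: (th01 s)|exact: th_lt|by case/andP: (th01 t)].
Qed.

Lemma th_le s t : set_val s <= set_val t -> th s <= th t.
Proof. by rewrite le_eqVlt => /orP[/eqP/set_val_inj ->//|/th_lt/ltW]. Qed.

Lemma velocity_path_cadlag : cadlag (V \o th).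
Proof.
split=> t.
  apply/cvgrPdist_lt => ep ep0.
  have [dl dl0 dlP] := velocity_right_continuous b01 sol (th01 t) ep0.
  rewrite /prop_near1 /within /=; apply: filterS (clock_near t dl0) => s ts st.
  rewrite distrC; apply: dlP; [exact: th_le| |by case/andP: (th01 s)].
  by have := th_le st; move: ts; rewrite ltr_norml; lra.
have [t0|t0] := leP (set_val t) 0.
  exists 0; apply/cvgrPdist_lt => ep ep0; rewrite /prop_near1 /within /=.
  apply: nearW => s st; have /andP[s0 _] := set_val_itv s.
  by move: (lt_le_trans st (le_trans t0 s0)); rewrite ltxx.
have z0 : set_val (clamp 0) = 0 by rewrite set_val_clamp max_l// min_l// ltW.
have tht0 : 0 < th t by rewrite -(th_start z0); apply: th_lt; rewrite z0.
have tht1 : th t < 1 by case/andP: (th01 t).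
have [w wP] := velocity_left_limit b01 sol tht0 tht1.
exists w; apply/cvgrPdist_lt => ep ep0; have [dl dl0 dlP] := wP ep ep0.
rewrite /prop_near1 /within /=; apply: filterS (clock_near t dl0) => s ts st.
apply: dlP; [by case/andP: (th01 s)| |exact: th_lt].
by move: ts; rewrite ltr_norml; lra.
Qed.

(** The error of a Young sum is the sum of the defects over its intervals, and the
control of [defect_control] telescopes. *)
Lemma velocity_path_young t : is_young_integral (V \o th) x t (Z (th t) - xi).
Proof.
move=> ep ep0.
have [rho [Gam [B [rho01 B0 GB defP]]]] := defect_control K0 M0 a01 b01 ab12 yM sol.
have rho0 : 0 < rho by case/andP: rho01.
have /cvgrPdist_lt/(_ ep ep0)[l _ /(_ l (leqnn l))] := cvg_geometric0 B rho01.
rewrite sub0r normrN => lP; have l0 : (0 : R) < 2 ^- l by rewrite invr_gt0 exprn_gt0.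
have [dl dl0 dlP] := th_unif l0; exists dl => // n s inc s0 sn mesh.
have -> : Z (th t) - xi = \sum_(k < n) (Z (th (s k.+1)) - Z (th (s k))).
  rewrite -(big_mkord xpredT (fun k => Z (th (s k.+1)) - Z (th (s k)))) telescope_sumr//.
  by rewrite sn (th_start s0) (solution_start sol).
rewrite -sumrB (eq_bigr (fun k : 'I_n => - defect y Z V (th (s k)) (th (s k.+1)))); last first.
  by move=> k _; rewrite /defect [RHS]opprB !xy.
apply: le_lt_trans lP; apply: le_trans (ler_norm _).
rewrite sumrN normrN (le_trans (ler_norm_sum _ _ _))//.
apply: (@le_trans _ _ (\sum_(k < n) rho ^+ l * (Gam (th (s k.+1)) - Gam (th (s k))))).
  apply: ler_sum => k _; apply: defP.
  - by case/andP: (th01 (s k)).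
  - by apply: th_lt; apply: inc.
  - by case/andP: (th01 (s k.+1)).
  - rewrite (le_trans (ler_norm _))// ltW//; apply: dlP.
    by rewrite gtr0_norm ?subr_gt0; [apply: mesh|apply: inc].
rewrite -mulr_sumr -(big_mkord xpredT (fun k => Gam (th (s k.+1)) - Gam (th (s k)))).
rewrite telescope_sumr// mulrC ler_wpM2r ?exprn_ge0 ?(ltW rho0)//.
have /andP[h1 h2] := GB _ (th01 (s n)); have /andP[h3 h4] := GB _ (th01 (s 0%N)).
by move: h2 h3; lra.
Qed.

End solution_paths.

End paths_on_interval.

Lemma uniformly_continuous_itv {R : realType} (T : R) (f : R -> R) : continuous f ->
  forall ep, 0 < ep -> exists2 dl, 0 < dl &
    forall s t, 0 <= s <= T -> `|t - s| < dl -> `|f t - f s| < ep.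
Proof.
move=> cf ep ep0; have /compact_near_coveringP cI := segment_compact (a := 0) (b := T).
have near_dl : \forall dl \near (0 : R)^'+, `[0, T]%classic `<=`
    [set s | forall t, `|t - s| < dl -> `|f t - f s| < ep].
  apply: cI => s sI; have ep2 : 0 < ep / 2 by rewrite divr_gt0.
  have /cvgrPdist_lt/(_ _ ep2)/nbhs_ballP[r /= r0 rP] := cf s.
  have r2 : 0 < r / 2 by rewrite divr_gt0.
  exists (ball s (r / 2), [set dl | dl < r / 2]) => /=.
    by split; [exact: nbhsx_ballx|exact: nbhs_right_lt].
  move=> [s' dl] /= []; rewrite -ball_normE /= => ss' dlr t ts'.
  have h1 : `|f s - f s'| < ep / 2 by apply: rP; rewrite -ball_normE /=; lra.
  have h2 : `|f s - f t| < ep / 2.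
    apply: rP; rewrite -ball_normE /=; have := ler_distD s' s t.
    by rewrite (distrC s' t); lra.
  have := ler_distD (f s) (f t) (f s'); rewrite (distrC (f t) (f s)); lra.
near (0 : R)^'+ => dl; exists dl; first by near: dl; exact: nbhs_right_gt.
move=> s t s0T; suff : `[0, T]%classic `<=`
    [set s | forall t, `|t - s| < dl -> `|f t - f s| < ep].
  by apply; rewrite /= in_itv.
by near: dl.
Unshelve. all: by end_near. Qed.

(** * The measurable selection theorem *)

Lemma measurable_evaluation_continuous {R : realType} (E : set R) (m n : nat) (q : R) (t : E) :
  measurable_entries (fun p : continuous_path_space E 'M[R]_(m, n) q => set_val p t).
Proof.
apply/measurable_entries_borel => _ B mB; apply: sub_sigma_algebra.
by exists t => //; exists B.
Qed.

Lemma powR2N_lt1 {R : realType} (r : R) : 0 < r -> 2 `^ (- r) < 1.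
Proof.
move=> r0; rewrite powRN invf_lt1 ?powR_gt0//.
have := @gt0_ltr_powR R r r0 1 2; rewrite powR1 !nnegrE; apply=> //.
exact: ltr1n.
Qed.

Lemma double_powR2N_lt1 {R : realType} (r : R) : 1 < r -> 2 * 2 `^ (- r) < 1.
Proof.
move=> r1; have -> : 2 * 2 `^ (- r) = 2 `^ (- (r - 1)).
  rewrite opprB addrC powRD; last by rewrite pnatr_eq0 implybT.
  by rewrite powRr1// mulrC.
by apply: powR2N_lt1; rewrite subr_gt0.
Qed.

Lemma measurable_to_continuous_paths {R : realType} dm (Om : measurableType dm) (E : set R)
    (m n : nat) (q : R) (f : Om -> continuous_path_space E 'M[R]_(m, n) q) :
  (forall t, measurable_entries (fun w => set_val (f w) t)) -> measurable_fun setT f.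
Proof.
move=> mf; apply: (@measurability _ _ _ (continuous_path_space E 'M[R]_(m, n) q) setT f
  (cylinders (fun p : continuous_path_space E 'M[R]_(m, n) q => set_val p))); first by [].
move=> _ [_ [t _ [B mB <-]] <-]; rewrite !setTI.
have /measurable_entries_borel := mf t.
by move=> /(_ measurableT B mB); rewrite setTI.
Qed.

Lemma measurable_to_cadlag_paths {R : realType} dm (Om : measurableType dm) (E : set R)
    (m n : nat) (r : R) (f : Om -> cadlag_path_space E 'M[R]_(m, n) r) :
  (forall t, measurable_entries (fun w => set_val (f w) t)) -> measurable_fun setT f.
Proof.
move=> mf; apply: (@measurability _ _ _ (cadlag_path_space E 'M[R]_(m, n) r) setT f
  (cylinders (fun p : cadlag_path_space E 'M[R]_(m, n) r => set_val p))); first by [].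
move=> _ [_ [t _ [B mB <-]] <-]; rewrite !setTI.
have /measurable_entries_borel := mf t.
by move=> /(_ measurableT B mB); rewrite setTI.
Qed.

Theorem theoremI1p3 (R : realType) (T : R) (d e : nat) (q gamma : R)
    (F : 'cV[R]_e -> set 'M[R]_(e, d)) :
  0 < T -> (1 <= d)%N -> (1 <= e)%N ->
  1 <= q < 2 -> q - 1 < gamma <= 1 ->
  (forall a, nonempty_compacts (F a)) ->
  holder gamma F ->
  let I := `[0, T]%classic in
  let Omega := (borel 'cV[R]_e * continuous_path_space I 'cV[R]_d q)%type in
  exists (z : Omega -> continuous_path_space I 'cV[R]_e q)
         (v : Omega -> cadlag_path_space I 'M[R]_(e, d) (q / gamma)),
    [/\ forall w : Omega,
          global_solution q F w.1 (set_val w.2) (set_val (z w)) (set_val (v w)),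
        measurable_fun [set: Omega] z &
        measurable_fun [set: Omega] v].
Proof.
move=> T0 _ _ q12 /andP[qg g1] Fc hF I Omega.
have q0 : 0 < q by case/andP: q12 => + _; apply: lt_le_trans.
have g0 : 0 < gamma by case/andP: q12; move: qg; lra.
have F0 a : F a !=set0 by case: (Fc a).
have cF a : closed (F a) by apply: compact_closed; [exact: norm_hausdorff|case: (Fc a)].
have [H H0 FH] := holder_hoelder_bound F0 hF.
have [pi [piF mpi]] := nearest_point_selector g0 H0 F0 cF FH.
pose a : R := 2 `^ (- q^-1); pose b := a `^ gamma.
have a01 : 0 < a < 1 by rewrite powR_gt0//= powR2N_lt1// invr_gt0.
have bE : b = 2 `^ (- (gamma / q)) by rewrite /b /a -powRrM mulNr mulrC.
have b01 : 0 < b < 1 by rewrite powR_gt0 ?powR_gt0//= bE powR2N_lt1// divr_gt0.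
have ab12 : 2 * (a * b) < 1.
  rewrite bE /a -powRD; last by rewrite pnatr_eq0 implybT.
  rewrite -opprD; apply: double_powR2N_lt1.
  have -> : q^-1 + gamma / q = (1 + gamma) / q by rewrite mulrDl mul1r.
  by rewrite ltr_pdivlMr// mul1r; move: qg; lra.
have bp p : q / gamma < p -> 2 * b `^ p < 1.
  move=> qp; rewrite bE -powRrM mulNr; apply: double_powR2N_lt1.
  by rewrite mulrAC ltr_pdivlMr// mul1r mulrC -ltr_pdivrMr.
have aq : a `^ q = 2^-1 by rewrite /a -powRrM mulNr mulVf ?gt_eqF// powR_inv1.
pose x (w : Omega) : R -> 'cV[R]_d := set_val w.2 \o clamp T0.
have mxi : measurable_entries (fun w : Omega => w.1 : 'cV[R]_e).
  by apply/measurable_entries_borel; exact: measurable_fst.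
have mx t : 0 <= t -> measurable_entries (fun w => x w t).
  move=> _ i j; rewrite /x /=.
  exact: (measurableT_comp (measurable_evaluation_continuous (clamp T0 t) i j) (@measurable_snd _ _ _ _)).
have xpv (w : Omega) : continuous_pvar I 'cV[R]_d q (set_val w.2) := set_valP w.2.
have cx w : continuous (x w).
  move=> t; apply: continuous_comp; first exact: clamp_continuous.
  by case: (xpv w) => _; exact.
have xC w : exists C, forall l, path <=%R 0 l -> power_sum q (x w) 0 l <= C.
  by apply: finite_pvar_power_sum => //; case: (xpv w).
pose y w u := x w (clock_inverse q T (x w) u).
have /choice[M MP] (w : Omega) : exists M, 0 <= M /\ driver_bound M a (y w).
  have [C xCw] := xC w; have [M M0 yM] := clock_driver_bound q12 T0 (@cx w) xCw.
  by exists M.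
have g01 : 0 < gamma <= 1 by rewrite g0.
have my u : 0 <= u -> measurable_entries (y ^~ u).
  exact: (measurable_driver q12 T0 mx cx xC).
have [Z [V [ZV mZV]]] := measurable_dyadic_solutions g01 H0 F0 cF FH a01 ab12 piF mpi mxi
  my (fun w => (MP w).1) (fun w => (MP w).2).
pose th w (t : I) := clock q T (x w) (set_val t).
have th01 w t : 0 <= th w t < 1.
  by have [C xCw] := xC w; exact: (clock_itv q12 T0 xCw (set_val_itv t)).
have th_start w t : set_val t = 0 -> th w t = 0.
  by have [C xCw] := xC w; rewrite /th => ->; exact: (clock0 T q12 xCw).
have th_lt w s t : set_val s < set_val t -> th w s < th w t.
  by have [C xCw] := xC w; rewrite /th (clock_lt q12 T0 xCw).
have th_unif w (ep : R) : 0 < ep -> exists2 dl, 0 < dl &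
    forall s t : I, `|set_val t - set_val s| < dl -> `|th w t - th w s| < ep.
  have [C xCw] := xC w; have cth := clock_continuous q12 (@cx w) xCw.
  move=> /(uniformly_continuous_itv T (cth T))[dl dl0 dlP]; exists dl => // s t.
  by apply: dlP; exact: set_val_itv.
have xy (w : Omega) t : set_val w.2 t = y w (th w t).
  have [C xCw] := xC w; have /andP[t0 _] := set_val_itv t.
  by rewrite /y /th (clockK q12 T0 (@cx w) xCw t0) /x /= clampK.
have zP w : continuous_pvar I 'cV[R]_e q (Z w \o th w).
  have [K K0 sol] := ZV w; have [M0 yM] := MP w.
  exact: (position_path T0 K0 M0 a01 b01 yM sol (th01 w) (th_lt w) (th_unif w) q0 aq).
have vp w p : q / gamma < p -> finite_pvar I 'M[R]_(e, d) p (V w \o th w).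
  have [K K0 sol] := ZV w => qp.
  have p0 : 0 < p by rewrite (lt_trans _ qp)// divr_gt0.
  exact: (velocity_path_pvar T0 K0 b01 sol (th01 w) (th_lt w) p0 (bp p qp)).
have vP w : cadlag_pvar_plus I 'M[R]_(e, d) (q / gamma) (V w \o th w).
  move=> p qp; split; first exact: vp.
  have [K K0 sol] := ZV w.
  exact: (velocity_path_cadlag T0 b01 sol (th01 w) (th_start w) (th_lt w) (th_unif w)).
exists (fun w => SigSub (mem_set (zP w))), (fun w => SigSub (mem_set (vP w))).
have mth t : measurable_fun setT (fun w => th w t).
  have /andP[t0 _] := set_val_itv t.
  exact: (measurable_clock q12 T0 mx cx xC t0).
split.
- move=> w; have [K K0 sol] := ZV w; have [M0 yM] := MP w.
  split.
  + by have [h1 h2] := zP w; split => //; exact: finite_pvar_locW.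
  (* The conditions on [p = 1 / r] are [1 - 1 / q < r < gamma / q], an interval which
  is not empty because [q - 1 < gamma]. *)
  + pose r := (gamma / q + (1 - q^-1)) / 2; exists r^-1.
    have gq : 1 - q^-1 < gamma / q.
      by rewrite ltr_pdivlMr// mulrBl mul1r mulVf ?gt_eqF.
    have q1 : 0 <= 1 - q^-1 by rewrite subr_ge0 invf_le1//; case/andP: q12.
    have gq0 : 0 < gamma / q by rewrite divr_gt0.
    have gq1 : gamma / q <= 1.
      by rewrite ler_pdivrMr// mul1r (le_trans g1)//; case/andP: q12.
    have r0 : 0 < r by rewrite /r; lra.
    have rgq : r < gamma / q by rewrite /r; lra.
    split.
    * by rewrite invf_ge1// (le_trans (ltW rgq)).
    * by rewrite invrK /r; lra.
    * apply: finite_pvar_locW; apply: vp.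
      by rewrite -[q / gamma]invrK invf_div ltf_pV2 ?posrE.
  + move=> t; split; last exact: (solution_value sol).
    exists (Z w (th w t) - w.1); last by rewrite addrC subrK.
    exact: (velocity_path_young K0 M0 a01 b01 ab12 yM sol (th01 w) (th_start w) (th_lt w)
      (th_unif w) (xy w)).
- apply: measurable_to_continuous_paths => t.
  by have [] := mZV (fun w => th w t) (mth t) (fun w => th01 w t).
- apply: measurable_to_cadlag_paths => t.
  by have [] := mZV (fun w => th w t) (mth t) (fun w => th01 w t).
Qed.
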